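(* For any choice of positive numbers $a_1,a_2,a_3$ there exists at least one free boundary minimal surface of genus $0$ with $6$ boundary components in the rectangular prism in $\mathbb R^3$ with side lengths $a_1,a_2,a_3$. Moreover, each boundary component lies in the interior of one of the faces of the prism.
   Context: The rectangular prism with side lengths $a_1,a_2,a_3$ is (up to rigid motion) $[0,a_1]\times[0,a_2]\times[0,a_3]$. A free boundary minimal surface of genus $0$ with $6$ boundary components in a prism $P$ is the image of a minimal immersion into $P$ of a compact connected genus $0$ surface with $6$ boundary components, smooth up to the boundary, which maps the boundary into $\partial P$ and meets $\partial P$ orthogonally along the boundary (the outward unit conormal of the surface equals the outward unit normal to the face). *)

(* Defs.v *)
From mathcomp Require Import all_boot all_order all_algebra.
From mathcomp Require Import all_classical all_reals all_analysis.
Import Order.TTheory GRing.Theory Num.Theory.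
Import numFieldNormedType.Exports.

Set Implicit Arguments.
Unset Strict Implicit.
Unset Printing Implicit Defensive.

Local Open Scope classical_set_scope.
Local Open Scope ring_scope.

(* The library norm on 'rV[R]_n is the sup norm; lengths and angles below are
   taken with respect to the Euclidean inner product. *)
Definition dotv (R : realType) n (u v : 'rV[R]_n) : R :=
  \sum_(i < n) u 0 i * v 0 i.

Definition enorm (R : realType) n (u : 'rV[R]_n) : R := Num.sqrt (dotv u u).

(* Indices are added modulo 3. *)
Definition crossv (R : realType) (u v : 'rV[R]_3) : 'rV[R]_3 :=
  \row_(i < 3) (u 0 (i + 1) * v 0 (i + 1 + 1) - u 0 (i + 1 + 1) * v 0 (i + 1)).

(* A compact connected surface of genus 0 with k.+1 boundary components is a
   sphere with k.+1 disjoint open discs removed.  Removing the first one leaves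
   a closed disc, so the surface is presented as the closed unit disc of the
   plane minus k open round discs whose closures are pairwise disjoint and lie
   in the open unit disc.  By the classification of surfaces this is the
   general case up to diffeomorphism; the centers and radii are left free. *)
Record holed_disc (R : realType) (k : nat) := HoledDisc {
  hole_center : 'I_k -> 'rV[R]_2;
  hole_radius : 'I_k -> R;
  hole_radius_gt0 : forall i, 0 < hole_radius i;
  hole_in_disc : forall i, enorm (hole_center i) + hole_radius i < 1;
  holes_disjoint : forall i j, i != j ->
    hole_radius i + hole_radius j < enorm (hole_center i - hole_center j)
}.

Section Surface.
Variables (R : realType) (k : nat) (D : holed_disc R k).

Definition carrier : set 'rV[R]_2 :=
  [set p | enorm p <= 1 /\
           forall i, hole_radius D i <= enorm (p - hole_center D i)].

(* [None] is the outer circle, [Some i] the circle bounding the i-th hole. *)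
Definition boundary_component (b : option 'I_k) : set 'rV[R]_2 :=
  if b is Some i then [set p | enorm (p - hole_center D i) = hole_radius D i]
  else [set p | enorm p = 1].

(* Normal to the given boundary circle at p, pointing out of [carrier]. *)
Definition domain_normal (b : option 'I_k) (p : 'rV[R]_2) : 'rV[R]_2 :=
  if b is Some i then hole_center D i - p else p.

End Surface.

Section Immersion.
Variable R : realType.
Implicit Types (X : 'rV[R]_2 -> 'rV[R]_3) (p : 'rV[R]_2).

Definition partial (i : 'I_2) X : 'rV[R]_2 -> 'rV[R]_3 :=
  fun p => 'D_(delta_mx 0 i) X p.

(* C^infinity on U: the iterated partial derivatives of all orders are
   differentiable at every point of U. *)
Definition smooth_on (U : set 'rV[R]_2) X : Prop :=
  forall (s : seq 'I_2) p, U p -> differentiable (foldr partial X s) p.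

(* Smooth up to the boundary: X is smooth on a neighbourhood of A. *)
Definition smooth_up_to_boundary (A : set 'rV[R]_2) X : Prop :=
  exists U, [/\ open U, A `<=` U & smooth_on U X].

(* The rows of the Jacobian are the two partial derivatives, and v *m 'J X p is
   the image of v under the differential of X at p. *)
Definition immersive_at X p : bool := row_free ('J X p).

Definition unit_normal X p : 'rV[R]_3 :=
  let N := crossv (partial 0 X p) (partial 1 X p) in (enorm N)^-1 *: N.

Definition first_form X p : 'M[R]_2 :=
  \matrix_(i, j) dotv (partial i X p) (partial j X p).

Definition second_form X p : 'M[R]_2 :=
  \matrix_(i, j) dotv (partial i (partial j X) p) (unit_normal X p).

Definition mean_curvature X p : R :=
  2^-1 * \tr (invmx (first_form X p) *m second_form X p).

(* w is the outward unit conormal at the boundary point p of the domain, where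
   nu is an outward normal of the domain at p. *)
Definition outward_unit_conormal X p (nu : 'rV[R]_2) (w : 'rV[R]_3) : Prop :=
  [/\ enorm w = 1,
      exists2 v, w = v *m 'J X p & 0 < dotv v nu
    & forall t, dotv t nu = 0 -> dotv w (t *m 'J X p) = 0].

End Immersion.

Section Prism.
Variables (R : realType) (a : 'I_3 -> R).

Definition prism : set 'rV[R]_3 := [set x | forall i, 0 <= x 0 i <= a i].

(* The face (i, false) lies in the plane x_i = 0, the face (i, true) in the
   plane x_i = a_i. *)
Definition face_level (f : 'I_3 * bool) : R := if f.2 then a f.1 else 0.

Definition face (f : 'I_3 * bool) : set 'rV[R]_3 :=
  [set x | prism x /\ x 0 f.1 = face_level f].

Definition face_interior (f : 'I_3 * bool) : set 'rV[R]_3 :=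
  [set x | x 0 f.1 = face_level f /\ forall j, j != f.1 -> 0 < x 0 j < a j].

Definition face_normal (f : 'I_3 * bool) : 'rV[R]_3 :=
  if f.2 then delta_mx 0 f.1 else - delta_mx 0 f.1.

Definition prism_boundary : set 'rV[R]_3 := \bigcup_f face f.

End Prism.

(* X exhibits S as a free boundary minimal surface in the prism, of genus 0 and
   with k.+1 boundary components. *)
Definition free_boundary_minimal (R : realType) (a : 'I_3 -> R) (k : nat)
    (D : holed_disc R k) (X : 'rV[R]_2 -> 'rV[R]_3) (S : set 'rV[R]_3) : Prop :=
  [/\ S = X @` carrier D,
      S `<=` prism a,
      smooth_up_to_boundary (carrier D) X,
      forall p, carrier D p -> immersive_at X p /\ mean_curvature X p = 0
    & forall b p, boundary_component D b p ->
        prism_boundary a (X p) /\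
        forall f, face a f (X p) ->
          outward_unit_conormal X p (domain_normal D b p) (face_normal R f)].

(* Main.v *)
(* The surface belongs to the Schwarz P family, written in separated form
   [t_1 (x_1) + t_2 (x_2) + t_3 (x_3) = - pi / 2].  The profile of axis [l] depends on an
   angle [g_l] in [(0, pi)] and satisfies [t'^2 = cos (t + g) cos t / sin g], i.e.
   [t'^2 = (cos th + cos g) / (2 sin g)] with [th = 2 t + g].  If [g_1 + g_2 + g_3 = pi]
   then [th_1 + th_2 + th_3 = 0] on the surface, and the minimal surface equation for a
   separated level set, [sum_l t_l'' (t_{l+1}'^2 + t_{l+2}'^2) = 0], becomes the addition
   theorem for the sine.  The derivative [t_l'] vanishes where [t_l = - pi / 2], so there
   the surface meets the planes [x_l = const] orthogonally; these planes bound the prism.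

   The distance from the midplane to such a plane is an elliptic integral of [g_l]
   (called the half-period), and an intermediate value argument gives angles with sum
   [pi] for which the three half-periods are proportional to the side lengths.

   For the parametrization, a signed square root [psi_l] replaces [x_l], so that the face
   is at [psi_l ^ 2 = 1 + w_l].  Along each ray of the [psi]-space pointing into the
   sphere minus six round caps the level function first vanishes at a simple zero, at
   distance [rho]; the implicit function theorem makes [rho] smooth.  Stereographic
   projection turns the sphere minus six caps into a disc with five round holes, and on a
   boundary circle [psi_l = +- sqrt (1 + w_l)]. *)
Require Import Defs.
From mathcomp Require Import all_boot all_order all_algebra.
From mathcomp Require Import all_classical all_reals all_analysis.
From mathcomp Require Import ring lra.
Import Order.TTheory GRing.Theory Num.Theory.
Import numFieldNormedType.Exports.
Local Open Scope classical_set_scope.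
Local Open Scope ring_scope.

Set Implicit Arguments.
Unset Strict Implicit.
Unset Printing Implicit Defensive.

(** * Calculus on the line *)

Section OneVariable.
Context {R : realType}.
Implicit Types (f g : R -> R) (x a b : R).

(** Both ends of a profile are turning points: [t_l'] vanishes at the face and, by symmetry, at the
    midplane, so the space coordinate is singular there as a function of [t_l]. Writing
    [t = 2 atan (ev v)] with a cubic [ev] critical at [v = -1] removes the singularity at the face,
    and [v = w - x ^ 2] the one at the midplane. The profile then continues smoothly past the face,
    which yields smoothness on an open neighbourhood of the closed domain. The caps are round
    because [ev] is odd. On a face of axis [i], [t_i = - pi / 2] leaves [t_j + t_k = 0], hence
    [v_j = - v_k]; with [v_i = -1] the sum of the [psi_l ^ 2 = w_l - v_l] is the constant
    [1 + w_1 + w_2 + w_3]. So all six boundary curves are plane sections of one sphere around the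
    origin of the psi-space, known before any integral is computed. The half-period takes
    arbitrarily small values near both ends of [(0, pi)]. It is not monotone, which forces the
    period problem to work with two branches. *)

Lemma is_derive_eqf f x a b : is_derive x 1 f a -> a = b -> is_derive x 1 f b.
Proof. by move=> + <-. Qed.

Lemma is_derive_cstf x a : is_derive x 1 (fun _ : R => a) 0.
Proof. exact: is_derive_cst. Qed.

Lemma is_derive_idf x : is_derive x 1 (fun t : R => t) 1.
Proof. exact: is_derive_id. Qed.

Lemma is_deriveDf f g x a b : is_derive x 1 f a -> is_derive x 1 g b ->
  is_derive x 1 (fun t => f t + g t) (a + b).
Proof. exact: is_deriveD. Qed.

Lemma is_deriveNf f x a : is_derive x 1 f a -> is_derive x 1 (fun t => - f t) (- a).
Proof. exact: is_deriveN. Qed.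

Lemma is_deriveMf f g x a b : is_derive x 1 f a -> is_derive x 1 g b ->
  is_derive x 1 (fun t => f t * g t) (a * g x + f x * b).
Proof.
by move=> fa gb; rewrite addrC [a * _]mulrC; exact: is_deriveM.
Qed.

Lemma is_derive_compf f g x a b : is_derive (f x) 1 g b -> is_derive x 1 f a ->
  is_derive x 1 (fun t => g (f t)) (b * a).
Proof. by move=> gb fa; apply: is_derive1_comp. Qed.

Lemma is_deriveXf f n x a : is_derive x 1 f a ->
  is_derive x 1 (fun t => f t ^+ n) (n%:R * f x ^+ n.-1 * a).
Proof.
move=> fa; rewrite (_ : (fun t => f t ^+ n) = f ^+ n); first exact: is_deriveX.
by apply/funext => t; rewrite exprfctE.
Qed.

Lemma is_deriveVf f x a : f x != 0 -> is_derive x 1 f a ->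
  is_derive x 1 (fun t => (f t)^-1) (- a / f x ^+ 2).
Proof.
move=> fx0 fa; rewrite mulrC mulrN -mulNr; exact: is_deriveV.
Qed.

Lemma is_derive_sqrtf f x a : 0 < f x -> is_derive x 1 f a ->
  is_derive x 1 (fun t => Num.sqrt (f t)) (a / (2 * Num.sqrt (f x))).
Proof.
by move=> fx0 fa; rewrite mulrC; apply: is_derive_compf => //; exact: is_derive1_sqrt.
Qed.

Lemma is_derive_sinf f x a : is_derive x 1 f a ->
  is_derive x 1 (fun t => sin (f t)) (cos (f x) * a).
Proof. by move=> fa; apply: is_derive_compf. Qed.

Lemma is_derive_cosf f x a : is_derive x 1 f a ->
  is_derive x 1 (fun t => cos (f t)) (- sin (f x) * a).
Proof. by move=> fa; apply: is_derive_compf. Qed.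

Lemma is_derive_atanf f x a : is_derive x 1 f a ->
  is_derive x 1 (fun t => atan (f t)) (a / (1 + f x ^+ 2)).
Proof.
by move=> fa; rewrite mulrC; apply: is_derive_compf => //; exact: is_derive1_atan.
Qed.

Lemma is_derive_continuous f x a : is_derive x 1 f a -> {for x, continuous f}.
Proof.
by move=> fa; apply: differentiable_continuous; apply/derivable1_diffP; case: fa.
Qed.

End OneVariable.

(** Hypotheses are tried before the rules for sums, products and compositions, so a derivative fact
    in the context serves for the function it names. *)
Ltac derive_step :=
  first [ notypeclasses refine (is_derive_cstf _ _)
        | notypeclasses refine (is_derive_idf _)
        | eassumption
        | notypeclasses refine (is_deriveDf _ _)
        | notypeclasses refine (is_deriveNf _)
        | notypeclasses refine (is_deriveMf _ _)
        | notypeclasses refine (is_deriveXf _ _)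
        | notypeclasses refine (is_deriveVf _ _)
        | notypeclasses refine (is_derive_sqrtf _ _)
        | notypeclasses refine (is_derive_sinf _)
        | notypeclasses refine (is_derive_cosf _)
        | notypeclasses refine (is_derive_atanf _) ].
Ltac derive_tac := notypeclasses refine (is_derive_eqf _ _); [ repeat derive_step | ]; cbn beta.

(** * The half-period *)

Section HalfPeriod.
Context {R : realType}.
Implicit Types (k F : R -> R) (g u : R).

Definition pint k : R :=
  (\int[@lebesgue_measure R]_(x in `[0%R, pi]) k x)%R.

Lemma pint_integrable k : continuous k ->
  (@lebesgue_measure R).-integrable `[0%R, pi] (EFin \o k).
Proof.
move=> ck; apply: continuous_compact_integrable; first exact: segment_compact.
exact: continuous_subspaceT.
Qed.

Lemma le_pint k1 k2 : continuous k1 -> continuous k2 ->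
  (forall u, 0 <= u <= pi -> k1 u <= k2 u) -> pint k1 <= pint k2.
Proof.
move=> c1 c2 le12; apply: le_Rintegral => //; try exact: pint_integrable.
Qed.

Lemma pintD k1 k2 : continuous k1 -> continuous k2 ->
  pint (fun u => k1 u + k2 u) = pint k1 + pint k2.
Proof. by move=> c1 c2; apply: RintegralD => //; exact: pint_integrable. Qed.

Lemma pintZ a k : continuous k -> pint (fun u => a * k u) = a * pint k.
Proof. by move=> c1; apply: RintegralZl => //; exact: pint_integrable. Qed.

Lemma pint_FTC k F : continuous k -> (forall u, is_derive u 1 F (k u)) ->
  pint k = F pi - F 0.
Proof.
move=> ck dF; rewrite /pint /Rintegral (@continuous_FTC2 _ _ F) //.
- exact: pi_gt0.
- exact: continuous_subspaceT.
- have cF : continuous F by move=> u; exact: is_derive_continuous (dF u).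
  split; first by move=> u _; case: (dF u).
  + exact: cvg_at_right_filter (cF 0).
  + exact: cvg_at_left_filter (cF pi).
- by move=> u _; rewrite derive1E; exact: derive_val.
Qed.

Definition Delta g u : R := 1 - cos (g / 2) ^+ 2 * cos u ^+ 2.

Lemma Delta_ge g u : sin (g / 2) ^+ 2 <= Delta g u.
Proof.
rewrite /Delta sin2cos2 lerD2l lerN2.
by have := cos2Dsin2 u; have := sqr_ge0 (sin u); have := sqr_ge0 (cos (g / 2)); nra.
Qed.

Lemma sin_half_gt0 g : 0 < g < pi -> 0 < sin (g / 2).
Proof. by move=> /andP[g0 gpi]; apply: sin_gt0_pi; have := @pi_gt0 R; lra. Qed.

Lemma cos_half_gt0 g : 0 < g < pi -> 0 < cos (g / 2).
Proof. by move=> /andP[g0 gpi]; apply: cos_gt0_pihalf; lra. Qed.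

Lemma sin_double g : sin g = 2 * sin (g / 2) * cos (g / 2).
Proof.
have -> : sin g = sin (g / 2 *+ 2) by congr sin; rewrite mulr2n; lra.
by rewrite sin_mulr2n mulr2n; lra.
Qed.

Lemma cos_double g : cos g = cos (g / 2) ^+ 2 - sin (g / 2) ^+ 2.
Proof.
have -> : cos g = cos (g / 2 *+ 2) by congr cos; rewrite mulr2n; lra.
by rewrite cos_mulr2n sin2cos2 mulr2n; lra.
Qed.

Lemma Delta_gt0 g u : 0 < g < pi -> 0 < Delta g u.
Proof.
move=> g0; apply: lt_le_trans (Delta_ge g u).
by rewrite exprn_gt0 // sin_half_gt0.
Qed.

Lemma sqrt_Delta_gt0 g u : 0 < g < pi -> 0 < Num.sqrt (Delta g u).
Proof. by move=> g0; rewrite sqrtr_gt0 Delta_gt0. Qed.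

(** This is [2 sqrt (sin g) K (k)], with [K] the complete elliptic integral of the first kind and
    modulus [k = cos (g / 2)]. The variable comes from the substitution
    [sin (t + g / 2) = cos (g / 2) cos u], with [u = 0] in the midplane and [u = pi] at the face. *)
Definition halfperiod g : R := pint (fun u => Num.sqrt (sin g) / Num.sqrt (Delta g u)).

(** In Legendre's notation [2 (K (k) - 2 E (k))] with [k = cos (g / 2)]. It carries the sign of the
    derivative of [halfperiod]. *)
Definition Phi g : R :=
  pint (fun u => (2 * cos (g / 2) ^+ 2 * cos u ^+ 2 - 1) / Num.sqrt (Delta g u)).

Lemma is_derive_Delta_u g u :
  is_derive u 1 (Delta g) (2 * cos (g / 2) ^+ 2 * cos u * sin u).
Proof. by rewrite /Delta; derive_tac; rewrite /=; ring. Qed.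

Lemma is_derive_Delta_g g u :
  is_derive g 1 (Delta ^~ u) (cos (g / 2) * sin (g / 2) * cos u ^+ 2).
Proof. rewrite /Delta; derive_tac; by field. Qed.

Lemma continuous_derive k : (forall u, exists a, is_derive u 1 k a) -> continuous k.
Proof. by move=> h u; have [a da] := h u; exact: is_derive_continuous da. Qed.

Definition integrand_g g u : R :=
  (2 * Num.sqrt (sin g))^-1 *
  (cos g / Num.sqrt (Delta g u) -
   sin g ^+ 2 * cos u ^+ 2 / (2 * (Delta g u * Num.sqrt (Delta g u)))).

Lemma is_derive_integrand_g g u : 0 < g < pi ->
  is_derive g 1 (fun g' => Num.sqrt (sin g') / Num.sqrt (Delta g' u)) (integrand_g g u).
Proof.
move=> g0; have D0 := Delta_gt0 u g0; have sD0 := sqrt_Delta_gt0 u g0.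
have s0 : 0 < sin g by exact: sin_gt0_pi.
have dD := is_derive_Delta_g g u.
derive_tac.
- by rewrite gt_eqF.
rewrite /integrand_g.
have ss0 : 0 < Num.sqrt (sin g) by rewrite sqrtr_gt0.
have E1 := sqr_sqrtr (ltW s0); have E2 := sqr_sqrtr (ltW D0).
have E3 : cos (g / 2) * sin (g / 2) = Num.sqrt (sin g) ^+ 2 / 2.
  by rewrite E1 [sin g]sin_double; field.
rewrite E3; move: ss0 sD0 E1 E2.
set a := Num.sqrt (sin g); set b := Num.sqrt (Delta g u) => a0 b0 <- <-.
by field; rewrite !gt_eqF.
Qed.


Lemma continuous_integrand g : 0 < g < pi ->
  continuous (fun u => Num.sqrt (sin g) / Num.sqrt (Delta g u)).
Proof.
move=> g0; apply: continuous_derive => u.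
have D0 := Delta_gt0 u g0; have sD0 := sqrt_Delta_gt0 u g0.
have dD := is_derive_Delta_u g u.
by eexists; repeat derive_step; rewrite gt_eqF.
Qed.

Lemma continuous_integrand_Phi g : 0 < g < pi ->
  continuous (fun u => (2 * cos (g / 2) ^+ 2 * cos u ^+ 2 - 1) / Num.sqrt (Delta g u)).
Proof.
move=> g0; apply: continuous_derive => u.
have D0 := Delta_gt0 u g0; have sD0 := sqrt_Delta_gt0 u g0.
have dD := is_derive_Delta_u g u.
by eexists; repeat derive_step; rewrite gt_eqF.
Qed.

Lemma continuous_integrand_g g : 0 < g < pi -> continuous (integrand_g g).
Proof.
move=> g0; apply: continuous_derive => u.
have D0 := Delta_gt0 u g0; have sD0 := sqrt_Delta_gt0 u g0.
have dD := is_derive_Delta_u g u.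
rewrite /integrand_g.
by eexists; repeat derive_step; rewrite ?mulf_neq0 ?pnatr_eq0 ?(gt_eqF D0) ?(gt_eqF sD0).
Qed.

(* Integration by parts in disguise: the two integrands differ by the derivative
   of [cos (g / 2) ^+ 2 * sin u * cos u / Num.sqrt (Delta g u)], up to a constant. *)
Lemma pint_integrand_g g : 0 < g < pi ->
  pint (integrand_g g) = (2 * Num.sqrt (sin g))^-1 * Phi g.
Proof.
move=> g0; have s0 : 0 < sin g by exact: sin_gt0_pi.
pose F u := (2 * Num.sqrt (sin g))^-1 *
  (2 * cos (g / 2) ^+ 2) * (sin u * cos u / Num.sqrt (Delta g u)).
pose k u := integrand_g g u -
  (2 * Num.sqrt (sin g))^-1 *
  ((2 * cos (g / 2) ^+ 2 * cos u ^+ 2 - 1) / Num.sqrt (Delta g u)).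
have dF u : is_derive u 1 F (- k u).
  have D0 := Delta_gt0 u g0; have sD0 := sqrt_Delta_gt0 u g0.
  have dD := is_derive_Delta_u g u.
  rewrite /F; derive_tac; first by rewrite gt_eqF.
  rewrite /k /integrand_g.
  have ss0 : 0 < Num.sqrt (sin g) by rewrite sqrtr_gt0.
  have E2 := sqr_sqrtr (ltW D0).
  rewrite [sin g ^+ 2](_ : _ = 4 * (1 - cos (g / 2) ^+ 2) * cos (g / 2) ^+ 2); last first.
    by rewrite [sin g]sin_double !exprMn sin2cos2; ring.
  rewrite [cos g]cos_double [sin (g / 2) ^+ 2]sin2cos2.
  have E3 : sin u ^+ 2 = 1 - cos u ^+ 2 by rewrite sin2cos2.
  have E4 : Num.sqrt (Delta g u) ^+ 2 = 1 - cos (g / 2) ^+ 2 * cos u ^+ 2 by rewrite E2.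
  move: sD0 E4 ss0 E2 E3; set C := cos (g / 2); set x := cos u; set y := sin u.
  set a := Num.sqrt (sin g); set b := Num.sqrt (Delta g u) => b0 E4 a0 <- E3.
  transitivity ((2 * C ^+ 2 * ((x ^+ 2 - y ^+ 2) * b ^+ 2 - C ^+ 2 * x ^+ 2 * y ^+ 2))
    / (2 * a * b ^+ 3)); first by field; rewrite !gt_eqF.
  transitivity (((1 - C ^+ 2 - C ^+ 2) * b ^+ 2 + 2 * (1 - C ^+ 2) * C ^+ 2 * x ^+ 2
    + (2 * C ^+ 2 * x ^+ 2 - 1) * b ^+ 2) / (2 * a * b ^+ 3)); last first.
    by field; rewrite !gt_eqF.
  by rewrite E3 E4; congr (_ / _); ring.
have c1 := continuous_integrand_g g0.
have c2 := continuous_integrand_Phi g0.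
have ck : continuous k.
  move=> u; apply: cvgB; first exact: c1.
  by apply: cvgM; [exact: cvg_cst | exact: c2].
have : pint (fun u => - k u) = 0.
  rewrite (pint_FTC _ dF); first by rewrite /F sinpi sin0 !mul0r !mulr0 subrr.
  by move=> u; apply: cvgN; exact: ck.
have -> : (fun u => - k u) = (fun u => (2 * Num.sqrt (sin g))^-1 *
  ((2 * cos (g / 2) ^+ 2 * cos u ^+ 2 - 1) / Num.sqrt (Delta g u)) + -1 * integrand_g g u).
  by apply/funext => u; rewrite /k; ring.
rewrite pintD; last 2 first.
- by move=> u; apply: cvgM; [exact: cvg_cst | exact: c2].
- by move=> u; apply: cvgM; [exact: cvg_cst | exact: c1].
rewrite (pintZ _ c2) (pintZ _ c1) mulN1r => /eqP.
by rewrite subr_eq0 => /eqP <-.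
Qed.

(** A constant dominating function for differentiation under the integral sign: where [sin g > c],
    the double angle formula gives [sqrt (Delta g u) >= sin (g / 2) >= c / 2] for every [u]. *)
Lemma integrand_g_bound g u (c : R) : 0 < c -> c < sin g -> 0 < g < pi ->
  `|integrand_g g u| <= (2 * Num.sqrt c)^-1 * (2 / c + 4 / c ^+ 3).
Proof.
move=> c0 cs g0.
have s0 : 0 < sin g by exact: sin_gt0_pi.
have D0 := Delta_gt0 u g0; have sD0 := sqrt_Delta_gt0 u g0.
have cD : c / 2 <= Num.sqrt (Delta g u).
  have -> : c / 2 = Num.sqrt ((c / 2) ^+ 2).
    by rewrite sqrtr_sqr ger0_norm // divr_ge0 // ltW.
  rewrite ler_wsqrtr // (le_trans _ (Delta_ge g u)) // ler_sqr ?nnegrE.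
  - have := sin_double g; have := cos_half_gt0 g0; have := cos_le1 (g / 2).
    have := sin_half_gt0 g0; nra.
  - by rewrite divr_ge0 // ltW.
  - by rewrite ltW // sin_half_gt0.
have E2 := sqr_sqrtr (ltW D0).
move: sD0 cD E2; rewrite /integrand_g; set b := Num.sqrt (Delta g u) => b0 cb <-.
rewrite normrM ger0_norm ?invr_ge0 ?mulr_ge0 ?sqrtr_ge0 //.
have c20 : 0 < c / 2 by rewrite divr_gt0.
apply: ler_pM => //.
- rewrite lef_pV2 ?posrE ?mulr_gt0 ?sqrtr_gt0 // ler_pM2l // ler_wsqrtr // ltW //.
- apply: (le_trans (ler_normB _ _)); apply: lerD.
  + rewrite normrM normfV (gtr0_norm b0) -[2 / c]mul1r; apply: ler_pM => //.
    * by rewrite invr_ge0 ltW.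
    * exact: cos_max.
    * by rewrite -invf_div lef_pV2 ?posrE.
  + have b30 : 0 < 2 * (b ^+ 2 * b) by rewrite !mulr_gt0 ?exprn_gt0.
    rewrite ger0_norm; last by rewrite divr_ge0 ?(ltW b30) // mulr_ge0 ?sqr_ge0.
    rewrite [4 / _](_ : _ = 1 * 1 * (2 * ((c / 2) ^+ 2 * (c / 2)))^-1); last first.
      by field; rewrite gt_eqF.
    apply: ler_pM => //.
    * by rewrite mulr_ge0 ?sqr_ge0.
    * by rewrite invr_ge0 ltW.
    * by apply: ler_pM; rewrite ?sqr_ge0.
    * rewrite lef_pV2 ?posrE ?mulr_gt0 // ler_pM2l // ler_pM ?sqr_ge0 ?(ltW c20) //.
      by rewrite ler_sqr ?nnegrE // ltW.
Qed.

Lemma is_derive_halfperiod g : 0 < g < pi ->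
  is_derive g 1 halfperiod ((2 * Num.sqrt (sin g))^-1 * Phi g).
Proof.
move=> g0.
have /andP[g00 gpi] := g0.
have s0 : 0 < sin g by exact: sin_gt0_pi.
(* On an interval where [sin x] stays above [sin g / 2], one constant dominates all the
   derivatives. *)
have [a [b [ag gb H]]] : exists a b, [/\ a < g, g < b &
    forall x, a < x < b -> (0 < x < pi) && (sin g / 2 < sin x)].
  have : \forall x \near g, (0 < x < pi) && (sin g / 2 < sin x).
    near=> x; apply/andP; split; first (apply/andP; split).
    - by near: x; exact: lt_nbhsr.
    - by near: x; exact: lt_nbhsl.
    - near: x; have : sin g / 2 < sin g by lra.
      by move=> h; exact: (cvgr_gt _ (@continuous_sin R g) _ h).
  move=> /nbhs_ballP[e /= e0 He]; exists (g - e), (g + e).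
  split; rewrite ?ltrBlDr ?ltrDl // => x /andP[x1 x2].
  by apply: He; rewrite /ball /= ltr_norml; apply/andP; split; lra.
pose f x u := Num.sqrt (sin x) / Num.sqrt (Delta x u).
pose K := (2 * Num.sqrt (sin g / 2))^-1 * (2 / (sin g / 2) + 4 / (sin g / 2) ^+ 3).
have Ig : `]a, b[%classic g by rewrite /= in_itv /= ag gb.
have H' x : `]a, b[%classic x -> (0 < x < pi) /\ (sin g / 2 < sin x).
  by rewrite /= in_itv /= => /H /andP[].
have h1 (x : R) : `]a, b[%classic x -> (@lebesgue_measure R).-integrable `[0%R, pi] (EFin \o f x).
  by move=> /H'[x0 _]; apply: pint_integrable; exact: continuous_integrand.
have h2 (x y : R) : `]a, b[%classic x -> `[0%R, pi]%classic y -> derivable (f ^~ y) x 1.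
  by move=> /H'[x0 _] _; case: (is_derive_integrand_g y x0).
have K0 : 0 <= K.
  have s20 : 0 < sin g / 2 by rewrite divr_gt0.
  by rewrite /K mulr_ge0 ?invr_ge0 ?mulr_ge0 ?sqrtr_ge0 // addr_ge0 // divr_ge0 // ltW // exprn_gt0.
have h3 (t : R) : 0 <= cst K t by exact: K0.
have h4 : (@lebesgue_measure R).-integrable `[0%R, pi] (EFin \o (cst K : R -> R)).
  by apply: pint_integrable => u; exact: cvg_cst.
have D1 (x y : R) : 0 < x < pi -> partial1of2 f x y = integrand_g x y.
  by move=> x0; rewrite partial1of2E; case: (is_derive_integrand_g y x0).
have h5 (x y : R) : `]a, b[%classic x -> `[0%R, pi]%classic y -> `|partial1of2 f x y| <= cst K y.
  by move=> /H'[x0 xs] _; rewrite D1 //; apply: integrand_g_bound => //; rewrite divr_gt0.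
have mB : measurable (`[0%R, pi]%classic : set (measurableTypeR R)) by [].
have dd := derivable_under_integral mB Ig h1 h2 h3 h4 h5.
have de := differentiation_under_integral mB Ig h1 h2 h3 h4 h5.
apply: DeriveDef; first exact: dd.
rewrite -derive1E; apply: (etrans de).
rewrite -pint_integrand_g //; apply: eq_Rintegral => u _; exact: D1.
Unshelve. all: by end_near. Qed.

End HalfPeriod.

(** * Monotonicity of the derivative and logarithmic estimates of the elliptic integral *)

Section HalfPeriodMonotone.
Context {R : realType}.
Implicit Types g u : R.

Lemma pint_cos_sqr : pint (fun u : R => cos u ^+ 2) = pi / 2.
Proof.
have c : continuous (fun u : R => cos u ^+ 2).
  by apply: continuous_derive => u; eexists; repeat derive_step.
have dF (u : R) : is_derive u 1 (fun u => (u + sin u * cos u) / 2) (cos u ^+ 2).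
  by derive_tac; have := cos2Dsin2 u; lra.
by rewrite (pint_FTC c dF) sinpi sin0; field.
Qed.

(** The form [1 / b - 2 b] is decreasing in [b = sqrt (Delta g u)], which grows with [g]. *)
Lemma PhiE g u : 0 < g < pi ->
  (2 * cos (g / 2) ^+ 2 * cos u ^+ 2 - 1) / Num.sqrt (Delta g u) =
  (Num.sqrt (Delta g u))^-1 - 2 * Num.sqrt (Delta g u).
Proof.
move=> g0; have D0 := Delta_gt0 u g0; have b0 := sqrt_Delta_gt0 u g0.
have -> : 2 * cos (g / 2) ^+ 2 * cos u ^+ 2 - 1 = 1 - 2 * Num.sqrt (Delta g u) ^+ 2.
  by rewrite sqr_sqrtr ?(ltW D0) // /Delta; ring.
by field; rewrite gt_eqF.
Qed.

Lemma Delta_le1 g u : Delta g u <= 1.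
Proof. by rewrite /Delta lerBlDr lerDl mulr_ge0 ?sqr_ge0. Qed.

(** The integrands agree at [u = pi / 2], so strictness needs a quantitative gap. With [p <= q <= 1]
    the two values of [sqrt Delta], the integrands differ by at least
    [2 (q - p) >= q ^ 2 - p ^ 2 = d cos ^ 2 u], whose integral is [d pi / 2 > 0]. *)
Lemma Phi_decreasing g1 g2 : 0 < g1 -> g1 < g2 -> g2 < pi -> Phi g2 < Phi g1.
Proof.
move=> g10 g12 g2p.
have h1 : 0 < g1 < pi by rewrite g10 (lt_trans g12).
have h2 : 0 < g2 < pi by rewrite g2p (lt_trans g10).
have c1 := continuous_integrand_Phi h1; have c2 := continuous_integrand_Phi h2.
have cc : continuous (fun u : R => cos u ^+ 2).
  by apply: continuous_derive => u; eexists; repeat derive_step.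
pose d := cos (g1 / 2) ^+ 2 - cos (g2 / 2) ^+ 2.
have ccd : continuous (fun u : R => d * cos u ^+ 2).
  by move=> u; apply: cvgM; [exact: cvg_cst|exact: cc].
have d0 : 0 < d.
  rewrite /d subr_gt0 ltr_sqr ?nnegrE ?ltW ?cos_half_gt0 //.
  by have := @pi_gt0 R; rewrite ltr_cos ?in_itv /=; lra.
have key : pint (fun u => (2 * cos (g2 / 2) ^+ 2 * cos u ^+ 2 - 1) / Num.sqrt (Delta g2 u)
    + d * cos u ^+ 2) <= Phi g1.
  apply: le_pint => // [|u _]; first by move=> u; apply: cvgD; [exact: c2|exact: ccd].
  rewrite !PhiE //.
  have p0 := sqrt_Delta_gt0 u h1; have q0 := sqrt_Delta_gt0 u h2.
  have pq : Num.sqrt (Delta g1 u) <= Num.sqrt (Delta g2 u).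
    rewrite ler_wsqrtr // /Delta; have := sqr_ge0 (cos u); move: d0; rewrite /d; nra.
  have q1 : Num.sqrt (Delta g2 u) <= 1.
    by rewrite -[leRHS]sqrtr1 ler_wsqrtr // Delta_le1.
  have -> : d * cos u ^+ 2 = Num.sqrt (Delta g2 u) ^+ 2 - Num.sqrt (Delta g1 u) ^+ 2.
    by rewrite !sqr_sqrtr ?ltW ?Delta_gt0 // /d /Delta; ring.
  move: p0 q0 pq q1.
  set p := Num.sqrt (Delta g1 u); set q := Num.sqrt (Delta g2 u) => p0 q0 pq q1.
  have : q^-1 <= p^-1 by rewrite lef_pV2.
  nra.
rewrite (pintD c2 ccd) (pintZ _ cc) pint_cos_sqr in key.
by apply: lt_le_trans key; rewrite ltrDl mulr_gt0 // divr_gt0 // pi_gt0.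
Qed.

(** At [g = pi / 2] the factor [2 cos ^ 2 (g / 2)] is 1 and the numerator becomes [cos ^ 2 u - 1].
    This places the maximum of [halfperiod] in [(0, pi / 2]]. *)
Lemma Phi_pihalf : Phi (pi / 2 : R) <= 0.
Proof.
have p0 := @pi_gt0 R.
have h : 0 < (pi / 2 : R) < pi by apply/andP; split; lra.
have c0 : continuous (fun _ : R => 0 : R) by move=> u; exact: cvg_cst.
have <- : pint (fun _ : R => 0) = 0.
  by rewrite (pint_FTC c0 (fun u => is_derive_cstf u (0 : R))) subrr.
apply: le_pint; first exact: continuous_integrand_Phi.
  exact: c0.
move=> u _; rewrite pmulr_lle0 ?invr_gt0 ?sqrt_Delta_gt0 //.
have := cos_double (pi / 2 : R); rewrite cos_pihalf sin2cos2.
have := cos2Dsin2 u; have := sqr_ge0 (sin u); have := sqr_ge0 (cos (pi / 2 / 2 : R)).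
nra.
Qed.

Lemma sin_le_id u : 0 <= u -> sin u <= u.
Proof.
move=> u0; have [->|u1] := eqVneq u 0; first by rewrite sin0.
have u2 : 0 < u by rewrite lt_neqAle eq_sym u1.
have [c _] := @MVT R sin cos 0 u u2 (fun x _ => is_derive_sin x)
  (continuous_subspaceT (@continuous_sin R)).
rewrite sin0 !subr0 => ->; have := cos_le1 c; nra.
Qed.

Lemma sqr_sin_le u : sin u ^+ 2 <= u ^+ 2.
Proof.
have [u0|u0] := leP 0 u.
  have [u1|u1] := leP u 1.
    rewrite ler_sqr ?nnegrE // ?sin_le_id // sin_ge0_pi //.
    by have := @pi_ge2 R; lra.
  have := sin_le1 u; have := sin_geN1 u; nra.
rewrite -[sin u ^+ 2]sqrrN -sinN -[u ^+ 2]sqrrN.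
have u1 : 0 <= - u by lra.
have [u2|u2] := leP (- u) 1.
  rewrite ler_sqr ?nnegrE // ?sin_le_id // sin_ge0_pi //.
  by have := @pi_ge2 R; lra.
have := sin_le1 (- u); have := sin_geN1 (- u); nra.
Qed.

(** The inverse hyperbolic sine of [u / s] up to the constant [ln s]. Its derivative is the model
    for [1 / sqrt Delta] near the ends of [[0, pi]], with [s] of the order of [g]. *)
Definition lnh (s u : R) := ln (u + Num.sqrt (s ^+ 2 + u ^+ 2)).

Lemma is_derive_lnh s u : 0 < s ->
  is_derive u 1 (lnh s) (Num.sqrt (s ^+ 2 + u ^+ 2))^-1.
Proof.
move=> s0; have p0 : 0 < s ^+ 2 + u ^+ 2 by rewrite ltr_wpDr ?sqr_ge0 ?exprn_gt0.
have b0 : 0 < Num.sqrt (s ^+ 2 + u ^+ 2) by rewrite sqrtr_gt0.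
have a0 : 0 < u + Num.sqrt (s ^+ 2 + u ^+ 2).
  have E := sqr_sqrtr (ltW p0); have s20 : 0 < s ^+ 2 by rewrite exprn_gt0.
  have [|u0] := leP 0 u; first lra.
  nra.
rewrite /lnh; have dl := is_derive1_ln a0.
have dg : is_derive u 1 (fun t => t + Num.sqrt (s ^+ 2 + t ^+ 2))
    (1 + u / Num.sqrt (s ^+ 2 + u ^+ 2)).
  by derive_tac; field; rewrite gt_eqF.
notypeclasses refine (is_derive_eqf (@is_derive_compf _ (fun t => t + Num.sqrt (s ^+ 2 + t ^+ 2)) 
  _ _ _ _ dl dg) _).
by rewrite /=; field; rewrite !gt_eqF.
Qed.

Lemma continuous_lnh' s a : 0 < s ->
  continuous (fun u => (Num.sqrt (s ^+ 2 + (a - u) ^+ 2))^-1).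
Proof.
move=> s0; apply: continuous_derive => u.
have p0 : 0 < s ^+ 2 + (a - u) ^+ 2 by rewrite ltr_wpDr ?sqr_ge0 ?exprn_gt0.
by eexists; repeat derive_step; rewrite ?gt_eqF ?sqrtr_gt0.
Qed.

(** With [v = u / 2], [sin v >= v cos v] gives [sin u >= u cos ^ 2 v], and [cos u >= 0] gives
    [cos ^ 2 v >= 1 / 2]. *)
Lemma sqr_half_le_sqr_sin u : 0 <= u <= pi / 2 -> u ^+ 2 / 4 <= sin u ^+ 2.
Proof.
move=> /andP[u0 u1]; have p0 := @pi_gt0 R.
have v0 : 0 <= u / 2 by lra.
have d1 (v : R) : is_derive v 1 (fun v => sin v - v * cos v) (v * sin v).
  by derive_tac; ring.
have h : u / 2 * cos (u / 2) <= sin (u / 2).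
  have [->|u2] := eqVneq u 0; first by rewrite !mul0r sin0.
  have u3 : 0 < u / 2 by rewrite lt_neqAle eq_sym mulf_neq0 //= invr_eq0 pnatr_eq0.
  have [c] := @MVT R _ _ 0 (u / 2) u3 (fun x _ => d1 x)
    (continuous_subspaceT (continuous_derive (fun v => ex_intro _ _ (d1 v)))).
  rewrite in_itv /= => /andP[c0 c1]; rewrite sin0 mul0r !subr0 => E.
  have : 0 <= c * sin c * (u / 2).
    rewrite !mulr_ge0 // ?(ltW c0) // sin_ge0_pi //; lra.
  lra.
have c0 : 0 <= cos u by apply: cos_ge0_pihalf; lra.
have c1 : 0 <= cos (u / 2) by apply: cos_ge0_pihalf; lra.
have E1 := sin_double u; have E2 := cos_double u; have E3 := cos2Dsin2 (u / 2).
have : u / 2 <= sin u.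
  rewrite E1; apply: le_trans (_ : 2 * (u / 2 * cos (u / 2)) * cos (u / 2) <= _).
    nra.
  by apply: ler_wpM2r => //; lra.
by move=> h2; have : (u / 2) ^+ 2 <= sin u ^+ 2; [rewrite ler_sqr ?nnegrE; lra|lra].
Qed.

Lemma DeltaE g u : Delta g u = sin (g / 2) ^+ 2 + cos (g / 2) ^+ 2 * sin u ^+ 2.
Proof. by rewrite /Delta !sin2cos2; ring. Qed.

(** Logarithmic divergence as [g] tends to 0, from [Delta g u <= (g / 2) ^ 2 + u ^ 2]. *)
Lemma pint_inv_sqrt_Delta_ge g : 0 < g < pi ->
  - ln (g / 2) <= pint (fun u => (Num.sqrt (Delta g u))^-1).
Proof.
move=> g0; have /andP[g1 g2] := g0; have t0 : 0 < g / 2 by lra.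
have dF := fun u : R => is_derive_lnh u t0.
have c1 : continuous (fun u : R => (Num.sqrt ((g / 2) ^+ 2 + u ^+ 2))^-1).
  by under eq_fun => u do rewrite -[u ^+ 2]sqrrN -[- u]add0r; exact: continuous_lnh'.
have c2 : continuous (fun u => (Num.sqrt (Delta g u))^-1).
  apply: continuous_derive => u.
  have D0 := Delta_gt0 u g0; have sD0 := sqrt_Delta_gt0 u g0.
  have dD := is_derive_Delta_u g u.
  by eexists; repeat derive_step; rewrite gt_eqF.
apply: le_trans (le_pint c1 c2 _).
  rewrite (pint_FTC c1 dF) /lnh expr0n /= addr0 add0r sqrtr_sqr gtr0_norm //.
  rewrite lerDr ln_ge0 //; have := @pi_ge2 R; have := sqrtr_ge0 ((g / 2) ^+ 2 + (pi : R) ^+ 2).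
  lra.
move=> u _; rewrite lef_pV2 ?posrE ?sqrt_Delta_gt0 ?sqrtr_gt0 //; last first.
  by rewrite ltr_wpDr ?sqr_ge0 // exprn_gt0.
rewrite ler_wsqrtr // DeltaE; apply: lerD; first exact: sqr_sin_le.
have := sqr_sin_le u; have := cos2Dsin2 (g / 2); have := sqr_ge0 (sin (g / 2)).
have := sqr_ge0 (cos (g / 2)); have := sqr_ge0 (sin u); nra.
Qed.

(** The integrand peaks at both ends of [[0, pi]]. At distance [x] from the nearer end,
    [sin ^ 2 u >= x ^ 2 / 4] and [cos ^ 2 (g / 2) >= 1 / 2] bound it by [4 / sqrt (s ^ 2 + x ^ 2)];
    the two ends contribute equally, hence the factor 8. *)
Lemma pint_inv_sqrt_Delta_le g : 0 < g <= pi / 2 ->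
  pint (fun u => (Num.sqrt (Delta g u))^-1) <=
  8 * (ln (pi + Num.sqrt (sin (g / 2) ^+ 2 + pi ^+ 2)) - ln (sin (g / 2))).
Proof.
move=> /andP[g1 g2]; have pi0 := @pi_gt0 R.
have g0 : 0 < g < pi by apply/andP; split; lra.
have s0 := sin_half_gt0 g0; set s := sin (g / 2) in s0 *.
have dF := fun u : R => is_derive_lnh u s0.
have c1 : continuous (fun u : R => (Num.sqrt (s ^+ 2 + u ^+ 2))^-1).
  by under eq_fun => u do rewrite -[u ^+ 2]sqrrN -[- u]add0r; exact: continuous_lnh'.
have dG u : is_derive u 1 (fun u => - lnh s (pi - u)) (Num.sqrt (s ^+ 2 + (pi - u) ^+ 2))^-1.
  have d := is_derive_lnh (pi - u) s0.
  have d' : is_derive u 1 (fun u : R => pi - u) (- 1) by derive_tac; ring.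
  notypeclasses refine (is_derive_eqf (is_deriveNf (@is_derive_compf _ (fun u : R => pi - u) _ _ _ _ d d')) _); ring.
have c3 := @continuous_lnh' s pi s0.
have c2 : continuous (fun u => (Num.sqrt (Delta g u))^-1).
  apply: continuous_derive => u.
  have D0 := Delta_gt0 u g0; have sD0 := sqrt_Delta_gt0 u g0.
  have dD := is_derive_Delta_u g u.
  by eexists; repeat derive_step; rewrite gt_eqF.
have c4 : continuous (fun u => (Num.sqrt (s ^+ 2 + u ^+ 2))^-1 +
    (Num.sqrt (s ^+ 2 + (pi - u) ^+ 2))^-1).
  by move=> u; apply: cvgD; [exact: c1|exact: c3].
have pos x : 0 < s ^+ 2 + x ^+ 2 by rewrite ltr_wpDr ?sqr_ge0 // exprn_gt0.
apply: le_trans (le_pint c2 (k2 := fun u => 4 * ((Num.sqrt (s ^+ 2 + u ^+ 2))^-1 +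
    (Num.sqrt (s ^+ 2 + (pi - u) ^+ 2))^-1)) _ _) _.
- by move=> u; apply: cvgM; [exact: cvg_cst|exact: c4].
- have main x u : x ^+ 2 / 4 <= sin u ^+ 2 ->
      (Num.sqrt (Delta g u))^-1 <= 4 * (Num.sqrt (s ^+ 2 + x ^+ 2))^-1.
    move=> xu; rewrite -[4]invrK -invfM lef_pV2 ?posrE ?sqrt_Delta_gt0 //; last first.
      by rewrite mulr_gt0 ?invr_gt0 ?sqrtr_gt0.
    have -> : 4^-1 * Num.sqrt (s ^+ 2 + x ^+ 2) = Num.sqrt (4^-1 ^+ 2 * (s ^+ 2 + x ^+ 2)).
      by rewrite sqrtrM ?sqr_ge0 // sqrtr_sqr ger0_norm // invr_ge0.
    rewrite ler_wsqrtr // DeltaE -/s.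
    have cg : 0 <= cos g by apply: cos_ge0_pihalf; lra.
    have := cos_double g; have := cos2Dsin2 (g / 2); rewrite -/s.
    have := sqr_ge0 (sin u); have := sqr_ge0 s; nra.
  move=> u /andP[u0 u1]; rewrite mulrDr.
  have p1 : 0 <= 4 * (Num.sqrt (s ^+ 2 + u ^+ 2))^-1 by rewrite mulr_ge0 ?invr_ge0 ?sqrtr_ge0.
  have p2 : 0 <= 4 * (Num.sqrt (s ^+ 2 + (pi - u) ^+ 2))^-1.
    by rewrite mulr_ge0 ?invr_ge0 ?sqrtr_ge0.
  have [u2|u2] := leP u (pi / 2).
    have := main u u (sqr_half_le_sqr_sin _); rewrite u0 u2 => /(_ isT); lra.
  have E : sin (pi - u) = sin u by rewrite addrC sinDpi sinN opprK.
  have := main (pi - u) u; rewrite -E => /(_ (sqr_half_le_sqr_sin _)) => h.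
  by have := h ltac:(apply/andP; split; lra); lra.
rewrite (pintZ _ c4) (pintD c1 c3) (pint_FTC c1 dF) (pint_FTC c3 dG) /lnh.
rewrite subrr subr0 expr0n /= addr0 add0r sqrtr_sqr gtr0_norm //; lra.
Qed.

End HalfPeriodMonotone.

(** * Shape of the half-period function *)

Section PeriodProblem.
Context {R : realType}.
Implicit Types g u x y : R.

Lemma continuous_inv_sqrt_Delta g : 0 < g < pi ->
  continuous (fun u => (Num.sqrt (Delta g u))^-1).
Proof.
move=> g0; apply: continuous_derive => u.
have D0 := Delta_gt0 u g0; have sD0 := sqrt_Delta_gt0 u g0.
have dD := is_derive_Delta_u g u.
by eexists; repeat derive_step; rewrite gt_eqF.
Qed.

Lemma halfperiodE g : 0 < g < pi ->
  halfperiod g = Num.sqrt (sin g) * pint (fun u => (Num.sqrt (Delta g u))^-1).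
Proof. by move=> g0; apply: pintZ; exact: continuous_inv_sqrt_Delta. Qed.

Lemma pint_cst (a : R) : pint (fun _ => a) = a * pi.
Proof.
have c : continuous (fun _ : R => a) by move=> u; exact: cvg_cst.
have dF (u : R) : is_derive u 1 (fun u => a * u) a by derive_tac; ring.
by rewrite (pint_FTC c dF) mulr0 subr0.
Qed.

Lemma continuous_cstf (a : R) : continuous (fun _ : R => a).
Proof. by move=> u; exact: cvg_cst. Qed.

Lemma halfperiod_gt0 g : 0 < g < pi -> 0 < halfperiod g.
Proof.
move=> g0; rewrite halfperiodE //; apply: mulr_gt0.
  by rewrite sqrtr_gt0 sin_gt0_pi.
suff : pint (fun _ : R => 1) <= pint (fun u => (Num.sqrt (Delta g u))^-1).
  by rewrite pint_cst; have := @pi_gt0 R; lra.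
apply: le_pint; [exact: continuous_cstf|exact: continuous_inv_sqrt_Delta|].
move=> u _; rewrite -invr1 lef_pV2 ?posrE ?sqrt_Delta_gt0 //.
by rewrite -[leRHS]sqrtr1 ler_wsqrtr // Delta_le1.
Qed.

Lemma halfperiod_le g : pi / 2 <= g < pi -> halfperiod g <= 2 * pi * Num.sqrt (sin g).
Proof.
move=> /andP[g1 g2]; have p0 := @pi_gt0 R.
have g0 : 0 < g < pi by apply/andP; split; lra.
have s0 := sin_half_gt0 g0.
rewrite halfperiodE // mulrC ler_wpM2r ?sqrtr_ge0 // -pint_cst.
apply: le_pint; [exact: continuous_inv_sqrt_Delta|exact: continuous_cstf|].
move=> u _; rewrite -[2]invrK lef_pV2 ?posrE ?sqrt_Delta_gt0 //.
have -> : 2^-1 = Num.sqrt (2^-1 ^+ 2) :> R by rewrite sqrtr_sqr ger0_norm.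
rewrite ler_wsqrtr // (le_trans _ (Delta_ge g u)) //.
have cg : cos g <= 0.
  have : 0 <= cos (pi - g) by apply: cos_ge0_pihalf; lra.
  by rewrite addrC cosDpi cosN; lra.
by have := cos_double g; have := cos2Dsin2 (g / 2); nra.
Qed.

Lemma Phi_pos_near0 : exists2 g : R, 0 < g < pi & 0 < Phi g.
Proof.
have p2 := @pi_ge2 R; have p0 := @pi_gt0 R.
(* Chosen so that [- ln (g / 2) = 2 * pi + 1] exceeds the integral [2 * pi] of the term
   [2 sqrt Delta <= 2]. *)
pose g : R := 2 * expR (- (2 * pi + 1)).
have e1 : expR (- (2 * pi + 1) : R) < 1 by rewrite expR_lt1; lra.
have e0 := expR_gt0 (- (2 * pi + 1) : R).
have g0 : 0 < g < pi by rewrite /g; apply/andP; split; lra.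
exists g => //.
have L := pint_inv_sqrt_Delta_ge g0.
have Eg : g / 2 = expR (- (2 * pi + 1)) by rewrite /g; field.
rewrite Eg expRK in L.
have c1 := continuous_inv_sqrt_Delta g0.
have : pint (fun u => (Num.sqrt (Delta g u))^-1 + - 2) <= Phi g.
  apply: le_pint; [by move=> u; apply: cvgD; [exact: c1|exact: cvg_cst]
    |exact: continuous_integrand_Phi|].
  move=> u _; rewrite PhiE //.
  have : Num.sqrt (Delta g u) <= 1 by rewrite -[leRHS]sqrtr1 ler_wsqrtr // Delta_le1.
  lra.
rewrite (pintD c1 (@continuous_cstf (- 2))) pint_cst; lra.
Qed.

Lemma halfperiod_MVT x y : 0 < x -> x < y -> y < pi ->
  exists2 c, x < c < y &
    halfperiod y - halfperiod x = (2 * Num.sqrt (sin c))^-1 * Phi c * (y - x).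
Proof.
move=> x0 xy yp.
have h c : x <= c <= y -> 0 < c < pi by move=> /andP[]; lra.
have [d|d|c cxy E] := @MVT R halfperiod (fun c => (2 * Num.sqrt (sin c))^-1 * Phi c) x y xy.
- by rewrite in_itv /= => cxy; apply: is_derive_halfperiod; apply: h; lra.
- move: d; apply: derivable_within_continuous => c; rewrite in_itv /= => cxy.
  by case: (is_derive_halfperiod (h c cxy)).
- by exists c => //; move: cxy; rewrite in_itv.
Qed.

(** The derivative has the sign of the decreasing function [Phi], so the turning point is the
    supremum of the set where [Phi] is positive. *)
Lemma halfperiod_unimodal : exists2 m : R, 0 < m <= pi / 2 &
  (forall x y, 0 < x -> x < y -> y <= m -> halfperiod x < halfperiod y) /\
  (forall x y, m <= x -> x < y -> y < pi -> halfperiod y < halfperiod x).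
Proof.
have [g0 g0p Pg0] := Phi_pos_near0; have p0 := @pi_gt0 R.
pose A := [set g : R | 0 < g < pi /\ 0 < Phi g].
have Ap x : A x -> x <= pi / 2.
  move=> [/andP[x0 xp] Px]; rewrite leNgt; apply/negP => xh.
  have := Phi_decreasing (_ : 0 < pi / 2) xh xp; have := @Phi_pihalf R; lra.
have sA : has_sup A by split; [exists g0|exists (pi / 2)].
have m0 : g0 <= sup A by apply: ub_le_sup => //; case: sA.
exists (sup A).
  move/andP: g0p => [g00 _]; rewrite (lt_le_trans g00 m0) /=.
  by apply: ge_sup => //; case: sA.
split=> x y.
- move=> x0 xy ym; have ypi : y < pi.
    have : sup A <= pi / 2 by apply: ge_sup => //; case: sA.
    lra.
  have [c /andP[c1 c2] E] := halfperiod_MVT x0 xy ypi.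
  have [z [/andP[z0 zp] Pz] cz] : exists2 z, A z & c < z.
    apply: sup_gt; [by exists g0|lra].
  have Pc : 0 < Phi c by apply: (lt_trans Pz); apply: Phi_decreasing; lra.
  have sc : 0 < sin c by apply: sin_gt0_pi; lra.
  by rewrite -subr_gt0 E !mulr_gt0 ?invr_gt0 ?mulr_gt0 ?sqrtr_gt0 ?subr_gt0.
- move=> mx xy yp; have x0 : 0 < x by move/andP: g0p; lra.
  have [c /andP[c1 c2] E] := halfperiod_MVT x0 xy yp.
  have Pc : Phi c < 0.
    (* Beyond the supremum only [Phi <= 0] is known; strict decrease from an earlier point [d] makes
       [Phi c] negative. *)
    have [d d1 d2] : exists2 d, x < d & d < c by exists ((x + c) / 2); lra.
    have nA : ~ A d.
      by move=> Ad; have : d <= sup A by [apply: ub_le_sup => //; case: sA]; lra.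
    have Pd : Phi d <= 0.
      by rewrite leNgt; apply/negP => Pd; apply: nA; split => //; apply/andP; split; lra.
    by apply: lt_le_trans Pd; apply: Phi_decreasing; lra.
  have sc : 0 < sin c by apply: sin_gt0_pi; lra.
  rewrite -subr_lt0 E pmulr_llt0 ?subr_gt0 // pmulr_rlt0 // invr_gt0 mulr_gt0 ?sqrtr_gt0 //.
Qed.

(** A power weak enough to be absorbed by the factor [sqrt (sin g)], which is of the order of the
    square of this fourth root. *)
Lemma ln_le_fourth_root x : 0 < x -> - ln x <= 4 / Num.sqrt (Num.sqrt x).
Proof.
move=> x0; set r := Num.sqrt (Num.sqrt x).
have r0 : 0 < r by rewrite !sqrtr_gt0.
have -> : x = r ^+ 4.
  by rewrite -[4%N]/(2 * 2)%N exprM sqr_sqrtr ?sqrtr_ge0 // sqr_sqrtr // ltW.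
have l : ln (r ^+ 4) = 4 * ln r by rewrite lnXn // mulr_natl.
have lV : ln r^-1 = - ln r by rewrite lnV.
have := ln_sublinear (_ : 0 < r^-1); rewrite invr_gt0 => /(_ r0); lra.
Qed.

Lemma halfperiod_small_at_0 (e b : R) : 0 < e -> 0 < b ->
  exists2 g, 0 < g < b & halfperiod g < e.
Proof.
move=> e0 b0.
have p0 := @pi_gt0 R; have p2 := @pi_ge2 R.
(* With [q] the fourth root of [sin (g / 2)], the half-period is at most
   [16 (q ^ 2 (2 pi + 1) + 4 q)]. The choice [g = 2 r ^ 4] gives [q <= r], and [r <= 1 / 2] turns
   the bound into [C r], at most [e / 2]. *)
pose C : R := 16 * (2 * pi + 1 + 4).
have C0 : 0 < C by rewrite /C; lra.
pose r : R := Num.min (1/2) (Num.min (e / (2 * C)) (b / 4)).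
have r0 : 0 < r by rewrite /r !lt_min !divr_gt0 // mulr_gt0.
have [r1 r2 r3] : [/\ r <= 1/2, r <= e / (2 * C) & r <= b / 4].
  by rewrite /r !ge_min !lexx !orbT.
have r4 : r ^+ 4 <= r.
  by rewrite exprS ler_piMr ?(ltW r0) // exprn_ile1 // ?ltW //; lra.
have r40 : 0 < r ^+ 4 by rewrite exprn_gt0.
pose g := 2 * r ^+ 4.
have g0 : 0 < g <= pi / 2 by rewrite /g; apply/andP; split; lra.
have g1 : 0 < g < pi by rewrite /g; apply/andP; split; lra.
exists g; first by rewrite /g; apply/andP; split; lra.
have s0 := sin_half_gt0 g1.
have sr : sin (g / 2) <= r ^+ 4.
  by rewrite (_ : r ^+ 4 = g / 2) ?sin_le_id //; rewrite /g; [lra|field].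
rewrite halfperiodE //.
have L := ln_le_fourth_root s0.
have q0 : 0 < Num.sqrt (Num.sqrt (sin (g / 2))) by rewrite !sqrtr_gt0.
have qr : Num.sqrt (Num.sqrt (sin (g / 2))) <= r.
  have -> : r = Num.sqrt (Num.sqrt (r ^+ 4)).
    rewrite -[4%N]/(2 * 2)%N exprM sqrtr_sqr ger0_norm ?sqr_ge0 //.
    by rewrite sqrtr_sqr ger0_norm // ltW.
  by rewrite !ler_wsqrtr.
have U := pint_inv_sqrt_Delta_le g0.
have V : ln (pi + Num.sqrt (sin (g / 2) ^+ 2 + pi ^+ 2)) <= 2 * pi + 1.
  have H : Num.sqrt (sin (g / 2) ^+ 2 + pi ^+ 2) <= pi + 1.
    have -> : pi + 1 = Num.sqrt ((pi + 1) ^+ 2) :> R by rewrite sqrtr_sqr ger0_norm //; lra.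
    rewrite ler_wsqrtr //.
    by have := sin_le1 (g / 2); have := sqr_ge0 (cos (g / 2)); have := cos2Dsin2 (g / 2); nra.
  have H0 := sqrtr_ge0 (sin (g / 2) ^+ 2 + (pi : R) ^+ 2).
  apply: (@le_trans _ _ (pi + Num.sqrt (sin (g / 2) ^+ 2 + pi ^+ 2))); last by lra.
  by apply: ltW; apply: ln_sublinear; rewrite ltr_wpDr.
have W : Num.sqrt (sin g) <= 2 * Num.sqrt (Num.sqrt (sin (g / 2))) ^+ 2.
  rewrite sqr_sqrtr ?sqrtr_ge0 //.
  have -> : 2 * Num.sqrt (sin (g / 2)) = Num.sqrt ((2 * Num.sqrt (sin (g / 2))) ^+ 2).
    by rewrite sqrtr_sqr ger0_norm // mulr_ge0 // sqrtr_ge0.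
  rewrite ler_wsqrtr // exprMn sqr_sqrtr ?(ltW s0) // sin_double.
  by have := cos_le1 (g / 2); have := cos_half_gt0 g1; nra.
move: L q0 qr W U V.
set q := Num.sqrt (Num.sqrt (sin (g / 2))).
set l := ln (sin (g / 2)); set l2 := ln _; set w := Num.sqrt (sin g); set p := pint _.
move=> L q0 qr W U V.
have w0 : 0 <= w by exact: sqrtr_ge0.
have U' : p <= 8 * (2 * pi + 1 + 4 / q) by lra.
have p8 : 0 <= 8 * (2 * pi + 1 + 4 / q).
  by rewrite mulr_ge0 // addr_ge0 ?divr_ge0 ?(ltW q0) //; lra.
have : w * p <= 2 * q ^+ 2 * (8 * (2 * pi + 1 + 4 / q)).
  by apply: (le_trans (ler_wpM2l w0 U')); apply: ler_wpM2r.
have -> : 2 * q ^+ 2 * (8 * (2 * pi + 1 + 4 / q)) = 16 * (q ^+ 2 * (2 * pi + 1) + 4 * q).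
  by field; rewrite gt_eqF.
move=> H; apply: le_lt_trans H _.
apply: (@le_lt_trans _ _ (C * r)).
  have q2 : q ^+ 2 <= r by rewrite expr2; clear -q0 qr r1; nra.
  have : q ^+ 2 * (2 * pi + 1) <= r * (2 * pi + 1) by rewrite ler_wpM2r //; lra.
  by rewrite /C; clear -qr; lra.
have : C * r <= C * (e / (2 * C)) by rewrite ler_pM2l.
have -> : C * (e / (2 * C)) = e / 2 by field; rewrite gt_eqF.
lra.
Qed.

End PeriodProblem.

(** * Comparison of the half-period near the two ends *)

Section PeriodExistence.
Context {R : realType}.
Implicit Types g u x y : R.

Lemma halfperiod_small_at_pi (e : R) : 0 < e ->
  exists2 g, pi / 2 < g < pi & halfperiod g < e.
Proof.
move=> e0; have p0 := @pi_gt0 R; have p2 := @pi_ge2 R.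
pose d : R := Num.min 1 ((e / (4 * pi)) ^+ 2) / 2.
have e1 : 0 < e / (4 * pi) by rewrite divr_gt0 // mulr_gt0.
have d0 : 0 < d by rewrite /d divr_gt0 // lt_min ltr01 exprn_gt0.
have d1 : d <= 1 / 2 by rewrite /d ler_pM2r ?invr_gt0 // ge_min lexx.
have d2 : d <= (e / (4 * pi)) ^+ 2.
  have : Num.min 1 ((e / (4 * pi)) ^+ 2) <= (e / (4 * pi)) ^+ 2 by rewrite ge_min lexx orbT.
  by rewrite /d; have := sqr_ge0 (e / (4 * pi)); lra.
have [p3 p4] : pi / 2 < pi - d /\ pi - d < pi by split; lra.
exists (pi - d); first by rewrite p3 p4.
have hp : pi / 2 <= pi - d < pi by rewrite p4 (ltW p3).
apply: (le_lt_trans (halfperiod_le hp)).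
have sd : Num.sqrt (sin (pi - d)) <= e / (4 * pi).
  have -> : e / (4 * pi) = Num.sqrt ((e / (4 * pi)) ^+ 2).
    by rewrite sqrtr_sqr gtr0_norm.
  rewrite ler_wsqrtr // addrC sinDpi sinN opprK (le_trans _ d2) // sin_le_id // ltW //.
have : 2 * pi * Num.sqrt (sin (pi - d)) <= 2 * pi * (e / (4 * pi)).
  by rewrite ler_wpM2l // mulr_ge0 // ltW.
have E (P : R) : 0 < P -> 2 * P * (e / (4 * P)) = e / 2.
  by move=> P0; field; rewrite gt_eqF.
rewrite (E _ p0).
by move=> h; apply: le_lt_trans h _; clear -e0; lra.
Qed.

(** Both values carry a factor [sqrt (sin e)] up to a constant, but at [e] the elliptic integral
    diverges logarithmically while at [pi - 2 * e] it stays bounded. In the period problem this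
    makes the sum of the three angles smaller than [pi] when the third one is [e]. *)
Lemma halfperiod_ratio (r b : R) : 0 < r -> 0 < b ->
  exists2 e, 0 < e < b & [/\ e < pi / 4 & halfperiod (pi - 2 * e) < r * halfperiod e].
Proof.
move=> r0 b0; have p0 := @pi_gt0 R; have p2 := @pi_ge2 R.
(* The half-period at [pi - 2 * e] is at most [2 pi (2 sqrt (sin e)) = r sqrt (sin e) K], so it
   suffices that the elliptic integral at [e] exceeds [K]. *)
pose K : R := 4 * pi / r.
have K0 : 0 < K by rewrite divr_gt0 // mulr_gt0.
pose e : R := Num.min (2 * expR (- (K + 1))) (Num.min (b / 2) (1 / 4)).
have e0 : 0 < e by rewrite /e !lt_min !mulr_gt0 ?invr_gt0 ?expR_gt0.
have [e1 e2 e3] : [/\ e <= 2 * expR (- (K + 1)), e <= b / 2 & e <= 1 / 4].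
  by rewrite /e !ge_min !lexx !orbT.
exists e; first by apply/andP; split; lra.
split; first lra.
have ep : 0 < e < pi by apply/andP; split; lra.
have s0 : 0 < sin e by exact: sin_gt0_pi.
have L := pint_inv_sqrt_Delta_ge ep.
have L2 : K + 1 <= - ln (e / 2).
  have : ln (e / 2) <= ln (expR (- (K + 1))).
    by rewrite ler_ln ?posrE ?expR_gt0 ?divr_gt0 //; lra.
  rewrite expRK; lra.
have hp : pi / 2 <= pi - 2 * e < pi by apply/andP; split; lra.
apply: (le_lt_trans (halfperiod_le hp)).
rewrite halfperiodE //.
have E : sin (pi - 2 * e) = sin (2 * e) by rewrite addrC sinDpi sinN opprK.
have S : Num.sqrt (sin (2 * e)) <= 2 * Num.sqrt (sin e).
  have -> : 2 * Num.sqrt (sin e) = Num.sqrt ((2 * Num.sqrt (sin e)) ^+ 2).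
    by rewrite sqrtr_sqr ger0_norm // mulr_ge0 // sqrtr_ge0.
  rewrite ler_wsqrtr // exprMn sqr_sqrtr ?(ltW s0) // sin_double.
  have -> : 2 * e / 2 = e by field.
  by have := cos_le1 e; clear -s0; nra.
have q0 : 0 < Num.sqrt (sin e) by rewrite sqrtr_gt0.
rewrite E; apply: (@le_lt_trans _ _ (2 * pi * (2 * Num.sqrt (sin e)))).
  by rewrite ler_wpM2l // mulr_ge0 // ltW.
have L3 : K < pint (fun u => (Num.sqrt (Delta e u))^-1) by lra.
have F (P q : R) : 2 * P * (2 * q) = r * (q * (4 * P / r)).
  by field; rewrite gt_eqF.
rewrite F -/K.
by rewrite ltr_pM2l // ltr_pM2l.
Qed.

Lemma halfperiod_continuous g : 0 < g < pi -> {for g, continuous halfperiod}.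
Proof. by move=> /is_derive_halfperiod; exact: is_derive_continuous. Qed.

End PeriodExistence.

(** * The period problem *)

Section PeriodProblemSolution.
Context {R : realType}.
Implicit Types g u x y : R.

Lemma subspace_continuous_comp (A B : set R) (g h : R -> R) :
  {within B, continuous g} -> (forall x, A x -> B (h x)) ->
  {within A, continuous h} -> {within A, continuous (fun x => g (h x))}.
Proof.
move/subspace_continuousP => cg hAB /subspace_continuousP ch.
apply/subspace_continuousP => x Ax.
apply: (cvg_comp _ _ _ (cg _ (hAB _ Ax))) => V HV.
have H : nbhs x [set z | A z -> B (h z) -> V (h z)] := ch x Ax _ HV.
suff : nbhs x [set z | A z -> V (h z)] by [].
by apply: filterS H => z hz Az; apply: hz => //; exact: hAB.
Qed.

(* The largest side is a3.  Let [d3] run through [`[e, pi / 2]], let [d2] be the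
   solution of [halfperiod d2 = r2 * halfperiod d3] on the increasing branch and
   [d1] that of [halfperiod d1 = r1 * halfperiod d3] on the decreasing branch: the
   sum of the three crosses [pi]. *)
Lemma ratio_problem_unimodal (f : R -> R) (P m : R) : 0 < P -> 0 < m <= P / 2 ->
  (forall x, 0 < x < P -> {for x, continuous f}) ->
  (forall x, 0 < x < P -> 0 < f x) ->
  (forall x y, 0 < x -> x < y -> y <= m -> f x < f y) ->
  (forall x y, m <= x -> x < y -> y < P -> f y < f x) ->
  (forall e b, 0 < e -> 0 < b -> exists2 x, 0 < x < b & f x < e) ->
  (forall e, 0 < e -> exists2 x, P / 2 < x < P & f x < e) ->
  (forall r b, 0 < r -> 0 < b -> exists2 e, 0 < e < b & [/\ e < P / 4 & f (P - 2 * e) < r * f e]) ->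
  forall r1 r2, 0 < r1 <= 1 -> 0 < r2 <= 1 ->
  exists d1 d2 d3 : R, [/\ 0 < d1, 0 < d2, 0 < d3 & d1 + d2 + d3 = P] /\
    f d1 = r1 * f d3 /\ f d2 = r2 * f d3.
Proof.
move=> P0 /andP[m0 mp] cf fpos inc dec small0 smallP ratio.
move=> r1 r2 /andP[r10 r11] /andP[r20 r21].
have cseg x y : 0 < x -> y < P -> {within `[x, y], continuous f}.
  move=> x0 yp; apply: continuous_in_subspaceT => z.
  by rewrite inE /= in_itv /= => /andP[xz zy]; apply: cf; apply/andP; split; lra.
have [e /andP[e0 em] [ep He]] := ratio _ _ r10 m0.
have incw x y : 0 < x -> x <= y -> y <= m -> f x <= f y.
  by move=> x0; rewrite le_eqVlt => /predU1P[->//|xy] ym; exact/ltW/inc.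
have decw x y : m <= x -> x <= y -> y < P -> f y <= f x.
  by move=> x0; rewrite le_eqVlt => /predU1P[->//|xy] ym; exact/ltW/dec.
have hp x : e <= x <= P / 2 -> 0 < f x.
  by move=> /andP[ex xp]; apply: fpos; apply/andP; split; lra.
have hm x : e <= x <= P / 2 -> f x <= f m.
  move=> /andP[ex xp]; have [xm|xm] := leP x m; first by apply: incw; lra.
  by apply: decw; lra.
(* A unimodal function has its minimum over [[e, P / 2]] at an end. The points [a] and [b] below are
   then far enough out for both branches to reach every value [r2 * f x] and [r1 * f x]. *)
pose mu := Num.min (f e) (f (P / 2)).
have mu0 : 0 < mu by rewrite lt_min !hp //; apply/andP; split; lra.
have hmu x : e <= x <= P / 2 -> mu <= f x.
  move=> /andP[ex xp]; rewrite ge_min; have [xm|xm] := leP x m.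
    by rewrite incw.
  by rewrite orbC decw //; lra.
have [a /andP[a0 ae] Ha] := small0 _ _ (mulr_gt0 r20 mu0) e0.
have [b /andP[bp b0] Hb] := smallP _ (mulr_gt0 r10 mu0).
have injl : {in `[a, m] &, injective f}.
  move=> x y; rewrite !in_itv /= => /andP[ax xm] /andP[ay ym] E.
  by case: (ltgtP x y) => // xy; [have := inc x y|have := inc y x]; rewrite E ltxx; lra.
have injr : {in `[m, b] &, injective f}.
  move=> x y; rewrite !in_itv /= => /andP[ax xm] /andP[ay ym] E.
  by case: (ltgtP x y) => // xy; [have := dec x y|have := dec y x]; rewrite E ltxx; lra.
have [gl gK] : exists gl, {in `[a, m], cancel f gl}.
  exists (fun y => get [set x | x \in `[a, m] /\ f x = y]) => x xm.
  by apply: get_unique => [|z [zm]]; [split|move=> E; apply: injl].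
have [gr rK] : exists gr, {in `[m, b], cancel f gr}.
  exists (fun y => get [set x | x \in `[m, b] /\ f x = y]) => x xm.
  by apply: get_unique => [|z [zm]]; [split|move=> E; apply: injr].
have am : a <= m by lra.
have mb : m <= b by lra.
have cl : {within `[a, m], continuous f} by apply: cseg; lra.
have cr : {within `[m, b], continuous f} by apply: cseg; lra.
have cgl := segment_can_le_continuous am cl gK.
have cgr := segment_can_ge_continuous mb cr rK.
have Hl y : f a <= y <= f m -> [/\ a <= gl y, gl y <= m & f (gl y) = y].
  move=> hy; have [|x xam <-] := IVT am cl (v := y).
    by rewrite min_l ?max_r ?incw.
  by rewrite gK //; move: xam; rewrite in_itv => /andP[].
have Hr y : f b <= y <= f m -> [/\ m <= gr y, gr y <= b & f (gr y) = y].
  move=> hy; have [|x xam <-] := IVT mb cr (v := y).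
    by rewrite min_r ?max_l ?decw.
  by rewrite rK //; move: xam; rewrite in_itv => /andP[].
have rl x : e <= x <= P / 2 -> f a <= r2 * f x <= f m.
  move=> hx; apply/andP; split.
    by apply: (le_trans (ltW Ha)); rewrite ler_pM2l // hmu.
  by apply: le_trans (hm x hx); rewrite ler_piMl // ltW // hp.
have rr x : e <= x <= P / 2 -> f b <= r1 * f x <= f m.
  move=> hx; apply/andP; split.
    by apply: (le_trans (ltW Hb)); rewrite ler_pM2l // hmu.
  by apply: le_trans (hm x hx); rewrite ler_piMl // ltW // hp.
pose S x := gr (r1 * f x) + gl (r2 * f x) + x.
have ep2 : e <= P / 2 by lra.
have cS : {within `[e, P / 2], continuous S}.
  have cf' (r : R) : {within `[e, P / 2], continuous (fun x => r * f x)}.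
    apply: continuous_in_subspaceT => z.
    rewrite inE /= in_itv /= => /andP[z1 z2]; apply: cvgM; first exact: cvg_cst.
    by apply: cf; apply/andP; split; lra.
  have c1 : {within `[e, P / 2], continuous (fun x => gr (r1 * f x))}.
    by apply: (subspace_continuous_comp cgr) => // x /=; rewrite !in_itv /=; exact: rr.
  have c2 : {within `[e, P / 2], continuous (fun x => gl (r2 * f x))}.
    by apply: (subspace_continuous_comp cgl) => // x /=; rewrite !in_itv /=; exact: rl.
  move=> x; apply: cvgD; first by apply: cvgD; [exact: c1|exact: c2].
  by apply: (continuous_subspaceT (f := id)) => z; exact: cvg_id.
(* The third angle is [e], the second is at most [e] because [r2 <= 1], and the first is below
   [P - 2 * e] by the choice of [e]. *)
have Se : S e < P.
  have he : e <= e <= P / 2 by rewrite lexx.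
  have [l1 l2 l3] := Hl _ (rl e he); have [k1 k2 k3] := Hr _ (rr e he).
  have : gr (r1 * f e) < P - 2 * e.
    by rewrite ltNge; apply/negP => h; have := decw _ _ (_ : m <= P - 2 * e) h; rewrite k3; lra.
  have : gl (r2 * f e) <= e.
    rewrite leNgt; apply/negP => h; have := inc _ _ e0 h l2; rewrite l3.
    have := hp e he; nra.
  by rewrite /S; lra.
(* The third angle is [P / 2], the first is at least that because [r1 <= 1] on the decreasing
   branch, and the second is positive. *)
have Sp : P < S (P / 2).
  have he : e <= P / 2 <= P / 2 by rewrite lexx andbT.
  have [l1 l2 l3] := Hl _ (rl _ he); have [k1 k2 k3] := Hr _ (rr _ he).
  have : P / 2 <= gr (r1 * f (P / 2)).
    rewrite leNgt; apply/negP => h; have := dec _ _ k1 h; rewrite k3.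
    have := hp _ he; nra.
  by rewrite /S; lra.
have [|x] := IVT ep2 cS (v := P).
  by have h := lt_trans Se Sp; rewrite min_l ?max_r ?ltW.
rewrite in_itv /= => hx Sx.
have [l1 l2 l3] := Hl _ (rl _ hx); have [k1 k2 k3] := Hr _ (rr _ hx).
exists (gr (r1 * f x)), (gl (r2 * f x)), x.
move/andP: hx => [hx1 hx2]; split; last by [].
by split; [exact: lt_le_trans m0 k1|exact: lt_le_trans a0 l1|exact: lt_le_trans e0 hx1|exact: Sx].
Qed.

Lemma period_problem_ordered (r1 r2 : R) : 0 < r1 <= 1 -> 0 < r2 <= 1 ->
  exists d1 d2 d3 : R, [/\ 0 < d1, 0 < d2, 0 < d3 & d1 + d2 + d3 = pi] /\
    halfperiod d1 = r1 * halfperiod d3 /\ halfperiod d2 = r2 * halfperiod d3.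
Proof.
have [m m0 [inc dec]] := @halfperiod_unimodal R.
apply: (ratio_problem_unimodal (@pi_gt0 R) m0) => //.
- exact: halfperiod_continuous.
- exact: halfperiod_gt0.
- exact: halfperiod_small_at_0.
- exact: halfperiod_small_at_pi.
- exact: halfperiod_ratio.
Qed.

Lemma ord3_all (Q : 'I_3 -> Prop) : Q 0 -> Q 1 -> Q (1 + 1) -> forall i, Q i.
Proof.
move=> Q0 Q1 Q2 [[|[|[|//]]] lti].
- by rewrite (_ : Ordinal lti = 0) //; apply/val_inj.
- by rewrite (_ : Ordinal lti = 1) //; apply/val_inj.
- by rewrite (_ : Ordinal lti = 1 + 1) //; apply/val_inj.
Qed.

Lemma sum_ord3 (F : 'I_3 -> R) : \sum_i F i = F 0 + F 1 + F (1 + 1).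
Proof.
rewrite !big_ord_recr big_ord0 /= add0r.
by congr (F _ + F _ + F _); apply/val_inj.
Qed.

Lemma period_problem3 (a b c : R) : 0 < a -> 0 < b -> 0 < c ->
  exists d1 d2 d3 lam : R, [/\ 0 < d1, 0 < d2, 0 < d3 & d1 + d2 + d3 = pi] /\
  [/\ 0 < lam, a = lam * halfperiod d1, b = lam * halfperiod d2 & c = lam * halfperiod d3].
Proof.
have main x y z : 0 < x <= z -> 0 < y <= z ->
    exists d1 d2 d3 lam : R, [/\ 0 < d1, 0 < d2, 0 < d3 & d1 + d2 + d3 = pi] /\
    [/\ 0 < lam, x = lam * halfperiod d1, y = lam * halfperiod d2 & z = lam * halfperiod d3].
  move=> /andP[x0 xz] /andP[y0 yz]; have z0 : 0 < z := lt_le_trans x0 xz.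
  have [|| d1 [d2 [d3 [[p1 p2 p3 s] [e1 e2]]]]] := @period_problem_ordered (x / z) (y / z).
  - by rewrite divr_gt0 //= ler_pdivrMr // mul1r.
  - by rewrite divr_gt0 //= ler_pdivrMr // mul1r.
  have h0 : 0 < halfperiod d3 by apply: halfperiod_gt0; apply/andP; split=> //; lra.
  exists d1, d2, d3, (z / halfperiod d3); split => //; rewrite e1 e2.
  move: h0; move: (halfperiod d3) => h h0; split; first exact: divr_gt0.
  - by field; rewrite !gt_eqF.
  - by field; rewrite !gt_eqF.
  - by field; rewrite !gt_eqF.
move=> a0 b0 c0.
have [ab|ab] := leP a b.
  have [bc|bc] := leP b c.
    by apply: main; rewrite ?a0 ?b0 //= (le_trans ab).
  have [||d1 [d2 [d3 [lam [[? ? ? s] [? ? ? ?]]]]]] := main a c b; rewrite ?a0 ?c0 //= ?ltW //.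
  by exists d1, d3, d2, lam; split; split => //; rewrite -s addrAC.
have [ac|ac] := leP a c.
  by apply: main; rewrite ?a0 ?b0 //= ltW // (lt_le_trans ab).
have [||d1 [d2 [d3 [lam [[? ? ? s] [? ? ? ?]]]]]] := main b c a; rewrite ?b0 ?c0 //= ?ltW //.
by exists d3, d1, d2, lam; split; split => //; rewrite -s [RHS]addrC addrA.
Qed.

Lemma period_problem (a : 'I_3 -> R) : (forall i, 0 < a i) ->
  exists (d : 'I_3 -> R) (lam : R), [/\ forall i, 0 < d i < pi, \sum_i d i = pi,
    0 < lam & forall i, a i / 2 = lam * halfperiod (d i)].
Proof.
move=> a0; have a20 i : 0 < a i / 2 by rewrite divr_gt0.
have [d1 [d2 [d3 [lam [[p1 p2 p3 s] [l0 e1 e2 e3]]]]]] :=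
  period_problem3 (a20 0) (a20 1) (a20 (1 + 1)).
exists (fun i => if i == 0 then d1 else if i == 1 then d2 else d3), lam; split => //.
- by apply: ord3_all => /=; apply/andP; split => //; lra.
- by rewrite sum_ord3.
- exact: ord3_all.
Qed.

End PeriodProblemSolution.

(** * The separated profiles *)

Section Profile.
Context {R : realType}.
Implicit Types (v w x : R).

(* On the surface [sum_l t_l = - pi / 2], where [t_l] depends on the [l]-th space
   coordinate only.  Here [w] is the value of [v] in the midplane, [x] is a signed
   square root of [w - v], [t = tv v], [dxi] is the derivative with respect to [x] of
   the (unscaled) space coordinate, and [Nx] is minus the derivative of [t] with
   respect to the latter.  Since [ev] has a critical point at [v = - 1],
   [dxi] stays regular at the face [x ^+ 2 = 1 + w], where [Nx] vanishes. *)
Definition ev v : R := (3 * v - v ^+ 3) / 2.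
Definition tv v : R := 2 * atan (ev v).
Definition gam w : R := pi / 2 - tv w.
Definition vx w x : R := w - x ^+ 2.
Definition Ap w x : R :=
  (4 - vx w x ^+ 2) * (3 - w ^+ 2 - w * vx w x - vx w x ^+ 2) * (1 + ev w * ev (vx w x)).
Definition dxi w x : R := 12 * Num.sqrt ((1 - ev w ^+ 2) / Ap w x).
Definition Nx w x : R :=
  x * (1 - vx w x ^+ 2) / (1 + ev (vx w x) ^+ 2) * Num.sqrt (Ap w x) /
  (2 * Num.sqrt (1 - ev w ^+ 2)).

Lemma cos_2atan x : cos (2 * atan x) = (1 - x ^+ 2) / (1 + x ^+ 2).
Proof.
have x1 : 0 < 1 + x ^+ 2 by rewrite ltr_wpDr ?sqr_ge0.
rewrite mulr_natl cos_mulr2n cos_atan exprVn sqr_sqrtr ?(ltW x1) // mulr2n.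
by field; rewrite gt_eqF.
Qed.

Lemma sin_2atan x : sin (2 * atan x) = 2 * x / (1 + x ^+ 2).
Proof.
have x1 : 0 < 1 + x ^+ 2 by rewrite ltr_wpDr ?sqr_ge0.
have s0 : 0 < Num.sqrt (1 + x ^+ 2) by rewrite sqrtr_gt0.
have c0 : 0 < cos (atan x) by rewrite cos_atan invr_gt0.
have := atanK x; rewrite /tan => /(canRL (mulfVK (lt0r_neq0 c0))) E.
rewrite mulr_natl sin_mulr2n E cos_atan mulr2n.
rewrite -[1 + x ^+ 2 in RHS](sqr_sqrtr (ltW x1)).
by field; rewrite gt_eqF.
Qed.

Lemma sin_gam w : sin (gam w) = (1 - ev w ^+ 2) / (1 + ev w ^+ 2).
Proof. by rewrite /gam addrC sinDpihalf cosN /tv cos_2atan. Qed.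

Lemma cos_gam w : cos (gam w) = 2 * ev w / (1 + ev w ^+ 2).
Proof. by rewrite /gam addrC cosDpihalf sinN opprK /tv sin_2atan. Qed.

Lemma oneD_gt0 x : 0 < 1 + x ^+ 2.
Proof. by rewrite ltr_wpDr ?sqr_ge0. Qed.

(** [ev w - ev v] contains the factor [w - v = x ^ 2], and [1 - ev v ^ 2] contains
    [(1 - v ^ 2) ^ 2]. What remains after these zeros at the midplane and at the face is, up to
    constants, [Ap], which is positive on the whole closed range. *)
Lemma cos_t_mul w x :
  cos (tv (vx w x) + gam w) * cos (tv (vx w x)) =
  x ^+ 2 * (1 - vx w x ^+ 2) ^+ 2 * Ap w x /
    (4 * (1 + ev (vx w x) ^+ 2) ^+ 2 * (1 + ev w ^+ 2)).
Proof.
rewrite cosD cos_gam sin_gam /tv cos_2atan sin_2atan /Ap.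
have h1 := oneD_gt0 (ev (vx w x)); have g1 := oneD_gt0 (ev w).
have E1 : 1 - ev (vx w x) ^+ 2 = (1 - vx w x ^+ 2) ^+ 2 * (4 - vx w x ^+ 2) / 4.
  by rewrite /ev; field.
have E2 : ev w - ev (vx w x) = x ^+ 2 * (3 - w ^+ 2 - w * vx w x - vx w x ^+ 2) / 2.
  by rewrite /ev /vx; field.
move: E1 E2 h1 g1; set h := ev (vx w x); set g := ev w; set v := vx w x => E1 E2 h1 g1.
transitivity (2 * (g - h) * (1 + g * h) * (1 - h ^+ 2) / ((1 + h ^+ 2) ^+ 2 * (1 + g ^+ 2))).
  by field; rewrite !gt_eqF.
by rewrite E2 E1; field; rewrite !gt_eqF.
Qed.

Lemma sin_2t_gam w x : sin (2 * tv (vx w x) + gam w) =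
  (4 * ev (vx w x) * (1 - ev (vx w x) ^+ 2) * (2 * ev w) +
   (((1 - ev (vx w x) ^+ 2)) ^+ 2 - 4 * ev (vx w x) ^+ 2) * (1 - ev w ^+ 2)) /
  ((1 + ev (vx w x) ^+ 2) ^+ 2 * (1 + ev w ^+ 2)).
Proof.
have h1 := oneD_gt0 (ev (vx w x)); have g1 := oneD_gt0 (ev w).
rewrite sinD [X in sin X]mulr_natl [X in cos X * _]mulr_natl sin_mulr2n cos_mulr2n.
rewrite cos_gam sin_gam /tv cos_2atan sin_2atan !mulr2n.
by field; rewrite !gt_eqF.
Qed.

Lemma is_derive_vx w x : is_derive x 1 (vx w) (- (2 * x)).
Proof. by rewrite /vx; derive_tac; rewrite /=; ring. Qed.

Lemma is_derive_ev_vx w x :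
  is_derive x 1 (fun x => ev (vx w x)) (- (3 * x * (1 - vx w x ^+ 2))).
Proof.
have d := is_derive_vx w x.
by rewrite /ev; derive_tac; rewrite /=; field.
Qed.

Lemma is_derive_tv_vx w x : is_derive x 1 (fun x => tv (vx w x))
  (- (6 * x * (1 - vx w x ^+ 2) / (1 + ev (vx w x) ^+ 2))).
Proof.
have d := is_derive_ev_vx w x; have h1 := oneD_gt0 (ev (vx w x)).
by rewrite /tv; derive_tac; field; rewrite gt_eqF.
Qed.

Definition dAp w x : R := 
  4 * x * vx w x * (3 - w ^+ 2 - w * vx w x - vx w x ^+ 2) * (1 + ev w * ev (vx w x))
  + (4 - vx w x ^+ 2) * (2 * x * (w + 2 * vx w x)) * (1 + ev w * ev (vx w x))
  - (4 - vx w x ^+ 2) * (3 - w ^+ 2 - w * vx w x - vx w x ^+ 2) *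
    (ev w * (3 * x * (1 - vx w x ^+ 2))).

Lemma is_derive_Ap w x : is_derive x 1 (Ap w) (dAp w x).
Proof.
have d := is_derive_vx w x; have d1 := is_derive_ev_vx w x.
by rewrite /Ap /dAp; derive_tac; rewrite /=; ring.
Qed.

(** The second order equation [t'' = - sin (2 t + g) / (2 sin g)] of the profile. Deriving it from
    the first integral would divide by [t'], which vanishes at the midplane and at the face; it is
    checked instead as a polynomial identity in [v] and [w], after [x ^ 2 = w - v]. *)
Lemma is_derive_Nx w x : 0 < Ap w x -> 0 < 1 - ev w ^+ 2 ->
  is_derive x 1 (Nx w) (2^-1 * sin (2 * tv (vx w x) + gam w) / sin (gam w) * dxi w x).
Proof.
move=> A0 g0.
have d := is_derive_vx w x; have d1 := is_derive_ev_vx w x; have d2 := is_derive_Ap w x.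
have h1 := oneD_gt0 (ev (vx w x)); have g1 := oneD_gt0 (ev w).
have sA0 : 0 < Num.sqrt (Ap w x) by rewrite sqrtr_gt0.
have sg0 : 0 < Num.sqrt (1 - ev w ^+ 2) by rewrite sqrtr_gt0.
rewrite /Nx; derive_tac; rewrite ?gt_eqF ?mulr_gt0 //.
have Es : Num.sqrt ((1 - ev w ^+ 2) / Ap w x) = Num.sqrt (1 - ev w ^+ 2) / Num.sqrt (Ap w x).
  by rewrite (sqrtrM _ (ltW g0)) sqrtrV // ltW.
rewrite sin_2t_gam sin_gam /dxi Es.
have EA := sqr_sqrtr (ltW A0); have Eg := sqr_sqrtr (ltW g0).
move: sA0 sg0 EA Eg; set a := Num.sqrt (Ap w x); set b := Num.sqrt (1 - ev w ^+ 2).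
move=> a0 b0 EA Eg.
rewrite -[X in _ / (X / _)]Eg.
set v := vx w x in h1 *; set h := ev v in h1 *; set g := ev w in g1 Eg *.
transitivity ((((1 - v ^+ 2 + 4 * x ^+ 2 * v) * (1 + h ^+ 2) +
   6 * x ^+ 2 * h * (1 - v ^+ 2) ^+ 2) * a ^+ 2 +
   x * (1 - v ^+ 2) * (1 + h ^+ 2) * dAp w x / 2) / (2 * (1 + h ^+ 2) ^+ 2 * a * b)).
  by field; rewrite !gt_eqF.
transitivity (12 * (4 * h * (1 - h ^+ 2) * (2 * g) +
   ((1 - h ^+ 2) ^+ 2 - 4 * h ^+ 2) * (1 - g ^+ 2)) / (2 * (1 + h ^+ 2) ^+ 2 * a * b)); last first.
  by rewrite -Eg; field; rewrite !gt_eqF.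
congr (_ / _); rewrite EA /dAp /Ap -/g -/v -/h.
have x2 : x ^+ 2 = w - v by rewrite /v /vx; ring.
transitivity (((1 - v ^+ 2 + 4 * (w - v) * v) * (1 + h ^+ 2) +
    6 * (w - v) * h * (1 - v ^+ 2) ^+ 2) *
   ((4 - v ^+ 2) * (3 - w ^+ 2 - w * v - v ^+ 2) * (1 + g * h)) +
   (w - v) * (1 - v ^+ 2) * (1 + h ^+ 2) * (
   2 * v * (3 - w ^+ 2 - w * v - v ^+ 2) * (1 + g * h)
   + (4 - v ^+ 2) * (w + 2 * v) * (1 + g * h)
   - (4 - v ^+ 2) * (3 - w ^+ 2 - w * v - v ^+ 2) * (g * (3 / 2 * (1 - v ^+ 2))))).
  by rewrite -x2; field.
by rewrite /h /g /ev; field.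
Qed.

End Profile.

(** * The space coordinate as an integral *)

Section ProfileIntegral.
Context {R : realType}.
Implicit Types (v w x u : R).


Lemma antiderivative (k : R -> R) (N : R) : continuous k ->
  exists F : R -> R, forall x, - N < x < N -> is_derive x 1 F (k x).
Proof.
move=> ck; pose F x := (\int[@lebesgue_measure R]_(t in `[(- N)%R, x]) k t)%R.
exists F => x /andP[x1 x2].
have [d e] := @continuous_FTC1_closed R k (- N) x N x2
  (continuous_compact_integrable (@segment_compact _ _ _) (continuous_subspaceT ck)) x1 (ck x).
apply: DeriveDef; first exact: d.
by rewrite -derive1E; exact: e.
Qed.

Lemma pint_FTC_segment (k F : R -> R) : continuous k ->
  (forall u, 0 <= u <= pi -> is_derive u 1 F (k u)) -> pint k = F pi - F 0.
Proof.
move=> ck dF; have p0 := @pi_gt0 R.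
have cF u : 0 <= u <= pi -> {for u, continuous F}.
  by move=> /dF; exact: is_derive_continuous.
rewrite /pint /Rintegral (@continuous_FTC2 _ _ F) //.
- exact: continuous_subspaceT.
- split; first by move=> u; rewrite in_itv /= => /andP[u0 up]; case: (dF u) => //; rewrite !ltW.
  + by apply: cvg_at_right_filter; apply: cF; rewrite lexx ltW.
  + by apply: cvg_at_left_filter; apply: cF; rewrite lexx ltW.
- move=> u; rewrite in_itv /= => /andP[u0 up]; rewrite derive1E.
  by case: (dF u) => //; rewrite !ltW.
Qed.

Lemma continuous_acos_segment : {within `[-1, 1], continuous (@acos R)}.
Proof.
have := @segment_can_ge_continuous R 0 pi cos acos (@pi_ge0 R)
  (continuous_subspaceT (@continuous_cos R)).
by rewrite cos0 cospi; apply; exact: cosK.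
Qed.

Lemma ev_lt v w : -1 <= v -> v < w -> w <= 1 -> ev v < ev w.
Proof.
move=> v1 vw w1; rewrite /ev ltr_pM2r ?invr_gt0 // -subr_gt0.
have -> : 3 * w - w ^+ 3 - (3 * v - v ^+ 3) =
  (w - v) * ((1 - w ^+ 2) + (1 - v ^+ 2) + (1 - w * v)) by ring.
rewrite mulr_gt0 ?subr_gt0 //; nra.
Qed.

Lemma ev_le v w : -1 <= v -> v <= w -> w <= 1 -> ev v <= ev w.
Proof. by move=> v1; rewrite le_eqVlt => /predU1P[->//|vw w1]; exact/ltW/ev_lt. Qed.

Lemma ev1 : ev (1 : R) = 1. Proof. by rewrite /ev; field. Qed.
Lemma evN1 : ev (- 1 : R) = - 1. Proof. by rewrite /ev; field. Qed.
Lemma evN v : ev (- v) = - ev v. Proof. by rewrite /ev; field. Qed.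

Lemma ev_bound w : -1 < w < 1 -> -1 < ev w < 1.
Proof.
move=> /andP[w0 w1]; apply/andP; split.
  by rewrite -[X in X < _]evN1 ev_lt // ltW.
by rewrite -[X in _ < X]ev1 ev_lt // ltW.
Qed.

Lemma Ap_gt0 w x : -1 < w < 1 -> x ^+ 2 <= 1 + w -> 0 < Ap w x.
Proof.
move=> w1 xw; have /andP[w2 w3] := w1; have /andP[g1 g2] := ev_bound w1.
have x0 := sqr_ge0 x.
have v0 : -1 <= vx w x by rewrite /vx; lra.
have v1 : vx w x <= w by rewrite /vx; lra.
have h1 : -1 <= ev (vx w x) by rewrite -[X in X <= _]evN1; apply: ev_le; lra.
have h2 : ev (vx w x) <= ev w by apply: ev_le; lra.
rewrite /Ap; move: v0 v1 h1 h2 g1 g2 w2 w3; clear.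
move: (vx w x) => v; move: (ev v) (ev w) => h g v0 v1 h1 h2 g1 g2 w2 w3.
by rewrite !mulr_gt0 //; nra.
Qed.

Lemma dxi_gt0 w x : -1 < w < 1 -> 0 < Ap w x -> 0 < dxi w x.
Proof.
move=> w1 A0; have /andP[g1 g2] := ev_bound w1.
by rewrite /dxi mulr_gt0 // sqrtr_gt0 divr_gt0 //; nra.
Qed.

Lemma gam_bound w : -1 < w < 1 -> 0 < gam w < pi.
Proof.
move=> /ev_bound/andP[g1 g2]; rewrite /gam /tv.
have := lt_atan g1; have := lt_atan g2; rewrite atanN atan1.
by move: (atan (ev w)) => y; move: (pi : R) => P h1 h2; apply/andP; split; lra.
Qed.

(** The first order profile equation solved for the space coordinate: [dxi] is [- dt / dx] over
    [sqrt (cos (t + g) cos t / sin g)]. Both sides are positive, so their squares are compared. *)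
Lemma dxiE w x : -1 < w < 1 -> 0 < x -> x ^+ 2 < 1 + w ->
  0 < cos (tv (vx w x) + gam w) * cos (tv (vx w x)) /\
  dxi w x = Num.sqrt (sin (gam w)) *
    (6 * x * (1 - vx w x ^+ 2) / (1 + ev (vx w x) ^+ 2)) /
    Num.sqrt (cos (tv (vx w x) + gam w) * cos (tv (vx w x))).
Proof.
move=> w1 x0 xw; have /andP[g1 g2] := ev_bound w1; have /andP[w2 w3] := w1.
have A0 := Ap_gt0 w1 (ltW xw).
have h1 := oneD_gt0 (ev (vx w x)); have g3 := oneD_gt0 (ev w).
have x2 : 0 < x ^+ 2 by rewrite exprn_gt0.
have v1 : 0 < 1 - vx w x ^+ 2.
  have : -1 < vx w x < 1 by rewrite /vx; apply/andP; split; lra.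
  by move=> /andP[]; move: (vx w x) => v v1 v2; nra.
have c0 : 0 < cos (tv (vx w x) + gam w) * cos (tv (vx w x)).
  have v2 : 0 < (1 - vx w x ^+ 2) ^+ 2 by rewrite exprn_gt0.
  have h2 : 0 < (1 + ev (vx w x) ^+ 2) ^+ 2 by rewrite exprn_gt0.
  rewrite cos_t_mul; apply: divr_gt0; first exact: (mulr_gt0 (mulr_gt0 x2 v2) A0).
  by apply: mulr_gt0 g3; apply: mulr_gt0.
split => //.
have g4 : 0 < 1 - ev w ^+ 2 by nra.
have s0 : 0 < sin (gam w) by rewrite sin_gam divr_gt0.
have d0 := dxi_gt0 w1 A0.
have r0 : 0 < Num.sqrt (sin (gam w)) *
    (6 * x * (1 - vx w x ^+ 2) / (1 + ev (vx w x) ^+ 2)) /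
    Num.sqrt (cos (tv (vx w x) + gam w) * cos (tv (vx w x))).
  by apply: divr_gt0; rewrite ?mulr_gt0 ?invr_gt0 ?sqrtr_gt0.
apply/eqP; rewrite -(@eqrXn2 _ 2) ?(ltW d0) ?(ltW r0) //; apply/eqP.
have Ec := cos_t_mul w x; have Es := sin_gam w.
rewrite /dxi; move: s0 c0 Ec Es A0 g4 h1 g3 v1 x0; clear.
move: (cos (tv (vx w x) + gam w) * cos (tv (vx w x))) (sin (gam w)) => c s.
move: (vx w x) (Ap w x) (ev (vx w x)) (ev w) => v A h g s0 c0 Ec Es A0 g4 h1 g3 v1 x0.
rewrite !exprMn !exprVn sqr_sqrtr ?divr_ge0 ?(ltW g4) ?(ltW A0) //.
rewrite !sqr_sqrtr ?(ltW s0) ?(ltW c0) // Ec Es.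
by field; rewrite !gt_eqF.
Qed.

(** The interval reaches strictly beyond the face value [sqrt (1 + w)], by continuity of [Ap];
    smoothness up to the boundary rests on this margin. *)
Lemma exists_xi w : -1 < w < 1 -> exists (b : R) (xi : R -> R),
  [/\ 0 < b, 1 + w < b ^+ 2, forall x, - b < x < b -> 0 < Ap w x,
      forall x, - b < x < b -> is_derive x 1 xi (dxi w x) & xi 0 = 0].
Proof.
move=> w1; have /andP[w2 w3] := w1.
pose p := Num.sqrt (1 + w).
have p0 : 0 < p by rewrite sqrtr_gt0; lra.
have p2 : p ^+ 2 = 1 + w by rewrite sqr_sqrtr //; lra.
have AN x : Ap w (- x) = Ap w x by rewrite /Ap /vx sqrrN.
have [e e0 He] : exists2 e, 0 < e & forall x, p - e < x < p + e -> 0 < Ap w x.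
  have : \forall x \near p, 0 < Ap w x.
    apply: (cvgr_gt _ (is_derive_continuous (is_derive_Ap w p))).
    by apply: Ap_gt0 => //; rewrite p2.
  move=> /nbhs_ballP[e /= e0 He]; exists e => // x hx; apply: He.
  by rewrite /ball /= ltr_norml; apply/andP; split; lra.
have pos x : 0 <= x < p + e -> 0 < Ap w x.
  move=> /andP[x0 xp]; have [xp'|xp'] := leP x p.
    by apply: Ap_gt0 => //; rewrite -p2; nra.
  by apply: He; apply/andP; split; lra.
have pos' x : - (p + e) < x < p + e -> 0 < Ap w x.
  move=> hx; have [x0|x0] := leP 0 x; first by apply: pos; lra.
  by rewrite -AN; apply: pos; lra.
pose b := p + e / 2.
(* Clamping makes the integrand continuous on the whole line without changing it between [- b] and
   [b]. *)
pose cl x := Num.max (- b) (Num.min x b).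
have clb x : - b <= cl x <= b.
  by rewrite /cl le_max lexx /= ge_max ge_min lexx orbT andbT /b; lra.
have ccl : continuous cl.
  move=> x; apply: (@continuous_max R R (cst (- b)) (fun x => Num.min x b)).
    exact: cvg_cst.
  by apply: (@continuous_min R R id (cst b)); [exact: cvg_id|exact: cvg_cst].
have ck : continuous (fun x => dxi w (cl x)).
  move=> x; apply: (@continuous_comp _ _ _ cl (dxi w)); first exact: ccl.
  have A0 : 0 < Ap w (cl x) by apply: pos'; have /andP[] := clb x; rewrite /b; lra.
  have dA := is_derive_Ap w (cl x).
  have /andP[g1 g2] := ev_bound w1.
  have [a da] : exists a, is_derive (cl x) 1 (dxi w) a.
    rewrite /dxi; eexists; repeat derive_step; rewrite ?divr_gt0 ?gt_eqF //; nra.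
  exact: is_derive_continuous da.
have [F dF] := antiderivative b ck.
exists b, (fun x => F x - F 0); split.
- by rewrite /b; lra.
- by rewrite -p2 /b; nra.
- by move=> x hx; apply: pos'; move: hx; rewrite /b; lra.
- move=> x hx; have := dF x hx.
  have -> : cl x = x.
    by have /andP[x1 x2] := hx; rewrite /cl min_l ?max_r // ltW.
  by move=> d; derive_tac; rewrite addr0.
- by rewrite subrr.
Qed.

Lemma xi_odd w b (xi : R -> R) : 0 < b -> (forall x, - b < x < b -> 0 < Ap w x) ->
  (forall x, - b < x < b -> is_derive x 1 xi (dxi w x)) -> xi 0 = 0 ->
  forall x, - b < x < b -> xi (- x) = - xi x.
Proof.
move=> b0 Apos dx x0.
suff odd_pos x : 0 < x < b -> xi (- x) = - xi x.
  move=> x /andP[xb1 xb2]; case: (ltgtP x 0) => [xn|xp|->].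
  - by rewrite -[in RHS](opprK x) (odd_pos (- x)) ?opprK //; apply/andP; split; lra.
  - by apply: odd_pos; rewrite xp.
  - by rewrite oppr0 x0 oppr0.
move=> /andP[xp xb].
have dN y : - b < y < b -> is_derive y 1 (fun y => xi (- y) + xi y) 0.
  move=> hy; have d1 := dx y hy.
  have d2 : is_derive (- y) 1 xi (dxi w y).
    have -> : dxi w y = dxi w (- y) by rewrite /dxi /Ap /vx sqrrN.
    by apply: dx; lra.
  have d3 : is_derive y 1 (fun y : R => - y) (- 1) by derive_tac.
  notypeclasses refine (is_derive_eqf (is_deriveDf
    (@is_derive_compf _ (fun y : R => - y) _ _ _ _ d2 d3) d1) _); ring.
have h1 y : y \in `]0, x[ -> is_derive y 1 (fun y => xi (- y) + xi y) 0.
  by rewrite in_itv /= => /andP[? ?]; apply: dN; apply/andP; split; lra.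
have h2 : {within `[0, x], continuous (fun y => xi (- y) + xi y)}.
  apply: continuous_in_subspaceT => y; rewrite inE /= in_itv /= => /andP[? ?].
  by apply: (is_derive_continuous (dN y _)); apply/andP; split; lra.
have [c _] := MVT xp h1 h2.
by rewrite mul0r oppr0 x0 addr0 subr0 => /eqP; rewrite addr_eq0 => /eqP.
Qed.

(** The substitution [u = acos (sin (t + g / 2) / cos (g / 2))] turns [dxi] into the elliptic
    integrand. Since [acos] has no derivative at the arguments 1 and -1 reached at the midplane and
    the face, derivatives are compared only on the open interval, with continuity up to its ends. *)
Lemma xi_halfperiod w b (xi : R -> R) : -1 < w < 1 -> 0 < b -> 1 + w < b ^+ 2 ->
  (forall x, - b < x < b -> 0 < Ap w x) ->
  (forall x, - b < x < b -> is_derive x 1 xi (dxi w x)) -> xi 0 = 0 ->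
  xi (Num.sqrt (1 + w)) = halfperiod (gam w).
Proof.
move=> w1 b0 wb Apos dx xi0; have /andP[w2 w3] := w1.
have g0 := gam_bound w1.
set p : R := Num.sqrt (1 + w); have p0 : 0 < p by rewrite sqrtr_gt0; lra.
have p2 : p ^+ 2 = 1 + w by rewrite sqr_sqrtr //; lra.
have pb : p < b by rewrite ltNge; apply/negP => bp; nra.
pose k u := Num.sqrt (sin (gam w)) / Num.sqrt (Delta (gam w) u).
have ck : continuous k := continuous_integrand g0.
have [X dX] := antiderivative (pi + 1) ck.
have pi0 := @pi_gt0 R.
have dX' u : 0 <= u <= pi -> is_derive u 1 X (k u) by move=> hu; apply: dX; lra.
rewrite /halfperiod (pint_FTC_segment ck dX').
pose c := cos (gam w / 2); have c0 : 0 < c := cos_half_gt0 g0.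
pose al x := tv (vx w x) + gam w / 2.
pose y x := sin (al x) / c.
have y0 : y 0 = 1.
  rewrite /y /al /vx expr0n /= subr0; transitivity (c / c); last exact: mulfV (lt0r_neq0 c0).
  congr (_ / _); rewrite /c -cosN -sinDpihalf; congr sin; rewrite /gam.
  by move: (tv w) (pi : R) => ? ?; field.
have yp : y p = -1.
  rewrite /y /al /vx p2.
  have -> : w - (1 + w) = -1 by ring.
  rewrite /tv evN1 atanN atan1.
  have -> : 2 * - (pi / 4) + gam w / 2 = gam w / 2 - pi / 2.
    by move: (gam w) (pi : R) => ? ?; field.
  by rewrite sinBpihalf mulNr mulfV // lt0r_neq0.
have y_sqr x : 0 < x < p ->
    0 < cos (tv (vx w x) + gam w) * cos (tv (vx w x)) /\
    1 - y x ^+ 2 = cos (tv (vx w x) + gam w) * cos (tv (vx w x)) / c ^+ 2.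
  move=> /andP[x0 xp]; have xw : x ^+ 2 < 1 + w by rewrite -p2; nra.
  have [cc _] := dxiE w1 x0 xw; split=> //.
  have Ec : c ^+ 2 - sin (al x) ^+ 2 = cos (tv (vx w x) + gam w) * cos (tv (vx w x)).
    have -> : tv (vx w x) + gam w = al x + gam w / 2 by rewrite /al; field.
    have -> : tv (vx w x) = al x - gam w / 2 by rewrite /al; field.
    rewrite cosD cosB -/c; have := cos2Dsin2 (gam w / 2); have := cos2Dsin2 (al x).
    rewrite -/c; move: (cos (al x)) (sin (al x)) (sin (gam w / 2)) => p1 p3 p4 e1 e2.
    have -> : p3 ^+ 2 = 1 - p1 ^+ 2 by rewrite -e1; ring.
    have -> : (p1 * c - p3 * p4) * (p1 * c + p3 * p4) = p1 ^+ 2 * c ^+ 2 - p3 ^+ 2 * p4 ^+ 2 by ring.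
    have -> : p4 ^+ 2 = 1 - c ^+ 2 by rewrite -e2; ring.
    have -> : p3 ^+ 2 = 1 - p1 ^+ 2 by rewrite -e1; ring.
    ring.
  by rewrite -Ec /y; field; rewrite gt_eqF.
have y_bound x : 0 < x < p -> -1 <= y x <= 1.
  move=> /y_sqr[cc E]; have : 0 < 1 - y x ^+ 2 by rewrite E divr_gt0 // exprn_gt0.
  by move: (y x) => z hz; apply/andP; split; nra.
have main x : 0 < x < p -> is_derive x 1 (fun x => X (acos (y x))) (dxi w x).
  move=> /andP[x0 xp]; have xw : x ^+ 2 < 1 + w by rewrite -p2; nra.
  have [cc E] := dxiE w1 x0 xw.
  have dt := is_derive_tv_vx w x.
  have c20 : 0 < c ^+ 2 by rewrite exprn_gt0.
  have [_ y2] := y_sqr x ltac:(apply/andP; split; lra).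
  have y1 : -1 < y x < 1.
    have : 0 < 1 - y x ^+ 2 by rewrite y2 divr_gt0.
    by move: (y x) => z hz; apply/andP; split; nra.
  have da := is_derive1_acos y1.
  have dy : is_derive x 1 y (cos (al x) * - (6 * x * (1 - vx w x ^+ 2) / (1 + ev (vx w x) ^+ 2)) / c).
    by rewrite /y /al; derive_tac; ring.
  have ya : 0 <= acos (y x) <= pi.
    by rewrite acos_ge0 ?acos_lepi //; apply/andP; split; lra.
  have dXx := dX' _ ya.
  have d1 := @is_derive_compf _ y _ _ _ _ da dy.
  notypeclasses refine (is_derive_eqf (@is_derive_compf _ (fun x => acos (y x)) _ _ _ _ dXx d1) _).
  rewrite /k /Delta acosK; last by rewrite in_itv /=; apply/andP; split; lra.
  have cal : 0 < cos (al x).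
    have vw : vx w x < w by rewrite /vx ltrBlDr ltrDl exprn_gt0.
    have v1 : -1 < vx w x by rewrite /vx; lra.
    have := lt_atan (ev_lt (ltW v1) vw (ltW w3)).
    have := lt_atan (ev_lt (lexx _) v1 (ltW (lt_trans vw w3))).
    rewrite evN1 atanN atan1 => h1 h2; have /andP[g1 g2] := g0.
    move: h1 h2 g1 g2; rewrite /al /gam /tv; move=> h1 h2 g1 g2.
    by apply: cos_gt0_pihalf; apply/andP; split; move: h1 h2 g1 g2;
      move: (atan (ev w)) (atan (ev (vx w x))) (pi : R) => ? ? ?; lra.
  have -> : 1 - cos (gam w / 2) ^+ 2 * y x ^+ 2 = cos (al x) ^+ 2.
    by rewrite -/c /y cos2sin2; field; rewrite gt_eqF.
  rewrite sqrtr_sqr gtr0_norm // y2 E sqrtrM ?(ltW cc) // sqrtrV ?(ltW c20) // sqrtr_sqr gtr0_norm //.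
  have scc : 0 < Num.sqrt (cos (tv (vx w x) + gam w) * cos (tv (vx w x))) by rewrite sqrtr_gt0.
  have h1 := oneD_gt0 (ev (vx w x)).
  have F (s q ca c' z h : R) : 0 < s -> 0 < h -> 0 < ca -> 0 < c' ->
      q / ca * (- (s / c')^-1 * (ca * - (z / h) / c')) = q * (z / h) / s.
    by move=> *; field; rewrite !gt_eqF.
  exact: F.
have cy : {within `[0, p], continuous y}.
  apply: continuous_subspaceT; apply: continuous_derive => x.
  by have dt := is_derive_tv_vx w x; rewrite /y /al; eexists; repeat derive_step.
have yb x : `[0, p]%classic x -> `[-1, 1]%classic (y x).
  rewrite /= !in_itv /= => /andP[x0 xp].
  have [->|xn0] := eqVneq x 0; first by rewrite y0; apply/andP; split; lra.
  have [->|xnp] := eqVneq x p; first by rewrite yp; apply/andP; split; lra.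
  have xi' : 0 < x < p by rewrite !lt_neqAle x0 xp xnp eq_sym xn0.
  exact: (y_bound x xi').
have ca : {within `[0, p], continuous (fun x => acos (y x))}.
  exact: (@subspace_continuous_comp R _ _ _ _ continuous_acos_segment yb cy).
have cX : {within `[0, pi], continuous X}.
  apply: continuous_in_subspaceT => u; rewrite inE /= in_itv /= => hu.
  exact: is_derive_continuous (dX' u hu).
have cXa : {within `[0, p], continuous (fun x => X (acos (y x)))}.
  apply: (@subspace_continuous_comp R _ _ _ (fun x => acos (y x)) cX _ ca) => x /yb.
  rewrite /= !in_itv /= => hy; by rewrite acos_ge0 ?acos_lepi.
have cxi : {within `[0, p], continuous xi}.
  apply: continuous_in_subspaceT => u; rewrite inE /= in_itv /= => /andP[u0 up].
  by apply: (is_derive_continuous (dx u _)); apply/andP; split; lra.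
have h1 x : x \in `]0, p[ -> is_derive x 1 (fun x => xi x - X (acos (y x))) 0.
  rewrite in_itv /= => /andP[x0 xp]; rewrite -[0](subrr (dxi w x)).
  apply: is_deriveDf; first by apply: dx; apply/andP; split; lra.
  by apply: is_deriveNf; apply: main; rewrite x0.
have h2 : {within `[0, p], continuous (fun x => xi x - X (acos (y x)))}.
  by move=> x; apply: cvgB; [exact: cxi|exact: cXa].
have [z _] := MVT p0 h1 h2.
by rewrite mul0r y0 yp acos1 acosN1 xi0; lra.
Qed.

End ProfileIntegral.

(** * First zeros depending on a parameter *)

Section ImplicitFunction.
Context {R : realType} {V : normedModType R}.
Implicit Types (z : V) (t : R).

Lemma differentiable_small (W : normedModType R) (r : V -> W) z0 : r z0 = 0 ->
  (forall e : R, 0 < e -> \forall z \near z0, `|r z| <= e * `|z - z0|) ->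
  differentiable r z0.
Proof.
move=> r0 rsmall; apply/diffP => /=.
apply: (@getPex _ (fun (df : {linear V -> W}) => continuous df /\
  forall y, r y = r (lim (nbhs z0)) + df (y - lim (nbhs z0))
                  +o_(y \near z0) (y - lim (nbhs z0)))).
exists (@GRing.null_fun V W : {linear V -> W}); split => /=; first by move=> x; exact: cvg_cst.
rewrite lim_id //.
have H : r = (fun _ => r z0 + 0) +o_ (nbhs z0) (fun y => y - z0).
  apply/eqaddoP => e e0; near=> z.
  have -> : (r - (fun _ => r z0 + 0)) z = r z by rewrite -[LHS]/(r z - (r z0 + 0)) r0 addr0 subr0.
  by near: z; exact: rsmall.
by move: H; rewrite funeqE.
Unshelve. all: by end_near.
Qed.

Lemma differentiable_near (W : normedModType R) (f g : V -> W) z0 :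
  (\forall z \near z0, f z = g z) -> differentiable f z0 -> differentiable g z0.
Proof.
move=> fg df; have -> : g = f + (g - f) by rewrite addrC subrK.
have r0 : \forall z \near z0, (g - f) z = 0.
  by apply: filterS fg => z fz; rewrite -[LHS]/(g z - f z) fz subrr.
apply: differentiableD => //; apply: differentiable_small; first exact: (nbhs_singleton r0).
by move=> e e0; apply: filterS r0 => z ->; rewrite normr0 mulr_ge0 // ltW.
Qed.

(** Split off [m z0 *: k]; the rest [k (m - m z0)] is small of higher order because [k] is of the
    order of [z - z0]. This serves a quotient whose denominator is only known to be continuous. *)
Lemma differentiable_mul_vanishing (k m : V -> R) z0 : differentiable k z0 -> k z0 = 0 ->
  {for z0, continuous m} -> differentiable (fun z => k z * m z) z0.
Proof.
move=> dk k0 cm.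
have -> : (fun z => k z * m z) = m z0 *: k + (fun z => k z * (m z - m z0)).
  apply/funext => z; rewrite -[RHS]/(m z0 * k z + k z * (m z - m z0)); ring.
apply: differentiableD; first exact: differentiableZ.
apply: differentiable_small; first by rewrite k0 mul0r.
move=> e e0.
have [C C0 HC] : exists2 C : R, 0 < C & \forall z \near z0, `|k z| <= C * `|z - z0|.
  have [C1 C10 HC1] := linear_lipschitz (diff_continuous dk).
  apply: (ex_intro2 _ _ (C1 + 1)); [by rewrite addr_gt0|].
  have [[_ E]] := dk; move/eqaddoP: E => /(_ 1 ltr01); rewrite lim_id // => H.
  near=> z.
  have hz : `|k z - 'd k z0 (z - z0)| <= `|z - z0|.
    suff : `|k z - (k z0 + 'd k z0 (z - z0))| <= 1 * `|z - z0| by rewrite k0 add0r mul1r.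
    by near: z; exact: H.
  rewrite mulrDl mul1r -[k z](subrK ('d k z0 (z - z0))) addrC.
  by apply: le_trans (ler_normD _ _) _; apply: lerD.
have eC : 0 < e / C by rewrite divr_gt0.
near=> z.
have h1 : `|k z| <= C * `|z - z0| by near: z.
have h2 : `|m z - m z0| <= e / C.
  rewrite distrC; near: z; apply: cvgr_dist_le eC; exact: cm.
rewrite normrM; apply: le_trans (ler_pM _ _ h1 h2) _ => //.
by rewrite mulrAC mulrCA mulfV ?mulr1 ?lt0r_neq0.
Unshelve. all: by end_near.
Qed.
Context (G Gd : R -> V -> R).
Hypothesis dG : forall t z, is_derive t 1 (G ^~ z) (Gd t z).
Hypothesis cG : forall t z, (fun p : R * V => G p.1 p.2) @ (t, z) --> G t z.
Hypothesis cGd : forall t z, (fun p : R * V => Gd p.1 p.2) @ (t, z) --> Gd t z.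
Hypothesis diffG : forall t z, differentiable (G t) z.

Definition first_zero z t :=
  [/\ 0 < t, G t z = 0, Gd t z < 0 & forall s, 0 <= s < t -> 0 < G s z].

Lemma first_zero_unique z t1 t2 : first_zero z t1 -> first_zero z t2 -> t1 = t2.
Proof.
move=> [t10 G1 _ p1] [t20 G2 _ p2]; case: (ltgtP t1 t2) => // t12.
  by have := p2 t1; rewrite G1 ltxx t12 ltW // => /(_ isT).
by have := p1 t2; rewrite G2 ltxx t12 ltW // => /(_ isT).
Qed.

Lemma G_MVT z t s : t < s -> exists2 c, t < c < s & G s z - G t z = Gd c z * (s - t).
Proof.
move=> ts; have [c cts E] := MVT ts (fun x _ => dG x z)
  (derivable_within_continuous (fun x _ => ex_derive (is_derive := dG x z))).
by exists c => //; move: cts; rewrite in_itv.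
Qed.

(** On [[0, t0 - h]] compactness keeps [G] positive for all nearby [z]; on [[t0 - h, t0 + h]] it is
    strictly decreasing in [t] and changes sign. *)
Lemma first_zero_near z0 t0 e : first_zero z0 t0 -> 0 < e ->
  \forall z \near z0, exists2 t, first_zero z t & `|t - t0| < e.
Proof.
move=> [t00 G0 Gd0 pos0] e0.
have : \forall p \near (t0, z0), Gd p.1 p.2 < 0.
  exact: (cvgr_lt _ (@cGd t0 z0) _ Gd0).
move=> [[/= A B] [/nbhs_ballP[d /= d0 Ad] nB] AB].
pose h := Num.min (d / 2) (Num.min (e / 2) (t0 / 2)).
have h0 : 0 < h by rewrite /h !lt_min !divr_gt0.
have [h1 h2 h3] : [/\ h <= d / 2, h <= e / 2 & h <= t0 / 2].
  by rewrite /h !ge_min !lexx !orbT.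
have Gdneg t z : t0 - h <= t <= t0 + h -> B z -> Gd t z < 0.
  move=> ht Bz; apply: (AB (t, z)); split => //=; apply: Ad.
  by rewrite /ball /= ltr_norml; apply/andP; split; lra.
have B0 : B z0 by exact: nbhs_singleton.
have Gh : G (t0 + h) z0 < 0.
  have [c cts] := @G_MVT z0 t0 (t0 + h) ltac:(lra).
  rewrite G0 subr0 => ->; rewrite pmulr_llt0; last by lra.
  by apply: Gdneg => //; lra.
have n1 : \forall z \near z0, G (t0 + h) z < 0.
  exact: (cvgr_lt _ (differentiable_continuous (diffG (t0 + h) z0)) _ Gh).
have n2 : \forall z \near z0, forall t, 0 <= t <= t0 - h -> 0 < G t z.
  have /compact_near_coveringP K := @segment_compact R 0 (t0 - h).
  have H t : `[0, t0 - h]%classic t -> \forall t' \near t & z \near z0, 0 < G t' z.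
    rewrite /= in_itv /= => /andP[t1 t2].
    have Gt0 : 0 < G t z0 by apply: pos0; apply/andP; split; lra.
    exact: (cvgr_gt _ (@cG t z0) _ Gt0).
  have Hn := K V (nbhs z0) (fun z t => 0 < G t z) _ H.
  near=> z => t ht; have Hz : `[0, t0 - h]%classic `<=` (fun t => 0 < G t z) by near: z; exact: Hn.
  by apply: Hz; rewrite /= in_itv.
near=> z.
have Bz : B z by near: z.
have Gz1 : G (t0 + h) z < 0 by near: z.
have Gz2 t : 0 <= t <= t0 - h -> 0 < G t z.
  by move: t; near: z.
have cGz : {within `[t0 - h, t0 + h], continuous (G ^~ z)}.
  exact: (derivable_within_continuous (fun x _ => ex_derive (is_derive := dG x z))).
have Gm : 0 < G (t0 - h) z by apply: Gz2; lra.
have [||t] := IVT _ cGz (v := 0); [lra| |].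
  by rewrite /= min_r ?max_l ?ltW // (lt_trans Gz1).
rewrite in_itv /= => /andP[t1 t2] Gt.
have t1' : t0 - h < t.
  by rewrite lt_neqAle t1 andbT; apply/eqP => E; move: Gm; rewrite E Gt ltxx.
exists t; last by rewrite ltr_norml; apply/andP; split; lra.
split=> //; first by lra.
  by apply: Gdneg => //; lra.
move=> s /andP[s0 st]; have [sh|sh] := leP s (t0 - h); first by apply: Gz2; lra.
have [c cst] := G_MVT z st; rewrite Gt sub0r => E.
have : Gd c z < 0 by apply: Gdneg => //; lra.
rewrite -oppr_lt0 E; nra.
Unshelve. all: by end_near.
Qed.

Definition zero_of z : R := get (first_zero z).

Lemma zero_ofP z t : first_zero z t -> first_zero z (zero_of z) /\ zero_of z = t.
Proof.
move=> zt; have H : first_zero z (zero_of z) by apply: getPex; exists t.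
by split=> //; exact: first_zero_unique H zt.
Qed.

Lemma zero_of_near z0 t0 : first_zero z0 t0 ->
  \forall z \near z0, first_zero z (zero_of z).
Proof.
move=> /first_zero_near /(_ ltr01).
by apply: filterS => z [t /zero_ofP[]].
Qed.

Lemma zero_of_continuous z0 t0 : first_zero z0 t0 -> {for z0, continuous zero_of}.
Proof.
move=> H; have [_ E] := zero_ofP H; apply/cvgrPdist_lt => e e0.
have := first_zero_near H e0; apply: filterS => z [t /zero_ofP[_ ->]].
by rewrite E distrC.
Qed.

Lemma zero_of_differentiable z0 t0 : first_zero z0 t0 ->
  differentiable zero_of z0.
Proof.
move=> H; have [_ E] := zero_ofP H.
have cz := zero_of_continuous H.
have [t00 G0 Gd0 pos0] := H.
(* The mean value theorem gives [zero_of z = t0 - G t0 z / Gd (c z) z] near [z0]. The intermediate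
   point [c z] is an arbitrary choice, but its distance bound makes it continuous at [z0]. *)
have /choice[c Hc] : forall z, exists c, `|c - t0| <= `|zero_of z - t0| /\
    G (zero_of z) z - G t0 z = Gd c z * (zero_of z - t0).
  move=> z; case: (ltgtP t0 (zero_of z)) => [tz|tz|<-].
  - have [c /andP[c1 c2] Ec] := G_MVT z tz; exists c; split => //.
    by rewrite !ger0_norm; lra.
  - have [c /andP[c1 c2] Ec] := G_MVT z tz; exists c; split.
      by rewrite !ler0_norm; lra.
    by rewrite -opprB Ec; ring.
  - by exists t0; rewrite !subrr mulr0.
have c0 : c z0 = t0.
  have [+ _] := Hc z0; rewrite E subrr normr0 normr_le0 subr_eq0 => /eqP; exact.
have cc : {for z0, continuous c}.
  apply/cvgrPdist_lt => e e0; rewrite c0.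
  have /cvgrPdist_lt /(_ e e0) := cz; rewrite E; apply: filterS => z.
  by rewrite ![`|t0 - _|]distrC; apply: le_lt_trans; case: (Hc z).
have cGc : (fun z => Gd (c z) z) @ z0 --> Gd (c z0) z0.
  exact: (cvg_comp (fun z => (c z, z)) (fun p => Gd p.1 p.2) (cvg_pair cc cvg_id) (@cGd _ _)).
have Gc0 : Gd (c z0) z0 < 0 by rewrite c0.
have cm : {for z0, continuous (fun z => (Gd (c z) z)^-1)}.
  by apply: cvgV => //; rewrite lt_eqF.
pose k z := - G t0 z.
have dkm : differentiable (fun z => k z * (Gd (c z) z)^-1) z0.
  apply: differentiable_mul_vanishing => //; first exact: differentiableN.
  by rewrite /k G0 oppr0.
have dz : differentiable (cst t0 + (fun z => k z * (Gd (c z) z)^-1)) z0.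
  exact: differentiableD.
apply: differentiable_near dz; near=> z.
have [_ Gz _ _] : first_zero z (zero_of z) by near: z; exact: zero_of_near H.
have Gcz : Gd (c z) z < 0 by near: z; exact: (cvgr_lt _ cGc _ Gc0).
have [_] := Hc z; rewrite Gz sub0r => Ez.
rewrite -[LHS]/(t0 + k z * (Gd (c z) z)^-1) /k Ez.
by rewrite mulrAC mulfV ?lt_eqF // mul1r addrC subrK.
Unshelve. all: by end_near.
Qed.

End ImplicitFunction.

(** * Smooth functions on the plane *)

Section Smoothness.
Context {R : realType}.
Local Notation plane := 'rV[R]_2.
Local Notation e_ i := (delta_mx 0 i : plane).
Implicit Types (f g : plane -> R) (p v : plane) (i : 'I_2) (n : nat).

(** Differentiability accompanies the value because ['D_v f p] is a limit, which has a default value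
    when it does not exist. *)
Definition has_D f p v (a : R) := differentiable f p /\ 'D_v f p = a.

Lemma has_D_cst (a : R) p v : has_D (fun _ => a) p v 0.
Proof. by split; [exact: differentiable_cst|exact: derive_cst]. Qed.

Lemma has_D_coord i p v : has_D (fun z : plane => z 0 i) p v (v 0 i).
Proof.
split; first exact: differentiable_coord.
apply: cvg_lim => //; apply: cvg_near_cst.
near=> h; rewrite /= !mxE addrK /GRing.scale /= mulrA mulVf ?mul1r //.
by near: h; exact: nbhs_dnbhs_neq.
Unshelve. all: by end_near. Qed.

Lemma has_DD f g p v a b : has_D f p v a -> has_D g p v b ->
  has_D (fun z => f z + g z) p v (a + b).
Proof.
move=> [df <-] [dg <-]; split; first exact: differentiableD.
by rewrite deriveD //; exact: diff_derivable.
Qed.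

Lemma has_DN f p v a : has_D f p v a -> has_D (fun z => - f z) p v (- a).
Proof.
move=> [df <-]; split; first exact: differentiableN.
by rewrite deriveN //; exact: diff_derivable.
Qed.

Lemma has_DM f g p v a b : has_D f p v a -> has_D g p v b ->
  has_D (fun z => f z * g z) p v (a * g p + f p * b).
Proof.
move=> [df <-] [dg <-]; split; first exact: differentiableM.
by rewrite deriveM; [rewrite /GRing.scale /= addrC [_ * g p]mulrC|exact: diff_derivable..].
Qed.

Lemma has_D_comp (phi : R -> R) f p v a b : is_derive (f p) 1 phi b -> has_D f p v a ->
  has_D (fun z => phi (f z)) p v (b * a).
Proof.
move=> dphi [df <-].
have dphi' : differentiable phi (f p) by apply/derivable1_diffP; case: dphi.
split; first exact: differentiable_comp.
have E x : 'd phi (f p) x = b * x.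
  have -> : b = 'd phi (f p) 1 by rewrite -deriveE //; case: dphi.
  by rewrite -[in LHS](mulr1 x) -[x * 1]/(x *: (1 : R)) linearZ mulrC.
rewrite -[(fun z => phi (f z))]/(phi \o f) deriveE; last exact: differentiable_comp.
by rewrite diff_comp //= E deriveE.
Qed.

Lemma has_D_eq f p v a b : has_D f p v a -> a = b -> has_D f p v b.
Proof. by move=> + <-. Qed.

Lemma has_D_near f g p v a : (\forall z \near p, f z = g z) -> has_D f p v a -> has_D g p v a.
Proof.
move=> fg [df Da].
split; first exact: differentiable_near fg df.
by rewrite -Da; apply: near_eq_derive => //; apply: filterS fg => z.
Qed.

(** Order 0 demands nothing, so order [n] means [n] times differentiable on [U]. The derivative is
    represented by any [g] equal to it on [U], which lets explicit formulas stand for it. *)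
Fixpoint smooth_n (U : set plane) n f : Prop :=
  if n is n'.+1 then (forall p, U p -> differentiable f p) /\
    forall i, exists g, (forall p, U p -> 'D_(e_ i) f p = g p) /\ smooth_n U n' g
  else True.

Context (U : set plane).
Hypothesis oU : open U.

Lemma smooth_n_intro n f (Df : 'I_2 -> plane -> R) :
  (forall p i, U p -> has_D f p (e_ i) (Df i p)) -> (forall i, smooth_n U n (Df i)) ->
  smooth_n U n.+1 f.
Proof.
move=> hf hD; split; first by move=> p Up; case: (hf p 0 Up).
by move=> i; exists (Df i); split => // p Up; case: (hf p i Up).
Qed.

Lemma smooth_n_elim n f : smooth_n U n.+1 f -> exists2 Df : 'I_2 -> plane -> R,
  (forall p i, U p -> has_D f p (e_ i) (Df i p)) & forall i, smooth_n U n (Df i).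
Proof.
move=> [df /choice[Df hD]]; exists Df; last by move=> i; case: (hD i).
by move=> p i Up; split; [exact: df|case: (hD i) => + _; exact].
Qed.

Lemma smooth_n_le n f : smooth_n U n.+1 f -> smooth_n U n f.
Proof.
elim: n f => // n IH f /smooth_n_elim[Df hf hD].
by apply: smooth_n_intro hf _ => i; exact: IH.
Qed.

Lemma smooth_n_ext n f g : (forall p, U p -> f p = g p) -> smooth_n U n f -> smooth_n U n g.
Proof.
case: n => // n fg /smooth_n_elim[Df hf hD]; apply: smooth_n_intro hD => p i Up.
apply: has_D_near (hf p i Up); have : nbhs p U by exact: open_nbhs_nbhs.
exact: filterS.
Qed.

Lemma smooth_n_cst n a : smooth_n U n (fun _ => a).
Proof.
elim: n a => // n IH a; apply: (smooth_n_intro (Df := fun _ _ => 0)) => // p i _.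
exact: has_D_cst.
Qed.

Lemma smooth_n_coord n i : smooth_n U n (fun z => z 0 i).
Proof.
case: n => // n; apply: (smooth_n_intro (Df := fun j _ => e_ j 0 i)); last first.
  by move=> j; exact: smooth_n_cst.
by move=> p j _; exact: has_D_coord.
Qed.

Lemma smooth_nD n f g : smooth_n U n f -> smooth_n U n g -> smooth_n U n (fun z => f z + g z).
Proof.
elim: n f g => // n IH f g /smooth_n_elim[Df hf hDf] /smooth_n_elim[Dg hg hDg].
apply: (smooth_n_intro (Df := fun i z => Df i z + Dg i z)) => [p i Up|i]; last exact: IH.
by apply: has_DD; [exact: hf|exact: hg].
Qed.

Lemma smooth_nM n f g : smooth_n U n f -> smooth_n U n g -> smooth_n U n (fun z => f z * g z).
Proof.
elim: n f g => // n IH f g sf sg; have [Df hf hDf] := smooth_n_elim sf.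
have [Dg hg hDg] := smooth_n_elim sg.
apply: (smooth_n_intro (Df := fun i z => Df i z * g z + f z * Dg i z)) => [p i Up|i].
  by apply: has_DM; [exact: hf|exact: hg].
by apply: smooth_nD; apply: IH => //; exact: smooth_n_le.
Qed.

Lemma smooth_nN n f : smooth_n U n f -> smooth_n U n (fun z => - f z).
Proof.
move=> sf; apply: (@smooth_n_ext _ (fun z => -1 * f z)) => [p _|]; first by rewrite mulN1r.
by apply: smooth_nM => //; exact: smooth_n_cst.
Qed.

Lemma smooth_nX n f m : smooth_n U n f -> smooth_n U n (fun z => f z ^+ m).
Proof.
move=> sf; elim: m => [|m IH].
  by apply: (@smooth_n_ext _ (fun _ => 1)) => [p _|]; [rewrite expr0|exact: smooth_n_cst].
apply: (@smooth_n_ext _ (fun z => f z * f z ^+ m)) => [p _|]; first by rewrite exprS.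
exact: smooth_nM.
Qed.

(** The hypothesis on [dphi] is one order lower. For the inverse and the square root, [dphi] is
    expressed through the function itself, so induction on the order closes. *)
Lemma smooth_n_comp n (phi dphi : R -> R) f :
  (forall p, U p -> is_derive (f p) 1 phi (dphi (f p))) ->
  smooth_n U n.+1 f -> smooth_n U n (fun z => dphi (f z)) ->
  smooth_n U n.+1 (fun z => phi (f z)).
Proof.
move=> hphi /smooth_n_elim[Df hf hDf] sd.
apply: (smooth_n_intro (Df := fun i z => dphi (f z) * Df i z)) => [p i Up|i].
  by apply: has_D_comp; [exact: hphi|exact: hf].
exact: smooth_nM.
Qed.

Lemma smooth_nV n f : (forall p, U p -> f p != 0) -> smooth_n U n f ->
  smooth_n U n (fun z => (f z)^-1).
Proof.
move=> f0; elim: n => // n IH sf.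
apply: (@smooth_n_comp _ (fun t => t^-1) (fun t => - (t^-1) ^+ 2)) => //.
  move=> p Up; have h := f0 p Up; derive_tac.
  by rewrite exprVn mulNr mul1r.
by apply/smooth_nN/smooth_nX/IH; exact: smooth_n_le.
Qed.

Lemma smooth_n_sqrt n f : (forall p, U p -> 0 < f p) -> smooth_n U n f ->
  smooth_n U n (fun z => Num.sqrt (f z)).
Proof.
move=> f0; elim: n => // n IH sf.
apply: (@smooth_n_comp _ Num.sqrt (fun t => (2 * Num.sqrt t)^-1)) => //.
  by move=> p Up; apply: is_derive1_sqrt; exact: f0.
apply: smooth_nV => [p Up|]; first by rewrite mulf_neq0 // gt_eqF // sqrtr_gt0 f0.
by apply: smooth_nM; [exact: smooth_n_cst|apply: IH; exact: smooth_n_le].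
Qed.

End Smoothness.

(** * Mean curvature from a separated normal *)

Section VectorValued.
Context {R : realType}.
Local Notation plane := 'rV[R]_2.
Local Notation e_ i := (delta_mx 0 i : plane).
Implicit Types (f : 'I_3 -> plane -> R) (p : plane) (U : set plane).

Definition rowf f : plane -> 'rV[R]_3 := fun z => \row_l f l z.

Lemma differentiable_rowf f p : (forall l, differentiable (f l) p) ->
  differentiable (rowf f) p.
Proof.
move=> df; have -> : rowf f = \sum_(l < 3) (fun z => f l z *: (delta_mx 0 l : 'rV[R]_3)).
  apply/funext => z; rewrite /rowf fct_sumE; apply/rowP => k; rewrite !mxE summxE.
  rewrite (bigD1 k) //= big1 ?addr0 => [|l lk]; rewrite !mxE eqxx ?eqxx ?mulr1 //=.
  by rewrite eq_sym (negbTE lk) mulr0.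
by apply: differentiable_sum => l; exact: differentiableZl.
Qed.

Lemma derive_rowf f p v : (forall l, differentiable (f l) p) ->
  'D_v (rowf f) p = \row_l 'D_v (f l) p.
Proof.
move=> df; rewrite derive_mx; last exact/diff_derivable/differentiable_rowf.
by apply/rowP => l; rewrite !mxE; congr ('D_v _ p); apply/funext => z; rewrite mxE.
Qed.

Lemma partial_near (X Y : plane -> 'rV[R]_3) i p : (\forall z \near p, X z = Y z) ->
  partial i X p = partial i Y p.
Proof. by move=> XY; apply: near_eq_derive. Qed.

Lemma smooth_D U (f0 : plane -> R) i : open U -> (forall n, smooth_n U n f0) ->
  forall n, smooth_n U n ('D_(e_ i) f0).
Proof.
move=> oU sf n; have [_ /(_ i)[g [gE sg]]] := sf n.+1.
by apply: (smooth_n_ext oU) sg => p Up; rewrite gE.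
Qed.

Lemma foldr_partial_rowf U f (s : seq 'I_2) : open U ->
  (forall l n, smooth_n U n (f l)) ->
  exists2 g : 'I_3 -> plane -> R,
    forall p, U p -> foldr (@partial R) (rowf f) s p = rowf g p &
    forall l n, smooth_n U n (g l).
Proof.
move=> oU sf; elim: s => [|i s [g gE sg]] /=; first by exists f.
exists (fun l => 'D_(e_ i) (g l)) => [p Up|l n]; last exact: smooth_D.
rewrite (@partial_near _ (rowf g)); last first.
  by have : nbhs p U by [exact: open_nbhs_nbhs]; apply: filterS.
by rewrite /partial derive_rowf // => l; have [+ _] := sg l 1%N; exact.
Qed.

Lemma smooth_on_rowf U f : open U -> (forall l n, smooth_n U n (f l)) ->
  smooth_on U (rowf f).
Proof.
move=> oU sf s p Up; have [g gE sg] := foldr_partial_rowf s oU sf.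
apply: (@differentiable_near _ _ _ (rowf g)).
  have : nbhs p U by exact: open_nbhs_nbhs.
  by apply: filterS => z /gE.
by apply: differentiable_rowf => l; have [+ _] := sg l 1%N; exact.
Qed.

Lemma ord3_3 : 1 + 1 + 1 = 0 :> 'I_3. Proof. exact/val_inj. Qed.

Lemma dotvE (u v : 'rV[R]_3) : dotv u v =
  u 0 0 * v 0 0 + u 0 1 * v 0 1 + u 0 (1 + 1) * v 0 (1 + 1).
Proof. exact: sum_ord3. Qed.

Lemma sum_ord2 (F : 'I_2 -> R) : \sum_i F i = F 0 + F 1.
Proof.
rewrite !big_ord_recr big_ord0 /= add0r.
by congr (F _ + F _); apply/val_inj.
Qed.

Lemma ord2_all (Q : 'I_2 -> Prop) : Q 0 -> Q 1 -> forall i, Q i.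
Proof.
move=> Q0 Q1 [[|[|//]] lti].
- by rewrite (_ : Ordinal lti = 0) //; apply/val_inj.
- by rewrite (_ : Ordinal lti = 1) //; apply/val_inj.
Qed.

Lemma trace_inv_mul (A B : 'M[R]_2) : A 0 0 * A 1 1 - A 0 1 * A 1 0 != 0 ->
  \tr (invmx A *m B) = (A 0 0 * A 1 1 - A 0 1 * A 1 0)^-1 *
    (A 1 1 * B 0 0 - A 0 1 * B 1 0 - A 1 0 * B 0 1 + A 0 0 * B 1 1).
Proof.
set d := _ - _ => d0.
pose C : 'M[R]_2 := d^-1 *: \matrix_(i, j)
  (if i == 0 then (if j == 0 then A 1 1 else - A 0 1)
   else (if j == 0 then - A 1 0 else A 0 0)).
have AC : A *m C = 1%:M.
  apply/matrixP; apply: ord2_all; apply: ord2_all; rewrite !mxE sum_ord2 !mxE /=;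
  rewrite /d in d0 *; by field.
have -> : invmx A = C.
  by have [uA _] := mulmx1_unit AC; rewrite -[LHS]mulmx1 -AC mulmxA mulVmx // mul1mx.
rewrite /mxtrace sum_ord2 !mxE !sum_ord2 !mxE /=; ring.
Qed.

(* With [c] the cross product of the tangent vectors [a] and [b], the left factor
   is [|c|^2] times the trace of [diag x] over the tangent plane. *)
Lemma tangent_trace (a0 a1 a2 b0 b1 b2 x0 x1 x2 : R) :
  (b0 * b0 + b1 * b1 + b2 * b2) * (x0 * a0 * a0 + x1 * a1 * a1 + x2 * a2 * a2)
  - 2 * (a0 * b0 + a1 * b1 + a2 * b2) * (x0 * a0 * b0 + x1 * a1 * b1 + x2 * a2 * b2)
  + (a0 * a0 + a1 * a1 + a2 * a2) * (x0 * b0 * b0 + x1 * b1 * b1 + x2 * b2 * b2) =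
  x0 * ((a2 * b0 - a0 * b2) ^+ 2 + (a0 * b1 - a1 * b0) ^+ 2) +
  x1 * ((a0 * b1 - a1 * b0) ^+ 2 + (a1 * b2 - a2 * b1) ^+ 2) +
  x2 * ((a1 * b2 - a2 * b1) ^+ 2 + (a2 * b0 - a0 * b2) ^+ 2).
Proof. ring. Qed.

Lemma cross_parallel (n0 n1 n2 a0 a1 a2 b0 b1 b2 : R) :
  n0 * a0 + n1 * a1 + n2 * a2 = 0 -> n0 * b0 + n1 * b1 + n2 * b2 = 0 ->
  [/\ n0 * (a2 * b0 - a0 * b2) = n1 * (a1 * b2 - a2 * b1),
      n1 * (a0 * b1 - a1 * b0) = n2 * (a2 * b0 - a0 * b2) &
      n2 * (a1 * b2 - a2 * b1) = n0 * (a0 * b1 - a1 * b0)].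
Proof.
move=> ha hb; split; apply/eqP; rewrite -subr_eq0; apply/eqP.
- transitivity (a2 * (n0 * b0 + n1 * b1 + n2 * b2) - b2 * (n0 * a0 + n1 * a1 + n2 * a2)).
    by ring.
  by rewrite ha hb !mulr0 subrr.
- transitivity (a0 * (n0 * b0 + n1 * b1 + n2 * b2) - b0 * (n0 * a0 + n1 * a1 + n2 * a2)).
    by ring.
  by rewrite ha hb !mulr0 subrr.
- transitivity (a1 * (n0 * b0 + n1 * b1 + n2 * b2) - b1 * (n0 * a0 + n1 * a1 + n2 * a2)).
    by ring.
  by rewrite ha hb !mulr0 subrr.
Qed.

(** For a separated level set the normal component [N l] varies only with the coordinate [f l], at
    rate [Dn l]. Hence the second form is, up to a factor, the restriction of the diagonal form [Dn]
    to the tangent plane, and its trace is the sum in the last hypothesis. *)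
Lemma mean_curvature_eq0 U f (N Dn : 'I_3 -> plane -> R) p : open U -> U p ->
  (forall l n, smooth_n U n (f l)) ->
  (forall z i, U z -> \sum_l N l z * 'D_(e_ i) (f l) z = 0) ->
  (forall l z i, U z -> has_D (N l) z (e_ i) (Dn l z * 'D_(e_ i) (f l) z)) ->
  (exists l, N l p != 0) ->
  (exists l, crossv (partial 0 (rowf f) p) (partial 1 (rowf f) p) 0 l != 0) ->
  \sum_l Dn l p * (N (l + 1) p ^+ 2 + N (l + 1 + 1) p ^+ 2) = 0 ->
  mean_curvature (rowf f) p = 0.
Proof.
move=> oU Up sf tang dN [l0 N0] [l1 c0] min.
have nU z : U z -> nbhs z U by move=> Uz; exact: open_nbhs_nbhs.
have df l z : U z -> differentiable (f l) z by move: z; have [+ _] := sf l 1%N; exact.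
pose D i l z := 'D_(e_ i) (f l) z.
have sD i l n : smooth_n U n (D i l) by exact: smooth_D.
have dD i l z : U z -> differentiable (D i l) z by move: z; have [+ _] := sD i l 1%N; exact.
have P1 i z : U z -> partial i (rowf f) z = rowf (D i) z.
  by move=> Uz; rewrite /partial derive_rowf // => l; exact: df.
have P2 i j : partial i (partial j (rowf f)) p = \row_l 'D_(e_ i) (D j l) p.
  rewrite (@partial_near _ (rowf (D j))); last first.
    by have : nbhs p U by [exact: nU]; apply: filterS => z /P1.
  by rewrite /partial derive_rowf // => l; exact: dD.
(* Derivative of the tangency relation in direction [i]. *)
have key i j : \sum_l N l p * 'D_(e_ i) (D j l) p = - \sum_l Dn l p * D i l p * D j l p.
  have h0 : has_D (fun z => \sum_l N l z * D j l z) p (e_ i) 0.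
    apply: (has_D_near _ (has_D_cst 0 p (e_ i))).
    by have : nbhs p U by [exact: nU]; apply: filterS => z /tang ->.
  have hl l : has_D (fun z => N l z * D j l z) p (e_ i)
      (Dn l p * D i l p * D j l p + N l p * 'D_(e_ i) (D j l) p).
    by apply: has_DM; [exact: dN|split => //; exact: dD].
  have F (x0 y0 x1 y1 x2 y2 : R) : x0 + y0 + (x1 + y1) + (x2 + y2) = 0 ->
      y0 + y1 + y2 = - (x0 + x1 + x2) by lra.
  have [_ E0] := h0; move: E0.
  under eq_fun do rewrite sum_ord3.
  have [_ ->] := has_DD (has_DD (hl 0) (hl 1)) (hl (1 + 1)).
  rewrite !sum_ord3; exact: F.
set A := partial 0 (rowf f) p in c0; set B := partial 1 (rowf f) p in c0.
have AE l : A 0 l = D 0 l p by rewrite /A P1 // mxE.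
have BE l : B 0 l = D 1 l p by rewrite /B P1 // mxE.
have HA : partial 0 (rowf f) p = A by [].
have HB : partial 1 (rowf f) p = B by [].
clearbody A B.
pose c := crossv A B.
have cE : [/\ c 0 0 = A 0 1 * B 0 (1 + 1) - A 0 (1 + 1) * B 0 1,
   c 0 1 = A 0 (1 + 1) * B 0 0 - A 0 0 * B 0 (1 + 1) &
   c 0 (1 + 1) = A 0 0 * B 0 1 - A 0 1 * B 0 0].
  by split; rewrite /c !mxE ?add0r ?ord3_3 ?add0r.
have HC : crossv A B = c by [].
rewrite HC in c0; clearbody c.
have nA : N 0 p * A 0 0 + N 1 p * A 0 1 + N (1 + 1) p * A 0 (1 + 1) = 0.
  by rewrite !AE -[RHS](tang p 0 Up) sum_ord3.
have nB : N 0 p * B 0 0 + N 1 p * B 0 1 + N (1 + 1) p * B 0 (1 + 1) = 0.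
  by rewrite !BE -[RHS](tang p 1 Up) sum_ord3.
have [c00 c01 c02] := cE.
have cross l m : N l p * c 0 m = N m p * c 0 l.
  have [h1 h2 h3] := cross_parallel nA nB.
  by move: l m; apply: ord3_all; apply: ord3_all => //; rewrite ?c00 ?c01 ?c02.
(* Both [N] and the cross product are orthogonal to the tangent plane, hence proportional. *)
pose k := N l1 p / c 0 l1.
have Nk l : N l p = k * c 0 l by rewrite /k mulrAC -cross mulrK ?unitfE.
clearbody k.
have k0 : k != 0 by apply: contraNneq N0 => E; rewrite Nk E mul0r.
pose S i j := dotv (partial i (partial j (rowf f)) p) c.
have SE i j : k * S i j = - \sum_l Dn l p * D i l p * D j l p.
  have F (x0 x1 x2 y0 y1 y2 : R) : k * (x0 * y0 + x1 * y1 + x2 * y2) =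
    k * y0 * x0 + k * y1 * x1 + k * y2 * x2 by ring.
  have PE l : partial i (partial j (rowf f)) p 0 l = 'D_(e_ i) (D j l) p.
    by rewrite P2 mxE.
  transitivity (\sum_l N l p * 'D_(e_ i) (D j l) p); last exact: key.
  by rewrite /S dotvE sum_ord3 !Nk !PE F.
have d0 : 0 < dotv c c.
  rewrite /dotv lt_neqAle sumr_ge0 ?andbT => [|l _]; last by rewrite -expr2 sqr_ge0.
  rewrite eq_sym psumr_neq0 => [|l _]; last by rewrite -expr2 sqr_ge0.
  apply/hasP; exists l1; first by rewrite mem_index_enum.
  by rewrite -expr2 exprn_even_gt0 //= c0.
have dE : first_form (rowf f) p 0 0 * first_form (rowf f) p 1 1 -
    first_form (rowf f) p 0 1 * first_form (rowf f) p 1 0 = dotv c c.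
  have F (a0 a1 a2 b0 b1 b2 : R) : (a0 * a0 + a1 * a1 + a2 * a2) * (b0 * b0 + b1 * b1 + b2 * b2)
     - (a0 * b0 + a1 * b1 + a2 * b2) * (b0 * a0 + b1 * a1 + b2 * a2) =
     (a1 * b2 - a2 * b1) * (a1 * b2 - a2 * b1) + (a2 * b0 - a0 * b2) * (a2 * b0 - a0 * b2) +
     (a0 * b1 - a1 * b0) * (a0 * b1 - a1 * b0) by ring.
  by rewrite !mxE HA HB !dotvE c00 c01 c02; exact: F.
rewrite /mean_curvature trace_inv_mul dE ?gt_eqF //.
have sE i j : second_form (rowf f) p i j = (enorm c)^-1 * S i j.
  have F (e x0 x1 x2 y0 y1 y2 : R) : x0 * (e * y0) + x1 * (e * y1) + x2 * (e * y2) =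
    e * (x0 * y0 + x1 * y1 + x2 * y2) by ring.
  by rewrite mxE /S /unit_normal HA HB HC !dotvE -F !mxE.
suff -> : first_form (rowf f) p 1 1 * second_form (rowf f) p 0 0 -
   first_form (rowf f) p 0 1 * second_form (rowf f) p 1 0 -
   first_form (rowf f) p 1 0 * second_form (rowf f) p 0 1 +
   first_form (rowf f) p 0 0 * second_form (rowf f) p 1 1 = 0 by rewrite !mulr0.
rewrite !sE !mxE HA HB.
have -> : dotv B A = dotv A B.
  by rewrite !dotvE [B 0 0 * _]mulrC [B 0 1 * _]mulrC [B 0 (1 + 1) * _]mulrC.
(* Multiplying by [k ^ 3] costs nothing: one factor turns each [S] into the diagonal form, the other
   two turn products of components of [c] into those of [N]. *)
have F (e g q h s0 s1 s2 s3 : R) : k ^+ 2 * (g * (k * s0) - q * (k * s2)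
     - q * (k * s1) + h * (k * s3)) = 0 ->
   g * (e * s0) - q * (e * s2) - q * (e * s1) + h * (e * s3) = 0.
  have -> : k ^+ 2 * (g * (k * s0) - q * (k * s2) - q * (k * s1) + h * (k * s3)) =
    k ^+ 3 * (g * s0 - q * s2 - q * s1 + h * s3) by ring.
  move/eqP; rewrite mulf_eq0 expf_eq0 /= (negbTE k0) /= => /eqP E.
  by rewrite -[RHS](mulr0 e) -E; ring.
apply: F.
have E00 : k * S 0 0 = - (Dn 0 p * A 0 0 * A 0 0 + Dn 1 p * A 0 1 * A 0 1 +
    Dn (1 + 1) p * A 0 (1 + 1) * A 0 (1 + 1)) by rewrite !AE SE sum_ord3.
have E01 : k * S 0 1 = - (Dn 0 p * A 0 0 * B 0 0 + Dn 1 p * A 0 1 * B 0 1 +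
    Dn (1 + 1) p * A 0 (1 + 1) * B 0 (1 + 1)) by rewrite !AE !BE SE sum_ord3.
have E10 : k * S 1 0 = - (Dn 0 p * B 0 0 * A 0 0 + Dn 1 p * B 0 1 * A 0 1 +
    Dn (1 + 1) p * B 0 (1 + 1) * A 0 (1 + 1)) by rewrite !AE !BE SE sum_ord3.
have E11 : k * S 1 1 = - (Dn 0 p * B 0 0 * B 0 0 + Dn 1 p * B 0 1 * B 0 1 +
    Dn (1 + 1) p * B 0 (1 + 1) * B 0 (1 + 1)) by rewrite !BE SE sum_ord3.
clear AE BE SE key; clearbody S.
rewrite E00 E01 E10 E11 !dotvE.
move: min; rewrite sum_ord3 !add0r ord3_3 !add0r !Nk !exprMn c00 c01 c02.
move: (A 0 0) (A 0 1) (A 0 (1 + 1)) (B 0 0) (B 0 1) (B 0 (1 + 1)) => a0 a1 a2 b0 b1 b2.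
move: (Dn 0 p) (Dn 1 p) (Dn (1 + 1) p) => x0 x1 x2 min.
rewrite -[RHS]oppr0 -min.
have T := tangent_trace a0 a1 a2 b0 b1 b2 x0 x1 x2.
transitivity (- (k ^+ 2 * (x0 * ((a2 * b0 - a0 * b2) ^+ 2 + (a0 * b1 - a1 * b0) ^+ 2) +
  x1 * ((a0 * b1 - a1 * b0) ^+ 2 + (a1 * b2 - a2 * b1) ^+ 2) +
  x2 * ((a1 * b2 - a2 * b1) ^+ 2 + (a2 * b0 - a0 * b2) ^+ 2)))); last by ring.
rewrite -T; ring.
Qed.

End VectorValued.

(** * The implicit surface *)

Section ImplicitSurface.
Context {R : realType}.
Local Notation plane := 'rV[R]_2.
Local Notation e_ i := (delta_mx 0 i : plane).
Context (w : 'I_3 -> R) (r : R).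
Implicit Types (t x : R) (z p v : plane) (i j l : 'I_3).

Hypothesis w1 : forall i, -1 < w i < 1.
Hypothesis sum_tv : \sum_i tv (w i) = pi / 2.

(* [stereo ^~ z] is [stereo_norm z] times the inverse stereographic projection of
   [r *: z]. *)
Definition stereo l z : R :=
  if l == 0 then 2 * r * z 0 0 else if l == 1 then 2 * r * z 0 1
  else r ^+ 2 * (z 0 0 ^+ 2 + z 0 1 ^+ 2) - 1.

Definition stereo_norm z : R := r ^+ 2 * (z 0 0 ^+ 2 + z 0 1 ^+ 2) + 1.

Definition dstereo l z v : R :=
  if l == 0 then 2 * r * v 0 0 else if l == 1 then 2 * r * v 0 1
  else 2 * r ^+ 2 * (z 0 0 * v 0 0 + z 0 1 * v 0 1).

Definition dstereo_norm z v : R := 2 * r ^+ 2 * (z 0 0 * v 0 0 + z 0 1 * v 0 1).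

Lemma sum_stereo_sqr z : \sum_l stereo l z ^+ 2 = stereo_norm z ^+ 2.
Proof. by rewrite sum_ord3 /stereo /stereo_norm /=; ring. Qed.

Lemma sum_stereo_dstereo z v :
  \sum_l stereo l z * dstereo l z v = stereo_norm z * dstereo_norm z v.
Proof. by rewrite sum_ord3 /stereo /stereo_norm /dstereo /dstereo_norm /=; ring. Qed.

Lemma stereo_norm_gt0 z : 0 < stereo_norm z.
Proof. by rewrite /stereo_norm ltr_wpDl // mulr_ge0 ?sqr_ge0 // addr_ge0 ?sqr_ge0. Qed.

Lemma has_D_sqr_norm z v : has_D (fun z => z 0 0 ^+ 2 + z 0 1 ^+ 2) z v
  (2 * (z 0 0 * v 0 0 + z 0 1 * v 0 1)).
Proof.
have h0 := has_D_coord 0 z v; have h1 := has_D_coord 1 z v.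
by apply: (has_D_eq (has_DD (has_DM h0 h0) (has_DM h1 h1))); ring.
Qed.

Lemma has_D_stereo l z v : has_D (stereo l) z v (dstereo l z v).
Proof.
have h0 := has_D_coord 0 z v; have h1 := has_D_coord 1 z v.
have c a := has_D_cst a z v; have h2 := has_D_sqr_norm z v.
move: l; apply: ord3_all; rewrite /stereo /dstereo /=.
- by apply: (has_D_eq (has_DM (c (2 * r)) h0)); ring.
- by apply: (has_D_eq (has_DM (c (2 * r)) h1)); ring.
- by apply: (has_D_eq (has_DD (has_DM (c (r ^+ 2)) h2) (c (-1)))); ring.
Qed.

Lemma has_D_stereo_norm z v : has_D stereo_norm z v (dstereo_norm z v).
Proof.
have c a := has_D_cst a z v; have h2 := has_D_sqr_norm z v.
by apply: (has_D_eq (has_DD (has_DM (c (r ^+ 2)) h2) (c 1))); rewrite /dstereo_norm; ring.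
Qed.

Lemma continuous_stereo l : continuous (stereo l).
Proof. by move=> z; apply: differentiable_continuous; case: (has_D_stereo l z 0). Qed.

Definition kx l (x : R) : R := 6 * x * (1 - vx (w l) x ^+ 2) / (1 + ev (vx (w l) x) ^+ 2).

Lemma is_derive_tv_kx l x : is_derive x 1 (fun x => tv (vx (w l) x)) (- kx l x).
Proof. exact: is_derive_tv_vx. Qed.

Lemma continuous_kx l : continuous (kx l).
Proof.
apply: continuous_derive => x; have d := is_derive_vx (w l) x; have d1 := is_derive_ev_vx (w l) x.
have h := oneD_gt0 (ev (vx (w l) x)).
by rewrite /kx; eexists; repeat derive_step; rewrite gt_eqF.
Qed.

Lemma continuous_tv_vx l : continuous (fun x => tv (vx (w l) x)).
Proof. by apply: continuous_derive => x; eexists; exact: is_derive_tv_kx. Qed.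

Definition level t z : R := \sum_l tv (vx (w l) (t * stereo l z)) + pi / 2.
Definition dlevel t z : R := - \sum_l kx l (t * stereo l z) * stereo l z.

Lemma is_derive_level t z : is_derive t 1 (level ^~ z) (dlevel t z).
Proof.
have h l : is_derive t 1 (fun t => tv (vx (w l) (t * stereo l z)))
    (- kx l (t * stereo l z) * stereo l z).
  have d : is_derive t 1 (fun t => t * stereo l z) (stereo l z) by derive_tac; ring.
  exact: (@is_derive_compf _ (fun t => t * stereo l z) _ _ _ _ (is_derive_tv_kx l _) d).
rewrite /level /dlevel; under eq_fun do rewrite sum_ord3.
rewrite sum_ord3.
notypeclasses refine (is_derive_eqf (is_deriveDf (is_deriveDf (is_deriveDf (h 0) (h 1))
  (h (1 + 1))) (is_derive_cstf t (pi / 2))) _).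
have F (k0 k1 k2 a b c : R) : - k0 * a + - k1 * b + - k2 * c + 0 = - (k0 * a + k1 * b + k2 * c).
  by ring.
exact: F.
Qed.

Lemma cvg_scaled_stereo l t z :
  (fun p : R * plane => p.1 * stereo l p.2) @ (t, z) --> t * stereo l z.
Proof.
apply: cvgM; first exact: cvg_fst.
apply: (cvg_comp (fun p : R * plane => p.2) (stereo l)); first exact: cvg_snd.
exact: continuous_stereo.
Qed.

Lemma cvg_sum3 (T : topologicalType) (F : set_system T) (h : 'I_3 -> T -> R) (a : 'I_3 -> R) :
  Filter F -> (forall l, h l @ F --> a l) -> (fun q : T => \sum_l h l q) @ F --> \sum_l a l.
Proof.
move=> FF H; under eq_fun do rewrite sum_ord3.
by rewrite sum_ord3; apply: cvgD; [apply: cvgD|].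
Qed.

Lemma cvg_level t z : (fun p : R * plane => level p.1 p.2) @ (t, z) --> level t z.
Proof.
apply: cvgD; last exact: cvg_cst.
apply: (@cvg_sum3 _ _ (fun l (p : R * plane) => tv (vx (w l) (p.1 * stereo l p.2)))) => l.
by apply: (cvg_comp _ (fun x => tv (vx (w l) x)) (@cvg_scaled_stereo l t z)); exact: continuous_tv_vx.
Qed.

Lemma cvg_dlevel t z : (fun p : R * plane => dlevel p.1 p.2) @ (t, z) --> dlevel t z.
Proof.
apply: cvgN.
apply: (@cvg_sum3 _ _ (fun l (p : R * plane) => kx l (p.1 * stereo l p.2) * stereo l p.2)) => l.
apply: cvgM.
  by apply: (cvg_comp _ (kx l) (@cvg_scaled_stereo l t z)); exact: continuous_kx.
apply: (cvg_comp (fun p : R * plane => p.2) (stereo l)); first exact: cvg_snd.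
exact: continuous_stereo.
Qed.

Lemma has_D_level (f : plane -> R) z v (Df : R) : has_D f z v Df ->
  has_D (fun z => level (f z) z) z v
    (- \sum_l kx l (f z * stereo l z) * (Df * stereo l z + f z * dstereo l z v)).
Proof.
move=> hf.
have h l : has_D (fun z => tv (vx (w l) (f z * stereo l z))) z v
    (- kx l (f z * stereo l z) * (Df * stereo l z + f z * dstereo l z v)).
  apply: (@has_D_comp _ (fun x => tv (vx (w l) x)) (fun z => f z * stereo l z)).
    exact: is_derive_tv_kx.
  by apply: has_DM => //; exact: has_D_stereo.
rewrite /level; under eq_fun do rewrite sum_ord3.
apply: (has_D_eq (has_DD (has_DD (has_DD (h 0) (h 1)) (h (1 + 1))) (has_D_cst (pi / 2) z v))).
rewrite sum_ord3.
have F (k0 k1 k2 a b c : R) : - k0 * a + - k1 * b + - k2 * c + 0 = - (k0 * a + k1 * b + k2 * c).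
  by ring.
exact: F.
Qed.

Lemma differentiable_level t z : differentiable (level t) z.
Proof. by case: (has_D_level (has_D_cst t z 0)). Qed.

End ImplicitSurface.

(** * The first zero of the level function along a ray *)

Section Inside.
Context {R : realType}.
Local Notation plane := 'rV[R]_2.
Context (w : 'I_3 -> R) (r : R).
Implicit Types (t x : R) (z p v : plane) (i j l : 'I_3).

Hypothesis w1 : forall i, -1 < w i < 1.
Hypothesis sum_tv : \sum_i tv (w i) = pi / 2.

Lemma sum_cyclic (F : 'I_3 -> R) i : \sum_l F l = F i + (F (i + 1) + F (i + 1 + 1)).
Proof.
rewrite sum_ord3; move: i; apply: ord3_all; rewrite ?add0r ?ord3_3 ?add0r; ring.
Qed.

Lemma ord3_neq i l : l != i -> l = i + 1 \/ l = i + 1 + 1.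
Proof.
move: i l; apply: ord3_all; apply: ord3_all => //; rewrite ?add0r ?ord3_3 ?add0r;
  by [left|right].
Qed.

Lemma tvN x : tv (- x) = - tv x.
Proof. by rewrite /tv evN atanN mulrN. Qed.

Lemma tv_lt x y : -1 <= x -> x < y -> y <= 1 -> tv x < tv y.
Proof. by move=> x1 xy y1; rewrite /tv ltr_pM2l // lt_atan // ev_lt. Qed.

Lemma tv_le x y : -1 <= x -> x <= y -> y <= 1 -> tv x <= tv y.
Proof. by move=> x1; rewrite le_eqVlt => /predU1P[->//|xy y1]; exact/ltW/tv_lt. Qed.

Lemma tv1 : tv 1 = pi / 2 :> R.
Proof. by rewrite /tv ev1 atan1; move: (pi : R) => P; field. Qed.

Lemma tvD_le0 x y : -1 <= x <= 1 -> -1 <= y <= 1 -> x + y <= 0 -> tv x + tv y <= 0.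
Proof.
move=> /andP[x0 x1] /andP[y0 y1] xy.
have : tv x <= tv (- y) by apply: tv_le; lra.
by rewrite tvN; move: (tv x) (tv y) => a b; lra.
Qed.

(** [tv (w i) < pi / 2] leaves a positive sum for the other two values of [tv], which is odd and
    increasing. *)
Lemma w_pair_gt0 i : 0 < w (i + 1) + w (i + 1 + 1).
Proof.
rewrite ltNge; apply/negP => h.
have W l : -1 <= w l <= 1 by have /andP[a b] := w1 l; rewrite !ltW.
have := tvD_le0 (W _) (W _) h; have := sum_tv; rewrite (sum_cyclic _ i).
have : tv (w i) < pi / 2 by rewrite -tv1; have /andP[a b] := w1 i; apply: tv_lt => //; exact: ltW.
by move: (tv _) (tv _) (tv _) (pi : R) => a b c P; lra.
Qed.

(** The squared radius of the sphere in the psi-space that carries all six boundary curves. *)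
Definition wtotal : R := 1 + \sum_l w l.
Definition cap l : R := (1 + w l) / wtotal.

Lemma totalE i : wtotal = 1 + w i + (w (i + 1) + w (i + 1 + 1)).
Proof. by rewrite /wtotal (sum_cyclic _ i) addrA. Qed.

Lemma total_gt0 : 0 < wtotal.
Proof. by rewrite (totalE 0); have := w_pair_gt0 0; have /andP[] := w1 0; lra. Qed.

Lemma cap_gt0 l : 0 < cap l.
Proof. by rewrite divr_gt0 ?total_gt0 //; have /andP[] := w1 l; lra. Qed.

Lemma cap_lt1 l : cap l < 1.
Proof. by rewrite ltr_pdivrMr ?total_gt0 // mul1r (totalE l) ltrDl w_pair_gt0. Qed.

(** Caps of the unit sphere around two different axes are disjoint exactly when their squared
    heights add up to more than 1. *)
Lemma capD_gt1 l : 1 < cap (l + 1) + cap (l + 1 + 1).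
Proof.
rewrite -mulrDl ltr_pdivlMr ?total_gt0 // mul1r (totalE l).
by have /andP[] := w1 l; lra.
Qed.

Lemma cap_total l : cap l * wtotal = 1 + w l.
Proof. by rewrite /cap mulfVK // gt_eqF // total_gt0. Qed.

(* The sphere minus the six caps cut off by the planes [x_l = +- sqrt (cap l)]; on the
   rim of such a cap the coordinate [l] of the surface is on a face of the prism. *)
Definition inside z := forall l, stereo r l z ^+ 2 <= cap l * stereo_norm r z ^+ 2.

Lemma kx_mul_ge0 t l z : 0 <= t -> (t * stereo r l z) ^+ 2 <= 1 + w l ->
  0 <= kx w l (t * stereo r l z) * stereo r l z.
Proof.
move=> t0 hl; have /andP[w2 w3] := w1 l; have h := oneD_gt0 (ev (vx (w l) (t * stereo r l z))).
have -> : kx w l (t * stereo r l z) * stereo r l z =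
   (6 * t * stereo r l z ^+ 2) * (1 - vx (w l) (t * stereo r l z) ^+ 2) /
   (1 + ev (vx (w l) (t * stereo r l z)) ^+ 2).
  by rewrite /kx; field; rewrite gt_eqF.
apply: divr_ge0; last exact: ltW.
apply: mulr_ge0; first by apply: mulr_ge0; [rewrite mulr_ge0|exact: sqr_ge0].
move: hl; rewrite /vx; have := sqr_ge0 (t * stereo r l z).
by move: (_ ^+ 2) => y y0 y1; nra.
Qed.

Lemma kx_mul_gt0 t l z : 0 < t -> (t * stereo r l z) ^+ 2 < 1 + w l -> stereo r l z != 0 ->
  0 < kx w l (t * stereo r l z) * stereo r l z.
Proof.
move=> t0 hl s0; have /andP[w2 w3] := w1 l; have h := oneD_gt0 (ev (vx (w l) (t * stereo r l z))).
have -> : kx w l (t * stereo r l z) * stereo r l z =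
   (6 * t * stereo r l z ^+ 2) * (1 - vx (w l) (t * stereo r l z) ^+ 2) /
   (1 + ev (vx (w l) (t * stereo r l z)) ^+ 2).
  by rewrite /kx; field; rewrite gt_eqF.
apply: divr_gt0 => //.
have s2 : 0 < stereo r l z ^+ 2 by rewrite exprn_even_gt0 //= s0.
apply: mulr_gt0; first by apply: mulr_gt0 => //; rewrite mulr_gt0.
move: hl; rewrite /vx; have := sqr_ge0 (t * stereo r l z).
by move: (_ ^+ 2) => y y0 y1; nra.
Qed.

Lemma dlevel_lt0 t z l : 0 < t -> (forall l, (t * stereo r l z) ^+ 2 <= 1 + w l) ->
  (t * stereo r l z) ^+ 2 < 1 + w l -> stereo r l z != 0 -> dlevel w r t z < 0.
Proof.
move=> t0 hle hl s0; rewrite /dlevel oppr_lt0 (bigD1 l) //=.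
apply: ltr_pwDl; first exact: kx_mul_gt0.
by apply: sumr_ge0 => m _; apply: kx_mul_ge0 => //; exact: ltW.
Qed.

Lemma stereo_neq0 z : exists l, stereo r l z != 0.
Proof.
apply/existsP; rewrite -negb_forall; apply/negP => /forallP H.
have := sum_stereo_sqr r z; rewrite big1 => [/esym/eqP|l _].
  by rewrite sqrf_eq0 gt_eqF // stereo_norm_gt0.
by have /eqP -> := H l; rewrite expr0n.
Qed.

Lemma stereo_neq0' z i : inside z -> exists2 l, l != i & stereo r l z != 0.
Proof.
move=> hz; have N0 := stereo_norm_gt0 r z.
have : stereo r i z ^+ 2 < stereo_norm r z ^+ 2.
  by apply: (le_lt_trans (hz i)); rewrite gtr_pMl ?exprn_gt0 // cap_lt1.
rewrite -sum_stereo_sqr (bigD1 i) //= ltrDl => H.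
apply/exists_inP; rewrite -[X in is_true X]negbK negb_exists_in; apply/negP => /forall_inP h.
by move: H; rewrite big1 ?ltxx // => l li; move: (h l li); rewrite negbK => /eqP ->; rewrite expr0n.
Qed.

Lemma level0 z : level w r 0 z = pi.
Proof.
rewrite /level; under eq_bigr do rewrite mul0r /vx expr0n subr0.
by rewrite sum_tv; move: (pi : R) => P; field.
Qed.

Lemma level_MVT z t s : t < s -> exists2 c, t < c < s &
  level w r s z - level w r t z = dlevel w r c z * (s - t).
Proof. exact: (G_MVT (is_derive_level w r)). Qed.

Lemma first_zero_inside z : inside z -> exists t,
  first_zero (level w r) (dlevel w r) z t /\ forall l, (t * stereo r l z) ^+ 2 <= 1 + w l.
Proof.
move=> hz; have N0 := stereo_norm_gt0 r z.
have W l : 0 < 1 + w l by have /andP[] := w1 l; lra.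
pose q l := stereo r l z ^+ 2 / (1 + w l).
have [i Hi] : exists i, forall l, q l <= q i.
  by exists [arg max_(l > 0) q l]%O; case: arg_maxP => //= i _ H l; exact: H.
have qi0 : 0 < q i.
  have [l l0] := stereo_neq0 z; apply: lt_le_trans (Hi l).
  by rewrite divr_gt0 // exprn_even_gt0 //= l0.
(* The time at which the ray leaves the box [psi_l ^ 2 <= 1 + w l], through a side of axis [i]. Up
   to then the level function is strictly decreasing. *)
pose T := Num.sqrt (q i)^-1.
have T0 : 0 < T by rewrite sqrtr_gt0 invr_gt0.
have T2 : T ^+ 2 = (q i)^-1 by rewrite sqr_sqrtr // invr_ge0 ltW.
have Tle l : (T * stereo r l z) ^+ 2 <= 1 + w l.
  rewrite exprMn T2 mulrC ler_pdivrMr // mulrC -ler_pdivrMr //; exact: Hi.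
have si0 : stereo r i z != 0.
  by apply/eqP => E; move: qi0; rewrite /q E expr0n mul0r ltxx.
have Ti : (T * stereo r i z) ^+ 2 = 1 + w i.
  by rewrite exprMn T2 /q invf_div mulfVK // sqrf_eq0.
have Tw t l : 0 <= t <= T -> (t * stereo r l z) ^+ 2 <= 1 + w l.
  move=> /andP[t0 tT]; apply: le_trans (Tle l); rewrite !exprMn ler_wpM2r ?sqr_ge0 //.
  by rewrite ler_sqr ?nnegrE // ltW.
have Tw' t l : 0 <= t < T -> stereo r l z != 0 -> (t * stereo r l z) ^+ 2 < 1 + w l.
  move=> /andP[t0 tT] s0; apply: lt_le_trans (Tle l); rewrite !exprMn ltr_pM2r.
    by rewrite ltr_sqr ?nnegrE // ltW.
  by rewrite exprn_even_gt0 //= s0.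
have V l : -1 <= vx (w l) (T * stereo r l z) <= 1.
  have := Tle l; have := sqr_ge0 (T * stereo r l z); have /andP[] := w1 l.
  by rewrite /vx; move: (_ ^+ 2) => y; lra.
have VI : vx (w i) (T * stereo r i z) = -1 by rewrite /vx Ti; lra.
(* A ray outside the caps leaves the box on or outside the sphere of squared radius [wtotal], so the
   two other values of [vx] have sum at most 0, and with them the values of [tv]. *)
have GT : level w r T z <= 0.
  rewrite /level (sum_cyclic _ i) VI tvN tv1.
  suff : tv (vx (w (i + 1)) (T * stereo r (i + 1) z)) +
      tv (vx (w (i + 1 + 1)) (T * stereo r (i + 1 + 1) z)) <= 0.
    by move: (tv _) (tv _) (pi : R) => a b P; lra.
  apply: tvD_le0 => //; rewrite /vx !exprMn.
  have E := sum_stereo_sqr r z; rewrite (sum_cyclic _ i) in E.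
  have : wtotal <= T ^+ 2 * stereo_norm r z ^+ 2.
    have h := hz i; rewrite -(ler_pM2l (cap_gt0 i)) cap_total -Ti exprMn.
    by rewrite [leRHS]mulrCA ler_pM2l // exprn_gt0.
  rewrite (totalE i) -Ti exprMn -E !mulrDr.
  move: (T ^+ 2 * _) (T ^+ 2 * _) (T ^+ 2 * _) => a b c; lra.
have cl : {within `[0, T], continuous (level w r ^~ z)}.
  exact: (derivable_within_continuous (fun x _ => ex_derive (is_derive := is_derive_level w r x z))).
have [|t] := IVT (ltW T0) cl (v := 0).
  by rewrite /= level0 min_r ?max_l ?GT ?pi_ge0 // (le_trans GT) ?pi_ge0.
rewrite in_itv /= => /andP[t0 tT] Gt; exists t; split; last by move=> l; apply: Tw; rewrite t0.
have t0' : 0 < t.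
  rewrite lt_neqAle t0 andbT; apply/eqP => E; move: Gt; rewrite -E level0 => /eqP.
  by rewrite gt_eqF // pi_gt0.
have Glt s : 0 < s < T -> dlevel w r s z < 0.
  move=> /andP[s0 sT]; apply: (@dlevel_lt0 _ _ i) => //.
    by move=> l; apply: Tw; rewrite !ltW.
  by apply: Tw' => //; rewrite ltW.
split=> //.
  move: tT; rewrite le_eqVlt => /predU1P[tT|tT]; last by apply: Glt; rewrite t0'.
  (* If the zero is the exit time, the term of axis [i] in the derivative vanishes. Another nonzero
     coordinate [l] provides a negative one: it is strictly inside the box, since two coordinates on
     sides would make the level negative. *)
  have [l li l0] := stereo_neq0' i hz.
  apply: (@dlevel_lt0 _ _ l) => //; first by rewrite tT.
  rewrite tT lt_neqAle Tle andbT; apply/eqP => El.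
  have VL : vx (w l) (T * stereo r l z) = -1 by rewrite /vx El; ring.
  have Vlt m : tv (vx (w m) (T * stereo r m z)) < pi / 2.
    rewrite -tv1; have /andP[v1 v2] := V m; apply: tv_lt => //.
    by rewrite /vx; have := sqr_ge0 (T * stereo r m z); have /andP[] := w1 m; lra.
  move: Gt (Vlt (i + 1)) (Vlt (i + 1 + 1)); rewrite tT /level (sum_cyclic _ i) VI tvN tv1.
  have [E|E] := ord3_neq li; rewrite -E VL tvN tv1.
    by move: (tv _) (pi : R) => a P; lra.
  by move: (tv _) (pi : R) => a P; lra.
move=> s /andP[s0 st]; have [c /andP[c1 c2]] := level_MVT z st; rewrite Gt sub0r => E.
have : dlevel w r c z < 0.
  by apply: Glt; apply/andP; split; [exact: le_lt_trans c1|exact: lt_le_trans tT].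
by rewrite -oppr_lt0 E => h; rewrite nmulr_rlt0 // subr_gt0.
Qed.

End Inside.

(** * The parametrization and its smoothness *)

Section Immersion.
Context {R : realType}.
Local Notation plane := 'rV[R]_2.
Local Notation e_ i := (delta_mx 0 i : plane).
Context (w b a : 'I_3 -> R) (xi : 'I_3 -> R -> R) (r lam : R).
Implicit Types (t x : R) (z p v : plane) (i j l : 'I_3).

Hypothesis w1 : forall i, -1 < w i < 1.
Hypothesis sum_tv : \sum_i tv (w i) = pi / 2.
Hypothesis b0 : forall l, 0 < b l.
Hypothesis wb : forall l, 1 + w l < b l ^+ 2.
Hypothesis Apos : forall l x, - b l < x < b l -> 0 < Ap (w l) x.
Hypothesis dxiP : forall l x, - b l < x < b l -> is_derive x 1 (xi l) (dxi (w l) x).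
Hypothesis r0 : 0 < r.
Hypothesis lam0 : 0 < lam.

Definition rho z : R := zero_of (level w r) (dlevel w r) z.
Definition psi l z : R := rho z * stereo r l z.
Definition Xcoord l z : R := a l / 2 + lam * xi l (psi l z).

(** An open neighbourhood of the domain where the implicit function theorem and all three profiles
    apply; [psi] may exceed the face values slightly. *)
Definition regular : set plane := [set z | first_zero (level w r) (dlevel w r) z (rho z) /\
  forall l, - b l < psi l z < b l].

Let dG := @is_derive_level R w r.
Let cG := @cvg_level R w r.
Let cGd := @cvg_dlevel R w r.
Let diffG := @differentiable_level R w r.

Lemma continuous_rho z t : first_zero (level w r) (dlevel w r) z t -> {for z, continuous rho}.
Proof. exact: (zero_of_continuous dG cG cGd diffG). Qed.

Lemma open_regular : open regular.
Proof.
rewrite openE => z [fz hb]; rewrite /interior.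
have cr := continuous_rho fz.
have cp l : {for z, continuous (psi l)}.
  exact: (@cvgM _ _ _ _ rho (stereo r l) _ _ cr (@continuous_stereo R r l z)).
have H l : \forall y \near z, - b l < psi l y < b l.
  have /andP[h1 h2] := hb l.
  near=> y; apply/andP; split; near: y.
    exact: (cvgr_gt _ (cp l) _ h1).
  exact: (cvgr_lt _ (cp l) _ h2).
near=> y; split; first by near: y; exact: (zero_of_near dG cG cGd diffG fz).
apply: ord3_all; near: y; exact: H.
Unshelve. all: by end_near. Qed.

Lemma inside_regular z : inside w r z ->
  regular z /\ forall l, psi l z ^+ 2 <= 1 + w l.
Proof.
move=> /(first_zero_inside w1 sum_tv)[t [fz ht]].
have [fz' E] := zero_ofP fz.
have hp l : psi l z ^+ 2 <= 1 + w l by rewrite /psi /rho E.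
split => //; split => // l; have := le_lt_trans (hp l) (wb l); have := b0 l.
by move: (b l) (psi l z) => B x B0 h; apply/andP; split; nra.
Qed.

Definition drho z v : R :=
  - (rho z * \sum_l kx w l (psi l z) * dstereo r l z v) *
  (\sum_l kx w l (psi l z) * stereo r l z)^-1.

Definition dpsi l z v : R := drho z v * stereo r l z + rho z * dstereo r l z v.

Lemma sum_kx_stereo_gt0 z : regular z -> 0 < \sum_l kx w l (psi l z) * stereo r l z.
Proof. by move=> [[_ _ h _] _]; rewrite -oppr_lt0. Qed.

Lemma has_D_rho z v : regular z -> has_D rho z v (drho z v).
Proof.
move=> hz; have [fz _] := hz.
have dr : differentiable rho z by exact: (zero_of_differentiable dG cG cGd diffG fz).
have := has_D_level w r (conj dr erefl : has_D rho z v ('D_v rho z)).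
have : has_D (fun y => level w r (rho y) y) z v 0.
  apply: has_D_near (has_D_cst 0 z v).
  have := zero_of_near dG cG cGd diffG fz; apply: filterS => y [_ + _ _].
  by rewrite -/(rho y) => ->.
move=> [_ E0] [_ E1]; split => //; move: (etrans (esym E0) E1) => {E0 E1} /esym/eqP.
rewrite oppr_eq0 => /eqP.
have := sum_kx_stereo_gt0 hz; rewrite /drho /psi !sum_ord3.
move: (kx _ _ _) (kx _ _ _) (kx _ _ _) => k0 k1 k2.
move: (stereo _ _ _) (stereo _ _ _) (stereo _ _ _) => s0 s1 s2.
move: (dstereo _ _ _ _) (dstereo _ _ _ _) (dstereo _ _ _ _) => d0 d1 d2.
move: (rho z) ('D_v rho z) => q D pos E.
apply: (mulIf (lt0r_neq0 pos)); rewrite mulfVK ?lt0r_neq0 //.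
by apply/eqP; rewrite -subr_eq0 -[X in _ == X]E; apply/eqP; ring.
Qed.

Lemma has_D_psi l z v : regular z -> has_D (psi l) z v (dpsi l z v).
Proof. by move=> hz; apply: has_DM; [exact: has_D_rho|exact: has_D_stereo]. Qed.

Lemma sum_kx_dpsi z v : regular z -> \sum_l kx w l (psi l z) * dpsi l z v = 0.
Proof.
move=> hz; have := sum_kx_stereo_gt0 hz; rewrite /dpsi /drho !sum_ord3.
move: (kx _ _ _) (kx _ _ _) (kx _ _ _) => k0 k1 k2.
move: (stereo _ _ _) (stereo _ _ _) (stereo _ _ _) => s0 s1 s2.
move: (dstereo _ _ _ _) (dstereo _ _ _ _) (dstereo _ _ _ _) => d0 d1 d2 pos.
by field; rewrite gt_eqF.
Qed.

Lemma has_D_Xcoord l z v : regular z ->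
  has_D (Xcoord l) z v (lam * dxi (w l) (psi l z) * dpsi l z v).
Proof.
move=> hz; have h : has_D (fun y => xi l (psi l y)) z v (dxi (w l) (psi l z) * dpsi l z v).
  by apply: has_D_comp; [apply: dxiP; case: hz|exact: has_D_psi].
apply: (has_D_eq (has_DD (has_D_cst (a l / 2) z v) (has_DM (has_D_cst lam z v) h))).
ring.
Qed.

Lemma smooth_sum n (h : 'I_3 -> plane -> R) : (forall l, smooth_n regular n (h l)) ->
  smooth_n regular n (fun z => \sum_l h l z).
Proof.
move=> sh; apply: (smooth_n_ext open_regular (f := fun z => h 0 z + h 1 z + h (1 + 1) z)).
  by move=> z _; rewrite sum_ord3.
by do 2?apply: smooth_nD.
Qed.

Let sC n c : smooth_n regular n (fun _ => c). Proof. exact: smooth_n_cst. Qed.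
Let sX n (i : 'I_2) : smooth_n regular n (fun z => z 0 i). Proof. exact: smooth_n_coord. Qed.

Let oR : open regular. Proof. exact: open_regular. Qed.

Lemma smooth_sqr_norm n : smooth_n regular n (fun z => z 0 0 ^+ 2 + z 0 1 ^+ 2).
Proof. by apply: smooth_nD; apply: smooth_nX; (exact: open_regular || exact: sX). Qed.

Lemma smooth_stereo n l : smooth_n regular n (stereo r l).
Proof.
move: l; apply: ord3_all; rewrite /stereo /=.
- by apply: smooth_nM; [exact: sC|exact: sX].
- by apply: smooth_nM; [exact: sC|exact: sX].
- apply: smooth_nD; last exact: sC.
  by apply: smooth_nM; [exact: sC|exact: smooth_sqr_norm].
Qed.

Lemma smooth_dstereo n l v : smooth_n regular n (fun z => dstereo r l z v).
Proof.
move: l; apply: ord3_all; rewrite /dstereo /=; [exact: sC|exact: sC|].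
apply: smooth_nM; first exact: sC.
by apply: smooth_nD; apply: smooth_nM; (exact: sX || exact: sC).
Qed.

Lemma smooth_vx n l (h : plane -> R) : smooth_n regular n h ->
  smooth_n regular n (fun z => vx (w l) (h z)).
Proof. by move=> sh; exact: (smooth_nD (sC n (w l)) (smooth_nN oR (smooth_nX oR 2 sh))). Qed.

Lemma smooth_ev n (h : plane -> R) : smooth_n regular n h ->
  smooth_n regular n (fun z => ev (h z)).
Proof.
move=> sh; exact: (smooth_nM (smooth_nD (smooth_nM (sC n 3) sh)
  (smooth_nN oR (smooth_nX oR 3 sh))) (sC n 2^-1)).
Qed.

Lemma smooth_kx n l (h : plane -> R) : smooth_n regular n h ->
  smooth_n regular n (fun z => kx w l (h z)).
Proof.
move=> sh; have sv := smooth_vx l sh; rewrite /kx.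
apply: (smooth_nM (smooth_nM (smooth_nM (sC n 6) sh)
  (smooth_nD (sC n 1) (smooth_nN oR (smooth_nX oR 2 sv))))).
apply: smooth_nV => [//|z _|]; first by rewrite gt_eqF // oneD_gt0.
exact: (smooth_nD (sC n 1) (smooth_nX oR 2 (smooth_ev sv))).
Qed.

(** Bootstrapping: implicit differentiation expresses the partial derivatives of [rho] through [rho]
    itself, so order [n] gives order [n.+1]. *)
Lemma smooth_rho n : smooth_n regular n rho.
Proof.
elim: n => // n IH.
apply: (@smooth_n_intro R regular n rho (fun (i : 'I_2) z => drho z (e_ i))) => [z i hz|i].
  exact: has_D_rho.
have sp l : smooth_n regular n (psi l) by apply: smooth_nM => //; exact: smooth_stereo.
have sk l := smooth_kx l (sp l).
rewrite /drho; apply: smooth_nM.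
  apply: smooth_nN => //; apply: smooth_nM => //; apply: smooth_sum => l.
  by apply: smooth_nM => //; exact: smooth_dstereo.
apply: smooth_nV => // [z hz|]; first by rewrite gt_eqF // sum_kx_stereo_gt0.
by apply: smooth_sum => l; apply: smooth_nM => //; exact: smooth_stereo.
Qed.

Lemma smooth_psi n l : smooth_n regular n (psi l).
Proof. by apply: smooth_nM; [exact: smooth_rho|exact: smooth_stereo]. Qed.

Lemma smooth_Xcoord n l : smooth_n regular n (Xcoord l).
Proof.
case: n => // n.
apply: smooth_nD; first exact: sC.
apply: smooth_nM; first exact: sC.
apply: (@smooth_n_comp _ _ n (xi l) (dxi (w l)) (psi l)); last 2 first.
- exact: smooth_psi.
- have sp := smooth_psi n l; have sv := smooth_vx l sp; have se := smooth_ev sv.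
  rewrite /dxi; apply: smooth_nM => //.
  have /andP[g1 g2] := ev_bound (w1 l).
  have AU z : regular z -> 0 < Ap (w l) (psi l z) by move=> [_ /(_ l)]; exact: Apos.
  apply: smooth_n_sqrt => // [z hz|]; first by rewrite divr_gt0 ?AU //; nra.
  apply: smooth_nM => //; apply: smooth_nV => // [z hz|]; first by rewrite gt_eqF // AU.
  rewrite /Ap; apply: smooth_nM; last by apply: smooth_nD => //; exact: smooth_nM.
  apply: smooth_nM; first by apply: smooth_nD => //; apply: smooth_nN => //; exact: smooth_nX.
  apply: smooth_nD; last by apply: smooth_nN => //; exact: smooth_nX.
  by apply: smooth_nD => //; apply: smooth_nN => //; exact: smooth_nM.
by move=> z [_ /(_ l)]; exact: dxiP.
Qed.

End Immersion.

(** * Trigonometric form of the normal *)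

Section ProfileNormal.
Context {R : realType}.
Implicit Types (w x : R).

Lemma Nx_dxi w x : 0 < Ap w x -> 0 < 1 - ev w ^+ 2 ->
  Nx w x * dxi w x = 6 * x * (1 - vx w x ^+ 2) / (1 + ev (vx w x) ^+ 2).
Proof.
move=> A0 g0; rewrite /Nx /dxi (sqrtrM _ (ltW g0)) sqrtrV; last exact: ltW.
have sA0 : 0 < Num.sqrt (Ap w x) by rewrite sqrtr_gt0.
have sg0 : 0 < Num.sqrt (1 - ev w ^+ 2) by rewrite sqrtr_gt0.
have h1 := oneD_gt0 (ev (vx w x)); move: sA0 sg0 h1.
set p := Num.sqrt (Ap w x); set q := Num.sqrt (1 - ev w ^+ 2).
set s := 1 + ev (vx w x) ^+ 2; set u := 1 - vx w x ^+ 2; clearbody p q s u => p0 q0 s0.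
by field; rewrite !gt_eqF.
Qed.

Lemma Nx_sqr w x : 0 < Ap w x -> 0 < 1 - ev w ^+ 2 ->
  Nx w x ^+ 2 = cos (tv (vx w x) + gam w) * cos (tv (vx w x)) / sin (gam w).
Proof.
move=> A0 g0; rewrite cos_t_mul sin_gam /Nx.
have EA := sqr_sqrtr (ltW A0); have Eg := sqr_sqrtr (ltW g0).
have sg0 : 0 < Num.sqrt (1 - ev w ^+ 2) by rewrite sqrtr_gt0.
have h1 := oneD_gt0 (ev (vx w x)); have g1 := oneD_gt0 (ev w).
move: EA Eg sg0 h1 g1.
set p := Num.sqrt (Ap w x); set q := Num.sqrt (1 - ev w ^+ 2).
set s := 1 + ev (vx w x) ^+ 2; set u := 1 - vx w x ^+ 2; set G := 1 + ev w ^+ 2.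
move=> <- <-; clearbody p q s u G => q0 s0 G0.
by field; rewrite !gt_eqF.
Qed.

Lemma sin_piB x : sin (pi - x) = sin x.
Proof. by rewrite sinB sinpi cospi mul0r mulN1r sub0r opprK. Qed.

(* After clearing the denominators the sum is
   [\sum_l sin (g l) * (sin (th (l + 1) + th (l + 2)) + sin (th l))]. *)
Lemma sum_sin_eq0 (th g n : 'I_3 -> R) (c : R) :
  \sum_l th l = 0 -> \sum_l g l = pi -> (forall l, 0 < sin (g l)) ->
  (forall l, n l = (cos (th l) + cos (g l)) / (2 * sin (g l))) ->
  \sum_l c * sin (th l) / sin (g l) * (n (l + 1) + n (l + 1 + 1)) = 0.
Proof.
rewrite !sum_ord3 !add0r ord3_3 add0r => th0 gpi g0 nE; rewrite !nE.
have s (i j k : R) : i + j + k = pi -> sin i = sin j * cos k + cos j * sin k.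
  by move=> E; rewrite -sinD -sin_piB -E; congr sin; ring.
have t (i j k : R) : i + j + k = 0 -> sin i = - (sin j * cos k + cos j * sin k).
  by move=> E; rewrite -sinD -sinN -[LHS]/(sin i); congr sin; rewrite -[RHS]addr0 -E; ring.
have cyc (x y z c0 : R) : x + y + z = c0 -> y + z + x = c0 by move=> <-; ring.
have := s _ _ _ gpi; have := s _ _ _ (cyc _ _ _ _ gpi).
have := s _ _ _ (cyc _ _ _ _ (cyc _ _ _ _ gpi)).
have := t _ _ _ th0; have := t _ _ _ (cyc _ _ _ _ th0).
have := t _ _ _ (cyc _ _ _ _ (cyc _ _ _ _ th0)).
have := g0 0; have := g0 1; have := g0 (1 + 1).
move: (sin (g 0)) (sin (g 1)) (sin (g (1 + 1))) (cos (g 0)) (cos (g 1)) (cos (g (1 + 1))).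
move: (sin (th 0)) (sin (th 1)) (sin (th (1 + 1))) (cos (th 0)) (cos (th 1)) (cos (th (1 + 1))).
move=> S0 S1 S2 C0 C1 C2 s0 s1 s2 c0 c1 c2 p2 p1 p0 T2 T1 T0 G2 G1 G0.
transitivity (c / (2 * s0 * s1 * s2) * (
  S0 * (C1 * s2 + C2 * s1) + S1 * (C2 * s0 + C0 * s2) + S2 * (C0 * s1 + C1 * s0) +
  S0 * (s1 * c2 + c1 * s2) + S1 * (s2 * c0 + c2 * s0) + S2 * (s0 * c1 + c0 * s1))).
  by field; rewrite !gt_eqF.
rewrite -G0 -G1 -G2.
transitivity (c / (2 * s0 * s1 * s2) * (s0 * (S0 + (S1 * C2 + C1 * S2)) +
  s1 * (S1 + (S2 * C0 + C2 * S0)) + s2 * (S2 + (S0 * C1 + C0 * S1)))); first by ring.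
by rewrite -[X in S0 + X]opprK -[X in S1 + X]opprK -[X in S2 + X]opprK -T0 -T1 -T2
  !subrr !mulr0 !addr0 mulr0.
Qed.

End ProfileNormal.

(** * Minimality *)

Section MinimalImmersion.
Context {R : realType}.
Local Notation plane := 'rV[R]_2.
Local Notation e_ i := (delta_mx 0 i : plane).
Context (w b a : 'I_3 -> R) (xi : 'I_3 -> R -> R) (r lam : R).
Implicit Types (t x : R) (z p v : plane) (i j l : 'I_3).

Hypothesis w1 : forall i, -1 < w i < 1.
Hypothesis sum_tv : \sum_i tv (w i) = pi / 2.
Hypothesis b0 : forall l, 0 < b l.
Hypothesis wb : forall l, 1 + w l < b l ^+ 2.
Hypothesis Apos : forall l x, - b l < x < b l -> 0 < Ap (w l) x.
Hypothesis dxiP : forall l x, - b l < x < b l -> is_derive x 1 (xi l) (dxi (w l) x).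
Hypothesis r0 : 0 < r.
Hypothesis lam0 : 0 < lam.

Local Notation regular := (regular w b r).
Local Notation psi := (psi w r).
Local Notation dpsi := (dpsi w r).
Local Notation Xcoord := (Xcoord w a xi r lam).
Local Notation X := (rowf Xcoord).

Definition Ncoord l z : R := Nx (w l) (psi l z).
(** The derivative with respect to the space coordinate [Xcoord], which is scaled by [lam]; hence
    the division by [lam]. *)
Definition dNcoord l z : R :=
  2^-1 / lam * sin (2 * tv (vx (w l) (psi l z)) + gam (w l)) / sin (gam (w l)).

Let Apsi l z : regular z -> 0 < Ap (w l) (psi l z).
Proof. by move=> [_ /(_ l)]; exact: Apos. Qed.

Let ev_sqr l : 0 < 1 - ev (w l) ^+ 2.
Proof. by have /andP[h1 h2] := ev_bound (w1 l); nra. Qed.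

Let sing l : 0 < sin (gam (w l)).
Proof. exact/sin_gt0_pi/gam_bound. Qed.

Let kxE l z : regular z -> Ncoord l z * dxi (w l) (psi l z) = kx w l (psi l z).
Proof. by move=> hz; rewrite /Ncoord Nx_dxi //; exact: Apsi. Qed.

Let dX l z v : regular z -> has_D (Xcoord l) z v (lam * dxi (w l) (psi l z) * dpsi l z v).
Proof. exact: (has_D_Xcoord a lam dxiP). Qed.

Lemma sum_Ncoord_D z v : regular z -> \sum_l Ncoord l z * 'D_v (Xcoord l) z = 0.
Proof.
move=> hz; transitivity (lam * \sum_l kx w l (psi l z) * dpsi l z v); last first.
  by rewrite (sum_kx_dpsi v hz) mulr0.
rewrite mulr_sumr; apply: eq_bigr => l _; have [_ ->] := dX l v hz; rewrite -kxE //; ring.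
Qed.

Lemma has_D_Ncoord l z v : regular z ->
  has_D (Ncoord l) z v (dNcoord l z * 'D_v (Xcoord l) z).
Proof.
move=> hz; have [_ ->] := dX l v hz.
apply: (has_D_eq (has_D_comp (is_derive_Nx (Apsi l hz) (ev_sqr l)) (has_D_psi l v hz))).
rewrite /dNcoord; have := sing l.
move: (sin _) (sin (gam _)) (dxi _ _) (dpsi _ _ _) => S s d D s0.
by field; rewrite !gt_eqF.
Qed.

Lemma sum_dNcoord z : regular z ->
  \sum_l dNcoord l z * (Ncoord (l + 1) z ^+ 2 + Ncoord (l + 1 + 1) z ^+ 2) = 0.
Proof.
move=> hz; have [[_ lev _ _] _] := hz.
have st : \sum_l tv (vx (w l) (psi l z)) = - (pi / 2).
  by apply/eqP; rewrite -addr_eq0; apply/eqP; exact: lev.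
have sg : \sum_l gam (w l) = pi.
  move: sum_tv; rewrite /gam !sum_ord3; move: (pi : R) => P; lra.
apply: (@sum_sin_eq0 _ (fun l => 2 * tv (vx (w l) (psi l z)) + gam (w l)) (fun l => gam (w l))
  (fun l => Ncoord l z ^+ 2)) => // [|l].
  by rewrite big_split /= -mulr_sumr st sg; move: (pi : R) => P; lra.
rewrite /Ncoord Nx_sqr //; last exact: Apsi.
have := sing l; move: (tv _) (gam _) => T g s0.
rewrite (_ : 2 * T + g = (T + g) + T); last by ring.
rewrite [X in _ + cos X](_ : g = (T + g) - T); last by ring.
move: (T + g) => A; rewrite cosD cosB; move: s0.
move: (sin g) (cos A) (cos T) (sin A) (sin T) => s cA cT sA sT s0.
by field; rewrite gt_eqF.
Qed.

Lemma Ncoord_neq0 z : regular z -> exists l, Ncoord l z != 0.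
Proof.
move=> hz; apply/existsP; apply: contraT; rewrite negb_exists => /forallP H.
have := sum_kx_stereo_gt0 hz; rewrite big1 ?ltxx // => l _.
by rewrite -kxE //; move: (H l); rewrite negbK => /eqP ->; rewrite !mul0r.
Qed.

(** A radial graph over the sphere. If [dpsi] vanishes, [dstereo] is [k] times [stereo], and so is
    [dstereo_norm] relative to [stereo_norm]. The third component of [stereo] differs from
    [stereo_norm] by the constant 2 and has the same derivative, so [k = 0]. *)
Lemma dpsi_eq0 z v : regular z -> (forall l, dpsi l z v = 0) -> v = 0.
Proof.
move=> hz H; have [[rz0 _ _ _] _] := hz.
pose k := - (drho w r z v / rho w r z).
have dk l : dstereo r l z v = k * stereo r l z.
  have := H l; rewrite /dpsi /dpsi /k.
  move: (drho w r z v) (rho w r z) (stereo r l z) (dstereo r l z v) rz0 => D q s d q0 E.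
  apply: (mulfI (lt0r_neq0 q0)); transitivity (- (D * s)); first by lra.
  by field; rewrite gt_eqF.
have kM : dstereo_norm r z v = k * stereo_norm r z.
  apply: (mulfI (lt0r_neq0 (stereo_norm_gt0 r z))); rewrite -sum_stereo_dstereo.
  transitivity (k * \sum_l stereo r l z ^+ 2).
    by rewrite mulr_sumr; apply: eq_bigr => l _; rewrite dk; ring.
  by rewrite sum_stereo_sqr; ring.
have k0 : k = 0.
  have := dk (1 + 1); rewrite {1}/dstereo /= -/(dstereo_norm r z v) kM /stereo_norm /stereo /=.
  move: (r ^+ 2 * _) => q; lra.
have h0 := dk 0; have h1 := dk 1; move: h0 h1; rewrite k0 !mul0r /dstereo /=.
move=> /eqP + /eqP; rewrite !mulf_eq0 !pnatr_eq0 !(gt_eqF r0) /= => /eqP v0 /eqP v1.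
by apply/rowP; apply: ord2_all; rewrite mxE.
Qed.

Lemma differentiable_X z : regular z -> differentiable X z.
Proof. by move=> hz; apply: differentiable_rowf => l; case: (dX l 0 hz). Qed.

Lemma mul_jacobian_X z v l : regular z ->
  (v *m 'J X z) 0 l = lam * dxi (w l) (psi l z) * dpsi l z v.
Proof.
move=> hz; rewrite -deriveEjacobian; last exact: differentiable_X.
rewrite derive_rowf ?mxE => [|m]; last by case: (dX m 0 hz).
by case: (dX l v hz).
Qed.

Lemma immersive_X z : regular z -> immersive_at X z.
Proof.
move=> hz; apply: inj_row_free => v /rowP vJ; apply: (dpsi_eq0 hz) => l.
have := vJ l; rewrite mul_jacobian_X // mxE; have := dxi_gt0 (w1 l) (Apsi l hz).
move: (dxi _ _) (dpsi _ _ _) => d D d0 /eqP.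
by rewrite !mulf_eq0 (gt_eqF lam0) (gt_eqF d0) => /eqP.
Qed.

Lemma crossv_row_free (J : 'M[R]_(2, 3)) : row_free J ->
  exists l, crossv (row 0 J) (row 1 J) 0 l != 0.
Proof.
move=> Jf; apply/existsP; apply: contraT; rewrite negb_exists => /forallP H.
have cE l m : J 0 l * J 1 m = J 0 m * J 1 l.
  have h0 := H 0; have h1 := H 1; have h2 := H (1 + 1).
  move: h0 h1 h2; rewrite !negbK !mxE !add0r ord3_3 add0r.
  rewrite !subr_eq0 => /eqP h0 /eqP h1 /eqP h2.
  by move: l m; apply: ord3_all; apply: ord3_all.
have z0 l : J 1 l = 0 /\ J 0 l = 0.
  pose v : plane := \row_i (if i == 0 then J 1 l else - J 0 l).
  have : v *m J = 0 *m J.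
    by apply/rowP => m; rewrite mul0mx !mxE sum_ord2 !mxE /= mulrC cE; ring.
  move=> /(row_free_inj Jf)/rowP v0; move: (v0 0) (v0 1); rewrite !mxE /= => -> /eqP.
  by rewrite oppr_eq0 => /eqP ->.
have : e_ 0 *m J = 0 *m J.
  apply/rowP => m; rewrite mul0mx !mxE sum_ord2; have [-> ->] := z0 m.
  by rewrite !mulr0 addr0.
by move=> /(row_free_inj Jf)/rowP/(_ 0)/eqP; rewrite !mxE /= oner_eq0.
Qed.

Lemma mean_curvature_X z : regular z -> mean_curvature X z = 0.
Proof.
move=> hz; apply: (@mean_curvature_eq0 _ regular Xcoord Ncoord dNcoord) => //.
- exact: open_regular.
- by move=> l n; exact: smooth_Xcoord.
- by move=> p i hp; exact: sum_Ncoord_D.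
- by move=> l p i hp; exact: has_D_Ncoord.
- exact: Ncoord_neq0.
- have pE (i : 'I_2) : partial i X z = row i ('J X z).
    by rewrite /partial deriveEjacobian ?rowE //; exact: differentiable_X.
  by rewrite !pE; apply: crossv_row_free; exact: immersive_X.
- exact: sum_dNcoord.
Qed.

End MinimalImmersion.

(** * Boundary curves *)

Section BoundaryCurves.
Context {R : realType}.
Local Notation plane := 'rV[R]_2.
Local Notation e_ i := (delta_mx 0 i : plane).
Context (w b a : 'I_3 -> R) (xi : 'I_3 -> R -> R) (r lam : R).
Implicit Types (t x : R) (z p v : plane) (i j l : 'I_3).

Hypothesis w1 : forall i, -1 < w i < 1.
Hypothesis sum_tv : \sum_i tv (w i) = pi / 2.
Hypothesis b0 : forall l, 0 < b l.
Hypothesis wb : forall l, 1 + w l < b l ^+ 2.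
Hypothesis Apos : forall l x, - b l < x < b l -> 0 < Ap (w l) x.
Hypothesis dxiP : forall l x, - b l < x < b l -> is_derive x 1 (xi l) (dxi (w l) x).
Hypothesis r0 : 0 < r.
Hypothesis lam0 : 0 < lam.
Hypothesis xi0 : forall l, xi l 0 = 0.
Hypothesis axi : forall l, a l / 2 = lam * xi l (Num.sqrt (1 + w l)).
Hypothesis a0 : forall l, 0 < a l.

Local Notation regular := (regular w b r).
Local Notation psi := (psi w r).
Local Notation rho := (rho w r).
Local Notation dpsi := (dpsi w r).
Local Notation inside := (inside w r).
Local Notation cap := (cap w).
Local Notation wtotal := (wtotal w).
Local Notation M := (stereo_norm r).
Local Notation Xcoord := (Xcoord w a xi r lam).
Local Notation X := (rowf Xcoord).

Let w1_gt0 l : 0 < 1 + w l.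
Proof. by have /andP[? ?] := w1 l; lra. Qed.

Let bP l x : x ^+ 2 <= 1 + w l -> - b l < x < b l.
Proof.
move=> hx; have := le_lt_trans hx (wb l); have := b0 l.
by move: (b l) => B B0 h; apply/andP; split; nra.
Qed.

Lemma xi_lt l x y : - b l < x -> x < y -> y < b l -> xi l x < xi l y.
Proof.
move=> x0 xy yb.
have inb u : u \in `[x, y] -> - b l < u < b l.
  by rewrite in_itv /= => /andP[h1 h2]; apply/andP; split; lra.
have [u||c cxy E] := MVT xy (df := dxi (w l)) (f := xi l).
- by move=> hu; apply/dxiP/inb; exact: subset_itv_oo_cc hu.
- by apply: derivable_within_continuous => u /inb hu; case: (dxiP hu).
rewrite -subr_gt0 E mulr_gt0 ?subr_gt0 // dxi_gt0 //; apply/Apos/inb.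
exact: subset_itv_oo_cc cxy.
Qed.

Lemma Xcoord_bound l z : psi l z ^+ 2 <= 1 + w l ->
  (0 <= Xcoord l z <= a l) /\ (psi l z ^+ 2 < 1 + w l -> 0 < Xcoord l z < a l).
Proof.
move=> hx; have p0 := sqrtr_gt0 (1 + w l); rewrite w1_gt0 in p0.
have pE := sqr_sqrtr (ltW (w1_gt0 l)).
have pb : - b l < Num.sqrt (1 + w l) < b l by apply: bP; rewrite pE.
have xb := bP hx.
have od := xi_odd (b0 l) (@Apos l) (@dxiP l) (xi0 l) pb.
have mb : - b l < - Num.sqrt (1 + w l) by case/andP: pb => ? ?; lra.
have [] : (xi l (- Num.sqrt (1 + w l)) <= xi l (psi l z) <= xi l (Num.sqrt (1 + w l))) /\
  (psi l z ^+ 2 < 1 + w l ->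
   xi l (- Num.sqrt (1 + w l)) < xi l (psi l z) < xi l (Num.sqrt (1 + w l))).
  move: hx pb xb; rewrite -[in X in X -> _]pE -[in X in _ /\ (X -> _)]pE.
  move: (Num.sqrt _) (psi l z) p0 mb => p x p0 mb hx /andP[pb1 pb2] /andP[xb1 xb2].
  have hs : x ^+ 2 < p ^+ 2 -> xi l (- p) < xi l x < xi l p.
    by move=> h; apply/andP; split; apply: xi_lt => //; nra.
  split=> //; move: hx; rewrite le_eqVlt => /orP[|/hs/andP[/ltW -> /ltW ->]//].
  rewrite eqf_sqr => /orP[]/eqP ->; rewrite lexx ?andbT.
    by apply/ltW/xi_lt => //; lra.
  by apply/ltW/xi_lt => //; lra.
rewrite od /Xcoord; have := axi l; have := a0 l; have := lam0.
move: (xi l _) (xi l _) (a l) => x P A L0 A0 E /andP[h1 h2] hs.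
have F (Q y : R) : 0 < y + Q -> y < Q -> 0 < lam * Q + lam * y < 2 * (lam * Q).
  by move=> H1 H2; apply/andP; split; nra.
have F' (Q y : R) : 0 <= y + Q -> y <= Q -> 0 <= lam * Q + lam * y <= 2 * (lam * Q).
  by move=> H1 H2; apply/andP; split; nra.
have -> : A = 2 * (lam * P) by rewrite -E; field.
rewrite (_ : 2 * (lam * P) / 2 = lam * P); last by field.
split; first by apply: F' => //; lra.
by move=> /hs/andP[h3 h4]; apply: F => //; lra.
Qed.

Lemma inside_prism z : inside z -> prism a (X z).
Proof.
move=> /(inside_regular w1 sum_tv b0 wb)[_ H] l; rewrite mxE.
by have [] := Xcoord_bound (H l).
Qed.

Section Curve.
Context (z : plane) (i : 'I_3) (e : R).
Hypothesis zin : inside z.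
Hypothesis e2 : e ^+ 2 = 1.
Hypothesis zi : stereo r i z = e * Num.sqrt (cap i) * M z.

Let scap l : Num.sqrt (cap l) ^+ 2 = cap l.
Proof. by rewrite sqr_sqrtr // ltW // cap_gt0. Qed.

(** The bound [psi_i ^ 2 <= 1 + w i] gives one inequality. Were it strict, [tau], where the ray
    meets the sphere, would be a second zero of the level function, against its strict decrease up
    to [tau]. *)
Lemma boundary_rho : (rho z * M z) ^+ 2 = wtotal.
Proof.
have [hz hp] := inside_regular w1 sum_tv b0 wb zin; have [fz _] := hz.
have [t0 lev0 _ _] := fz; have M0 := stereo_norm_gt0 r z.
have S0 := total_gt0 w1 sum_tv.
have le1 : (rho z * M z) ^+ 2 <= wtotal.
  rewrite -(ler_pM2l (cap_gt0 w1 sum_tv i)) cap_total //; have := hp i.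
  rewrite /psi zi (_ : rho z * _ = e * Num.sqrt (cap i) * (rho z * M z)); last by ring.
  by rewrite exprMn [(e * _) ^+ 2]exprMn e2 scap mul1r.
apply/eqP; rewrite eq_le le1 leNgt; apply/negP => lt1.
pose tau := Num.sqrt wtotal / M z.
have tauE : (tau * M z) ^+ 2 = wtotal by rewrite /tau mulfVK ?gt_eqF // sqr_sqrtr // ltW.
have tau0 : 0 < tau by rewrite divr_gt0 // sqrtr_gt0.
have bnd s l : 0 <= s -> s < tau -> (s * stereo r l z) ^+ 2 < 1 + w l.
  move=> s0 st; apply: (@le_lt_trans _ _ (cap l * (s * M z) ^+ 2)).
    have := zin l; rewrite !exprMn; have : 0 <= s ^+ 2 by rewrite sqr_ge0.
    move: (s ^+ 2) (cap l) => q c q0 h; rewrite [c * _]mulrCA; exact: ler_wpM2l.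
  rewrite -(cap_total w1 sum_tv) ltr_pM2l ?cap_gt0 // -tauE.
  have st' : s * M z < tau * M z by rewrite ltr_pM2r.
  have sM : 0 <= s * M z by rewrite mulr_ge0 // ltW.
  by move: (s * M z) (tau * M z) sM st' => p q p0 pq; nra.
have lt2 : rho z < tau.
  rewrite -(ltr_pM2r M0); have p0 : 0 < rho z * M z by exact: mulr_gt0.
  have q0 : 0 < tau * M z by exact: mulr_gt0.
  move: lt1; rewrite -tauE; move: (rho z * M z) (tau * M z) p0 q0 => p q p0 q0 pq; nra.
have levtau : level w r tau z = 0.
  have vi : vx (w i) (tau * stereo r i z) = -1.
    rewrite /vx zi (_ : tau * _ = e * Num.sqrt (cap i) * (tau * M z)); last by ring.
    by rewrite exprMn [(e * _) ^+ 2]exprMn e2 scap tauE mul1r cap_total //; ring.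
  have vjk : vx (w (i + 1 + 1)) (tau * stereo r (i + 1 + 1) z) =
      - vx (w (i + 1)) (tau * stereo r (i + 1) z).
    have := sum_stereo_sqr r z; rewrite (sum_cyclic _ i) => E.
    have := congr1 (fun x => tau ^+ 2 * x) E; rewrite /= !mulrDr -!exprMn tauE (totalE _ i).
    move: vi; rewrite /vx; lra.
  rewrite /level (sum_cyclic _ i) vi vjk !tvN tv1; move: (tv _) (pi : R) => T P; ring.
have [c /andP[c1 c2] E] := level_MVT w r z lt2.
have c0 : 0 < c by exact: lt_trans c1.
have [l sl] := stereo_neq0 r z.
have : dlevel w r c z < 0.
  apply: (dlevel_lt0 w1 c0 _ _ sl) => [m|]; first exact/ltW/bnd/c2/ltW.
  exact/bnd/c2/ltW.
have : dlevel w r c z = 0.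
  move: E; rewrite levtau lev0 subrr => /esym/eqP; rewrite mulf_eq0 => /orP[/eqP //|].
  by rewrite gt_eqF ?subr_gt0.
by move=> ->; rewrite ltxx.
Qed.

Lemma boundary_vi : vx (w i) (psi i z) = -1.
Proof.
rewrite /vx /psi zi (_ : rho z * _ = e * Num.sqrt (cap i) * (rho z * M z)); last by ring.
by rewrite exprMn [(e * _) ^+ 2]exprMn e2 scap boundary_rho mul1r cap_total //; ring.
Qed.

Lemma boundary_vjk : vx (w (i + 1 + 1)) (psi (i + 1 + 1) z) = - vx (w (i + 1)) (psi (i + 1) z).
Proof.
have := sum_stereo_sqr r z; rewrite (sum_cyclic _ i) => E.
have := congr1 (fun x => rho z ^+ 2 * x) E; rewrite /= !mulrDr -!exprMn boundary_rho (totalE _ i).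
by move: boundary_vi; rewrite /vx /psi; lra.
Qed.

(** Every value of [vx] is below 1, and the two remaining ones are opposite. Thus the boundary curve
    avoids the edges of its face. *)
Lemma boundary_v_bound l : l != i -> -1 < vx (w l) (psi l z) < 1.
Proof.
have [hz hp] := inside_regular w1 sum_tv b0 wb zin.
have up m : vx (w m) (psi m z) < 1.
  have /andP[_ h] := w1 m; rewrite /vx; have := sqr_ge0 (psi m z); lra.
have h1 := up (i + 1); have h2 := up (i + 1 + 1); move: h2; rewrite boundary_vjk => h2.
move=> /ord3_neq[] ->; rewrite ?boundary_vjk; apply/andP; split; lra.
Qed.

Lemma boundary_psi : psi i z = e * Num.sqrt (1 + w i).
Proof.
have M0 := stereo_norm_gt0 r z; have [[[q0 _ _ _] _] _] := inside_regular w1 sum_tv b0 wb zin.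
have -> : Num.sqrt (1 + w i) = Num.sqrt (cap i) * (rho z * M z).
  rewrite -(cap_total w1 sum_tv) -boundary_rho sqrtrM ?ltW ?cap_gt0 // sqrtr_sqr.
  by rewrite ger0_norm // ltW // mulr_gt0.
by rewrite /psi zi; ring.
Qed.

Lemma boundary_Xcoord : Xcoord i z = a i / 2 + e * (a i / 2).
Proof.
rewrite /Xcoord boundary_psi axi.
have pb : - b i < Num.sqrt (1 + w i) < b i by apply: bP; rewrite sqr_sqrtr // ltW.
have od := xi_odd (b0 i) (@Apos i) (@dxiP i) (xi0 i) pb.
have /eqP := e2; rewrite sqrf_eq1 => /orP[]/eqP ->; rewrite ?mul1r // mulN1r od; ring.
Qed.

Lemma boundary_Xcoord_other l : l != i -> 0 < Xcoord l z < a l.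
Proof.
move=> li; have [hz hp] := inside_regular w1 sum_tv b0 wb zin.
have [_ H] := Xcoord_bound (hp l); apply: H.
by have /andP[+ _] := boundary_v_bound li; rewrite /vx; lra.
Qed.

Lemma boundary_Ncoord : Ncoord w r i z = 0.
Proof. by rewrite /Ncoord /Nx boundary_vi sqrrN expr1n subrr mulr0 !mul0r. Qed.

(* The two remaining profile angles are opposite, so that the factors of [psi l] in [kx] agree
   and [sum_stereo_dstereo] eliminates the derivative of [rho]. *)
Lemma boundary_dpsi v : dpsi i z v =
  rho z / (1 - cap i) * (dstereo r i z v - e * Num.sqrt (cap i) * dstereo_norm r z v).
Proof.
have [[[q0 _ _ _] _] _] := inside_regular w1 sum_tv b0 wb zin.
have M0 := stereo_norm_gt0 r z; have c1 : 0 < 1 - cap i by rewrite subr_gt0 cap_lt1.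
have lt l (li : l != i) := boundary_v_bound li.
pose V := vx (w (i + 1)) (psi (i + 1) z).
pose k := 6 * (1 - V ^+ 2) / (1 + ev V ^+ 2).
have k0 : 0 < k.
  have /lt : i + 1 != i by move: {lt k V} i; apply: ord3_all.
  rewrite -/V => /andP[V1 V2]; rewrite /k divr_gt0 ?oneD_gt0 // mulr_gt0 // subr_gt0; nra.
have ki : kx w i (psi i z) = 0 by rewrite /kx boundary_vi sqrrN expr1n subrr mulr0 mul0r.
have kj : kx w (i + 1) (psi (i + 1) z) = k * psi (i + 1) z.
  have F (x u q : R) : 6 * x * u / q = 6 * u / q * x by ring.
  exact: F.
have kk : kx w (i + 1 + 1) (psi (i + 1 + 1) z) = k * psi (i + 1 + 1) z.
  have F (x u q : R) : 6 * x * u / q = 6 * u / q * x by ring.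
  by rewrite /kx boundary_vjk -/V evN !sqrrN; exact: F.
have S1 := sum_stereo_sqr r z; have S2 := sum_stereo_dstereo r z v.
move: S1 S2; rewrite !(sum_cyclic _ i) => S1 S2.
rewrite /dpsi /drho !(sum_cyclic _ i) ki kj kk /psi !mul0r !add0r.
have sc := scap i; move: S1 S2; rewrite zi.
move: sc c1 M0 q0.
move: (M z) (cap i) (rho z) (Num.sqrt (cap i)) => m c q g gc c1 m0 q0.
move: (stereo _ _ _) (stereo _ _ _) => sk sj.
move: (dstereo _ _ _ _) (dstereo_norm _ _ _) (dstereo _ _ _ _) (dstereo _ _ _ _) => dk dm dj di.
move=> S1 S2.
have T1 : sj ^+ 2 + sk ^+ 2 = (1 - c) * m ^+ 2.
  by move: S1; rewrite !exprMn e2 gc; lra.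
have T2 : sj * dj + sk * dk = m * (dm - e * g * di) by move: S2; lra.
have -> : k * (q * sj) * dj + k * (q * sk) * dk = k * q * (m * (dm - e * g * di)).
  by rewrite -T2; ring.
have -> : k * (q * sj) * sj + k * (q * sk) * sk = k * q * ((1 - c) * m ^+ 2).
  by rewrite -T1; ring.
transitivity (q / (1 - c) * ((e * g) ^+ 2 * di + (1 - c) * di - e * g * dm)).
  by field; rewrite !gt_eqF.
by rewrite exprMn e2 gc; ring.
Qed.

(** The face normal is orthogonal to the surface normal [n], hence in the image of the differential:
    this image lies in the kernel of [n] and has the same rank. The [i]-th component of the
    differential is [e] times a positive multiple of [dotv v nu], which gives the outward direction
    and the orthogonality to the boundary curve. *)
Lemma boundary_conormal (nu : plane) K : 0 < K ->
  (forall v, dstereo r i z v - e * Num.sqrt (cap i) * dstereo_norm r z v = e * K * dotv v nu) ->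
  outward_unit_conormal X z nu (e *: delta_mx 0 i).
Proof.
move=> K0 hK; have [hz hp] := inside_regular w1 sum_tv b0 wb zin.
have [[q0 _ _ _] _] := hz.
have c1 : 0 < 1 - cap i by rewrite subr_gt0 cap_lt1.
have A0 : 0 < Ap (w i) (psi i z) by apply/Apos; case: hz.
pose C := lam * dxi (w i) (psi i z) * (rho z / (1 - cap i)) * K.
have C0 : 0 < C.
  by rewrite /C mulr_gt0 // mulr_gt0 // ?divr_gt0 // mulr_gt0 // dxi_gt0.
have JC v : (v *m 'J X z) 0 i = e * C * dotv v nu.
  rewrite (mul_jacobian_X a lam dxiP) // boundary_dpsi hK /C.
  have F (x y y' k u : R) : x * (y * (e * k * u)) = e * (x * y * k) * u by ring.
  exact: F.
have dotE (u : 'rV[R]_3) : dotv (e *: delta_mx 0 i) u = e * u 0 i.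
  rewrite /dotv (bigD1 i) //= big1 ?addr0 ?mxE ?eqxx ?mulr1 // => l li.
  by rewrite !mxE (negbTE li) andbF mulr0 mul0r.
split.
- by rewrite /enorm dotE !mxE !eqxx mulr1 -expr2 e2 sqrtr1.
- have imm := immersive_X a w1 Apos dxiP r0 lam0 hz.
  pose n : 'cV[R]_3 := \col_l Ncoord w r l z.
  have Jn : 'J X z *m n = 0.
    apply/row_matrixP => j; rewrite row_mul row0 rowE.
    apply/rowP => k; rewrite mxE [RHS]mxE -[RHS](sum_Ncoord_D a lam w1 Apos dxiP (e_ j) hz).
    apply: eq_bigr => l _; rewrite [n _ _]mxE (mul_jacobian_X a lam dxiP) //.
    by have [_ ->] := has_D_Xcoord a lam dxiP l (e_ j) hz; rewrite mulrC.
  have en : (e *: delta_mx 0 i : 'rV[R]_3) *m n = 0.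
    by rewrite -scalemxAl -rowE; apply/rowP => k; rewrite !mxE boundary_Ncoord mulr0.
  have rn : \rank n = 1%N.
    have := rank_leq_col n; have [l nl] := Ncoord_neq0 w1 Apos hz.
    have : n != 0 by apply: contraNneq nl => /matrixP/(_ l 0); rewrite !mxE => ->.
    by rewrite -mxrank_eq0; case: (\rank n) => [|[|]].
  have sub : ('J X z <= kermx n)%MS by apply/sub_kermxP.
  have sub' : (kermx n <= 'J X z)%MS.
    by rewrite -(mxrank_leqif_sup sub) mxrank_ker rn (eqP imm).
  have /submxP[v vE] : ((e *: delta_mx 0 i : 'rV[R]_3) <= 'J X z)%MS.
    by apply: submx_trans sub'; apply/sub_kermxP.
  exists v => //; have := JC v; rewrite -vE !mxE !eqxx mulr1 => E.
  have e0 : e != 0 by apply: contra_eq_neq e2 => ->; rewrite expr0n eq_sym oner_eq0.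
  have : C * dotv v nu = 1 by apply: (mulfI e0); rewrite mulrA -E mulr1.
  by move=> E'; rewrite -(pmulr_rgt0 _ C0) E'.
- by move=> t tn; rewrite dotE JC tn !mulr0.
Qed.


End Curve.

End BoundaryCurves.

(** * The parameter domain *)

Section FiveHoles.
Context {R : realType}.
Local Notation plane := 'rV[R]_2.

Lemma ord5_all (Q : 'I_5 -> Prop) :
  Q (inord 0) -> Q (inord 1) -> Q (inord 2) -> Q (inord 3) -> Q (inord 4) -> forall k, Q k.
Proof.
move=> Q0 Q1 Q2 Q3 Q4 [[|[|[|[|[|//]]]]] ltk].
- by rewrite (_ : Ordinal ltk = inord 0) //; apply/val_inj; rewrite /= inordK.
- by rewrite (_ : Ordinal ltk = inord 1) //; apply/val_inj; rewrite /= inordK.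
- by rewrite (_ : Ordinal ltk = inord 2) //; apply/val_inj; rewrite /= inordK.
- by rewrite (_ : Ordinal ltk = inord 3) //; apply/val_inj; rewrite /= inordK.
- by rewrite (_ : Ordinal ltk = inord 4) //; apply/val_inj; rewrite /= inordK.
Qed.

Lemma enormE (u : plane) : enorm u = Num.sqrt (u 0 0 ^+ 2 + u 0 1 ^+ 2).
Proof. by rewrite /enorm /dotv sum_ord2 !expr2. Qed.

Lemma enorm_le (u : plane) c : 0 <= c -> (enorm u <= c) = (u 0 0 ^+ 2 + u 0 1 ^+ 2 <= c ^+ 2).
Proof.
move=> c0; rewrite enormE -[in LHS](ger0_norm c0) -sqrtr_sqr ler_psqrt // nnegrE.
  by rewrite addr_ge0 ?sqr_ge0.
exact: sqr_ge0.
Qed.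

Lemma enorm_ge (u : plane) c : 0 <= c -> (c <= enorm u) = (c ^+ 2 <= u 0 0 ^+ 2 + u 0 1 ^+ 2).
Proof.
move=> c0; rewrite enormE -[in LHS](ger0_norm c0) -sqrtr_sqr ler_psqrt // nnegrE.
  exact: sqr_ge0.
by rewrite addr_ge0 ?sqr_ge0.
Qed.

Lemma enorm_gt (u : plane) c : 0 <= c -> (c < enorm u) = (c ^+ 2 < u 0 0 ^+ 2 + u 0 1 ^+ 2).
Proof. by move=> c0; rewrite ltNge enorm_le // -ltNge. Qed.

Lemma enorm_eq (u : plane) c : 0 <= c -> enorm u = c -> u 0 0 ^+ 2 + u 0 1 ^+ 2 = c ^+ 2.
Proof. by move=> c0 <-; rewrite enormE sqr_sqrtr // addr_ge0 ?sqr_ge0. Qed.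

Context (h d0 d1 s0 s1 : R).
Hypothesis h01 : 0 < h < 1.
Hypothesis s00 : 0 < s0.
Hypothesis s10 : 0 < s1.
Hypothesis ds0 : d0 + s0 < 1.
Hypothesis ds1 : d1 + s1 < 1.
Hypothesis hs0 : h + s0 < d0.
Hypothesis hs1 : h + s1 < d1.
Hypothesis ss : (s0 + s1) ^+ 2 < d0 ^+ 2 + d1 ^+ 2.

Definition five_center (k : 'I_5) : plane :=
  \row_j (if j == 0 then [:: 0; d0; - d0; 0; 0] else [:: 0; 0; 0; d1; - d1])`_k.

Definition five_radius (k : 'I_5) : R := [:: h; s0; s0; s1; s1]`_k.

Lemma five_radius_gt0 k : 0 < five_radius k.
Proof. by have /andP[h0 _] := h01; move: k; apply: ord5_all; rewrite /five_radius inordK. Qed.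

Lemma five_center_in k : enorm (five_center k) + five_radius k < 1.
Proof.
have /andP[h0 h1] := h01.
suff : five_radius k < 1 /\ (five_center k 0 0) ^+ 2 + (five_center k 0 1) ^+ 2 <
    (1 - five_radius k) ^+ 2.
  move=> [r1 H]; rewrite -ltrBrDr ltNge enorm_ge; first by rewrite -ltNge.
  by rewrite subr_ge0 ltW.
rewrite !mxE /five_radius; move: k; apply: ord5_all; rewrite !inordK //=.
- by split => //; rewrite expr0n addr0 exprn_gt0 // subr_gt0.
all: have := s00; have := s10; have := ds0; have := ds1; have := hs0; have := hs1.
all: by rewrite ?sqrrN ?expr0n ?addr0 ?add0r => *; split; [lra|nra].
Qed.

Lemma five_disjoint i j : i != j ->
  five_radius i + five_radius j < enorm (five_center i - five_center j).
Proof.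
have /andP[h0 h1] := h01.
have A (s d : R) : 0 < s -> h + s < d -> (h + s) ^+ 2 < d ^+ 2 /\ s ^+ 2 < d ^+ 2.
  by move=> *; split; nra.
have [A0 B0] := A _ _ s00 hs0; have [A1 B1] := A _ _ s10 hs1; have S := ss.
move=> ij; rewrite enorm_gt; last by rewrite addr_ge0 // ltW // five_radius_gt0.
rewrite !mxE /five_radius; move: i j ij; apply: ord5_all; apply: ord5_all.
all: rewrite -val_eqE /= !inordK //= => _; lra.
Qed.

Definition five_holes : holed_disc R 5 :=
  HoledDisc five_radius_gt0 five_center_in five_disjoint.

End FiveHoles.

(** * Stereographic images of the caps *)

Section StereographicDomain.
Context {R : realType}.
Local Notation plane := 'rV[R]_2.

Lemma enormD (u v : plane) : enorm (u + v) <= enorm u + enorm v.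
Proof.
have n0 (x : plane) : 0 <= enorm x by rewrite /enorm sqrtr_ge0.
rewrite enorm_le ?addr_ge0 // !mxE.
have := enorm_eq (n0 u) erefl; have := enorm_eq (n0 v) erefl.
move: (enorm u) (enorm v) (n0 u) (n0 v) => p q p0 q0 Q P.
have CS : u 0 0 * v 0 0 + u 0 1 * v 0 1 <= p * q.
  have [|uv0] := ltP (u 0 0 * v 0 0 + u 0 1 * v 0 1) 0.
    by move=> /ltW/le_trans; apply; exact: mulr_ge0.
  rewrite -(ler_pXn2r (n := 2)) ?nnegrE ?mulr_ge0 // exprMn -P -Q -subr_ge0.
  rewrite [X in 0 <= X](_ : _ = (u 0 0 * v 0 1 - u 0 1 * v 0 0) ^+ 2) ?sqr_ge0 //.
  by ring.
move: (u 0 0) (u 0 1) (v 0 0) (v 0 1) P Q CS => x y x' y' P Q CS; nra.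
Qed.

Lemma enormB (u v : plane) : enorm u <= enorm v + enorm (u - v).
Proof. by have := enormD v (u - v); rewrite addrC subrK. Qed.

Lemma enormN (u : plane) : enorm (- u) = enorm u.
Proof. by rewrite !enormE !mxE !sqrrN. Qed.

Lemma boundary_carrier k (D : holed_disc R k) b z :
  boundary_component D b z -> carrier D z.
Proof.
case: b => [i|] /= zb.
  split=> [|j].
    have := enormB z (hole_center D i); have := hole_in_disc D i; rewrite zb => *; lra.
  have [<-|ij] := eqVneq i j; first by rewrite zb.
  have := holes_disjoint D ij.
  have := enormB (hole_center D i - hole_center D j) (z - hole_center D j).
  by rewrite opprB addrA subrK -[hole_center D i - z]opprB enormN zb => *; lra.
split=> [|j]; first by rewrite zb.
by have := enormB z (hole_center D j); have := hole_in_disc D j; rewrite zb => *; lra.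
Qed.

(** Under inverse stereographic projection of [r *: z], the section of the sphere at height [p]
    along a horizontal axis pulls back to the circle with center at distance [1 / (r p)] and radius
    [hole_rad]. *)
Definition hole_dist (r p : R) : R := (r * p)^-1.
Definition hole_rad (r p : R) : R := Num.sqrt (1 - p ^+ 2) * hole_dist r p.

(** With [s = sqrt (1 - p ^ 2)], disjointness of the caps reads [s < q]. Since
    [p ^ 2 = (1 - s) (1 + s)], both separations reduce to [1 + s < r ^ 2 (1 - s)], which is [s < q]
    again for this [r]. *)
Lemma hole_bounds (p q r : R) : 0 < p -> p < 1 -> 0 < q -> q < 1 -> 1 < p ^+ 2 + q ^+ 2 ->
  0 < r -> r ^+ 2 = (1 + q) / (1 - q) ->
  [/\ 0 < hole_rad r p, hole_dist r p + hole_rad r p < 1 &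
    (r ^+ 2)^-1 + hole_rad r p < hole_dist r p].
Proof.
move=> p0 p1 q0 q1 pq r0 rE; rewrite /hole_rad /hole_dist.
have s2 : 0 < 1 - p ^+ 2 by nra.
have sE := sqr_sqrtr (ltW s2); have s0 : 0 < Num.sqrt (1 - p ^+ 2) by rewrite sqrtr_gt0.
move: (Num.sqrt _) s0 sE => s s0 sE.
have sq : s < q by nra.
have rs : 1 + s < r ^+ 2 * (1 - s).
  rewrite rE mulrAC ltr_pdivlMr ?subr_gt0 //; nra.
have rp0 : 0 < r * p by exact: mulr_gt0.
have s1 : s < 1 by lra.
split; first by rewrite mulr_gt0 // invr_gt0.
  rewrite -[X in X + _]mul1r -mulrDl ltr_pdivrMr // mul1r.
  rewrite -(ltr_pXn2r (n := 2)) ?nnegrE ?addr_ge0 ?ltW // exprMn.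
  by rewrite (_ : p ^+ 2 = (1 - s) * (1 + s)) ?mulrA; nra.
rewrite -ltrBrDr -[X in X - _]mul1r -mulrBl ltr_pdivlMr //.
rewrite expr2 invfM -mulrA [r^-1 * (r * p)]mulrA mulVf ?gt_eqF // mul1r.
rewrite mulrC ltr_pdivrMr //.
rewrite -(ltr_pXn2r (n := 2)) ?nnegrE ?mulr_ge0 ?subr_ge0 ?ltW // exprMn.
by rewrite (_ : p ^+ 2 = (1 - s) * (1 + s)); nra.
Qed.

Context (w : 'I_3 -> R).
Hypothesis w1 : forall i, -1 < w i < 1.
Hypothesis sum_tv : \sum_i tv (w i) = pi / 2.

Definition rcap l : R := Num.sqrt (cap w l).
(* With this scale the two caps around the third axis become the outside of the unit
   disc and the disc of radius [(rscale ^+ 2)^-1] around the origin. *)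
Definition rscale : R := Num.sqrt ((1 + rcap (1 + 1)) / (1 - rcap (1 + 1))).
Local Notation d l := (hole_dist rscale (rcap l)).
Local Notation s l := (hole_rad rscale (rcap l)).

Let rcapE l : rcap l ^+ 2 = cap w l.
Proof. by rewrite sqr_sqrtr // ltW // cap_gt0. Qed.

Let rcap_gt0 l : 0 < rcap l.
Proof. by rewrite sqrtr_gt0 cap_gt0. Qed.

Let rcap_lt1 l : rcap l < 1.
Proof. by have := rcapE l; have := rcap_gt0 l; have := cap_lt1 w1 sum_tv l; nra. Qed.

Let rscaleE : rscale ^+ 2 = (1 + rcap (1 + 1)) / (1 - rcap (1 + 1)).
Proof.
rewrite sqr_sqrtr // divr_ge0 ?subr_ge0; [by []| |exact/ltW/rcap_lt1].
by rewrite addr_ge0 // ltW.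
Qed.

Lemma rscale_gt0 : 0 < rscale.
Proof. by rewrite sqrtr_gt0 divr_gt0 ?subr_gt0 ?rcap_lt1 // addr_gt0. Qed.

Let bounds l : l != 1 + 1 -> [/\ 0 < s l, d l + s l < 1 & (rscale ^+ 2)^-1 + s l < d l].
Proof.
move=> l2; apply: (hole_bounds (rcap_gt0 l) (rcap_lt1 l) (rcap_gt0 (1 + 1)) (rcap_lt1 _)) => //.
  rewrite !rcapE; move: l l2; apply: ord3_all => // _.
    by have := capD_gt1 w1 sum_tv 1; rewrite ord3_3 addrC.
  by have := capD_gt1 w1 sum_tv 0; rewrite !add0r.
exact: rscale_gt0.
Qed.

Let h01 : 0 < (rscale ^+ 2)^-1 < 1.
Proof.
rewrite invr_gt0 exprn_gt0 ?rscale_gt0 //= invf_lt1 ?exprn_gt0 ?rscale_gt0 //.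
rewrite rscaleE ltr_pdivlMr ?subr_gt0 ?rcap_lt1 // mul1r ltrD2l.
by have := rcap_gt0 (1 + 1); lra.
Qed.

Let s00 : 0 < s 0. Proof. by have [] := bounds (isT : 0 != 1 + 1 :> 'I_3). Qed.
Let s10 : 0 < s 1. Proof. by have [] := bounds (isT : 1 != 1 + 1 :> 'I_3). Qed.
Let ds0 : d 0 + s 0 < 1. Proof. by have [] := bounds (isT : 0 != 1 + 1 :> 'I_3). Qed.
Let ds1 : d 1 + s 1 < 1. Proof. by have [] := bounds (isT : 1 != 1 + 1 :> 'I_3). Qed.
Let hs0 : (rscale ^+ 2)^-1 + s 0 < d 0.
Proof. by have [] := bounds (isT : 0 != 1 + 1 :> 'I_3). Qed.
Let hs1 : (rscale ^+ 2)^-1 + s 1 < d 1.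
Proof. by have [] := bounds (isT : 1 != 1 + 1 :> 'I_3). Qed.

Let rad2 l : s l ^+ 2 = (1 - cap w l) * d l ^+ 2.
Proof. by rewrite exprMn sqr_sqrtr rcapE // subr_ge0 ltW // cap_lt1. Qed.

Let dist2 l : cap w l * d l ^+ 2 = (rscale ^+ 2)^-1.
Proof.
rewrite /hole_dist exprVn exprMn rcapE invfM mulrCA mulfV ?mulr1 //.
by rewrite gt_eqF // cap_gt0.
Qed.

Let ss : (s 0 + s 1) ^+ 2 < d 0 ^+ 2 + d 1 ^+ 2.
Proof.
have c01 : 1 < cap w 0 + cap w 1.
  by have := capD_gt1 w1 sum_tv (1 + 1); rewrite ord3_3 add0r.
have := rad2 0; have := rad2 1; have := dist2 0; have := dist2 1; have := s00; have := s10.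
have := cap_gt0 w1 sum_tv 0; have := cap_gt0 w1 sum_tv 1.
have := cap_lt1 w1 sum_tv 0; have := cap_lt1 w1 sum_tv 1.
have /andP[h0 _] := h01; move: h0.
move: (d 0) (d 1) (s 0) (s 1) (cap w 0) (cap w 1) (_^-1) c01 => d0 d1 s0 s1 c0 c1 h c01 h0.
move=> c1l c0l c1p c0p s1p s0p dd1 dd0 r1 r0.
(* Here [s_l ^ 2 = d_l ^ 2 - h], so the claim is [s0 * s1 < h]; after squaring it becomes
   [(1 - c0) (1 - c1) < c0 c1], that is [c0 + c1 > 1]. *)
suff : s0 * s1 < h by rewrite sqrrD r1 r0 -mulr_natl => ?; nra.
have h0' : 0 <= h by exact: ltW.
have s01 : 0 <= s0 * s1 by rewrite mulr_ge0 // ltW.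
rewrite -(ltr_pXn2r (n := 2)) ?nnegrE // exprMn r0 r1.
rewrite -(ltr_pM2l (mulr_gt0 c0p c1p)).
have -> : c0 * c1 * ((1 - c0) * d0 ^+ 2 * ((1 - c1) * d1 ^+ 2)) =
  (1 - c0) * (1 - c1) * ((c0 * d0 ^+ 2) * (c1 * d1 ^+ 2)) by ring.
rewrite dd0 dd1 -expr2 ltr_pM2r ?exprn_gt0 //; lra.
Qed.

Definition domain : holed_disc R 5 := five_holes h01 s00 s10 ds0 ds1 hs0 hs1 ss.

End StereographicDomain.

(** * Boundary circles and the faces they map to *)

Section BoundaryCircles.
Context {R : realType}.
Local Notation plane := 'rV[R]_2.
Context (w : 'I_3 -> R).
Hypothesis w1 : forall i, -1 < w i < 1.
Hypothesis sum_tv : \sum_i tv (w i) = pi / 2.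
Implicit Types (z v : plane) (l : 'I_3).

Local Notation r := (rscale w).
Local Notation D := (domain w1 sum_tv).

Definition side (s : bool) : R := if s then 1 else -1.

Lemma side_sqr s : side s ^+ 2 = 1.
Proof. by case: s; rewrite /side ?sqrrN expr1n. Qed.

Definition circle_face (c : option 'I_5) : 'I_3 * bool :=
  if c is Some k then nth (0, true)
    [:: (1 + 1, false); (0, true); (0, false); (1, true); (1, false)] k
  else (1 + 1, true).

Definition circle_eqn (c : option 'I_5) z : R :=
  if c is Some k then (z 0 0 - hole_center D k 0 0) ^+ 2 + (z 0 1 - hole_center D k 0 1) ^+ 2
    - hole_radius D k ^+ 2
  else 1 - (z 0 0 ^+ 2 + z 0 1 ^+ 2).

Definition circle_factor (c : option 'I_5) : R :=
  if c is Some k then r ^+ 2 * [:: 1 + rcap w (1 + 1); rcap w 0; rcap w 0; rcap w 1; rcap w 1]`_k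
  else 1 + rcap w (1 + 1).

Let rcap0 l : 0 < rcap w l. Proof. by rewrite sqrtr_gt0 cap_gt0. Qed.
Let rcapE l : rcap w l ^+ 2 = cap w l. Proof. by rewrite sqr_sqrtr // ltW // cap_gt0. Qed.

Lemma circle_factor_gt0 c : 0 < circle_factor c.
Proof.
have q0 : 0 < 1 + rcap w (1 + 1) by rewrite addr_gt0.
case: c => [k|//]; rewrite mulr_gt0 ?exprn_gt0 ?rscale_gt0 //.
by move: k; apply: ord5_all; rewrite inordK //=.
Qed.

(** The equation of the plane cutting off a cap is a positive multiple of the equation of its
    circle. The sign locates the domain outside the caps, the zero set the boundary, and the
    gradient the normal. *)
Lemma circle_stereo c z :
  rcap w (circle_face c).1 * stereo_norm r z -
    side (circle_face c).2 * stereo r (circle_face c).1 z =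
  circle_factor c * circle_eqn c z.
Proof.
have r0 := rscale_gt0 w1 sum_tv.
have q1 : 0 < 1 - rcap w (1 + 1).
  by have := rcapE (1 + 1); have := rcap0 (1 + 1); have := cap_lt1 w1 sum_tv (1 + 1); nra.
have rE : r ^+ 2 * (1 - rcap w (1 + 1)) = 1 + rcap w (1 + 1).
  rewrite sqr_sqrtr ?mulfVK ?gt_eqF // ltW // divr_gt0 // addr_gt0 //.
have s0 l : 0 <= 1 - rcap w l ^+ 2 by rewrite rcapE subr_ge0 ltW // cap_lt1.
have h0 := rcap0 0; have h1 := rcap0 1; have h2 := rcap0 (1 + 1).
have axis l x y e : e ^+ 2 = 1 -> rcap w l * (r ^+ 2 * (x ^+ 2 + y ^+ 2) + 1) - e * (2 * r * x) =
    r ^+ 2 * rcap w l * ((x - e * hole_dist r (rcap w l)) ^+ 2 + y ^+ 2 -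
      hole_rad r (rcap w l) ^+ 2).
  move=> e2; rewrite /hole_rad exprMn (sqr_sqrtr (s0 l)) /hole_dist.
  rewrite [(x - _) ^+ 2]sqrrB [(e / _) ^+ 2]exprMn e2 mul1r.
  by have := rcap0 l; move: r (rcap w l) r0 => R0 p r0 p0; field; rewrite !gt_eqF.
have center s : rcap w (1 + 1) * (r ^+ 2 * s + 1) - -1 * (r ^+ 2 * s - 1) =
    r ^+ 2 * (1 + rcap w (1 + 1)) * (s - (r ^+ 2)^-1 ^+ 2).
  transitivity (r ^+ 2 * (1 + rcap w (1 + 1)) * s - (1 + rcap w (1 + 1)) * (r ^+ 2)^-1).
    rewrite -[in X in _ = _ - X]rE.
    by move: r (rcap _ _) r0 => R0 q r0; field; rewrite !gt_eqF.
  by move: r (rcap _ _) r0 => R0 q r0; field; rewrite !gt_eqF.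
have outer s : rcap w (1 + 1) * (r ^+ 2 * s + 1) - 1 * (r ^+ 2 * s - 1) =
    (1 + rcap w (1 + 1)) * (1 - s).
  by rewrite [RHS]mulrBr mulr1 -[in X in _ = _ - X]rE; ring.
case: c => [k|]; last exact: outer.
have eN : (-1 : R) ^+ 2 = 1 by rewrite sqrrN expr1n.
rewrite /= !mxE /= /five_radius.
move: k; apply: ord5_all; rewrite inordK //= ?subr0 /stereo_norm /stereo /=.
- exact: center.
- by rewrite (axis 0 _ _ 1) ?expr1n // mul1r.
- by rewrite (axis 0 _ _ (-1)) // mulN1r.
- rewrite [z 0 0 ^+ 2 + _]addrC (axis 1 _ _ 1) ?expr1n // mul1r; congr (_ * (_ - _)); exact: addrC.
- rewrite [z 0 0 ^+ 2 + _]addrC (axis 1 _ _ (-1)) // mulN1r; congr (_ * (_ - _)); exact: addrC.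
Qed.

Lemma carrier_circle_eqn z c : carrier D z -> 0 <= circle_eqn c z.
Proof.
move=> [z1 zk]; case: c => [k|] /=; last first.
  by rewrite subr_ge0 -[X in _ <= X](expr1n _ 2) -enorm_le.
have := zk k; rewrite enorm_ge; last exact/ltW/hole_radius_gt0.
by rewrite !mxE subr_ge0.
Qed.

Lemma boundary_circle_eqn z c : boundary_component D c z -> circle_eqn c z = 0.
Proof.
case: c => [k|] /= zb; last by rewrite (enorm_eq ler01 zb) expr1n subrr.
have := enorm_eq (ltW (hole_radius_gt0 D k)) zb; rewrite !mxE => ->.
by rewrite subrr.
Qed.

Lemma carrier_inside z : carrier D z -> inside w r z.
Proof.
move=> zD l; have M0 := stereo_norm_gt0 r z.
have H c : 0 <= rcap w (circle_face c).1 * stereo_norm r z -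
    side (circle_face c).2 * stereo r (circle_face c).1 z.
  by rewrite circle_stereo mulr_ge0 ?carrier_circle_eqn // ltW // circle_factor_gt0.
have : `|stereo r l z| <= rcap w l * stereo_norm r z.
  have := H None; have := H (Some (inord 0)); have := H (Some (inord 1)).
  have := H (Some (inord 2)); have := H (Some (inord 3)); have := H (Some (inord 4)).
  rewrite /= !inordK //= /side !mul1r !mulN1r !opprK !subr_ge0 => h4 h3 h2 h1 h0 hN.
  have F (x y : R) : 0 <= y + x -> x <= y -> `|x| <= y by move=> ? ?; rewrite ler_norml; lra.
  by move: l; apply: ord3_all; apply: F.
by rewrite -rcapE -exprMn ler_norml => /andP[h1 h2]; nra.
Qed.

Lemma boundary_stereo z c : boundary_component D c z ->
  stereo r (circle_face c).1 z =
  side (circle_face c).2 * rcap w (circle_face c).1 * stereo_norm r z.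
Proof.
move=> /boundary_circle_eqn zb; have := circle_stereo c z; rewrite zb mulr0.
have := side_sqr (circle_face c).2; move: (side _) (rcap _ _) (stereo_norm _ _) (stereo _ _ _).
move=> e p m x e2 /eqP; rewrite subr_eq0 => /eqP E.
by rewrite -mulrA E mulrA -expr2 e2 mul1r.
Qed.

(** Derivative of [circle_stereo], the gradient of [circle_eqn] being -2 times [domain_normal]. *)
Lemma boundary_dstereo z v c :
  dstereo r (circle_face c).1 z v -
    side (circle_face c).2 * rcap w (circle_face c).1 * dstereo_norm r z v =
  side (circle_face c).2 * (2 * circle_factor c) * dotv v (domain_normal D c z).
Proof.
set e := side _; set i := (circle_face c).1.
have dc : has_D (circle_eqn c) z v (- (2 * dotv v (domain_normal D c z))).
  have h0 := has_D_coord 0 z v; have h1 := has_D_coord 1 z v.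
  have cst a := has_D_cst a z v; rewrite /dotv sum_ord2; case: c {e i} => [k|].
    have k0 := has_DD h0 (cst (- hole_center D k 0 0)).
    have k1 := has_DD h1 (cst (- hole_center D k 0 1)).
    apply: (has_D_eq (has_DD (has_DD (has_DM k0 k0) (has_DM k1 k1))
      (cst (- hole_radius D k ^+ 2)))).
    by rewrite [domain_normal _ _ _]/= !mxE; ring.
  apply: (has_D_eq (has_DD (cst 1) (has_DN (has_DD (has_DM h0 h0) (has_DM h1 h1))))).
  by rewrite /=; ring.
have dl : has_D (fun z => rcap w i * stereo_norm r z - e * stereo r i z) z v
    (rcap w i * dstereo_norm r z v - e * dstereo r i z v).
  apply: (has_D_eq (has_DD (has_DM (has_D_cst (rcap w i) z v) (has_D_stereo_norm r z v))
    (has_DN (has_DM (has_D_cst e z v) (has_D_stereo r i z v))))).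
  by move: (stereo_norm _ _) (stereo _ _ _) => *; ring.
have [_ E] : has_D (fun z => circle_factor c * circle_eqn c z) z v
    (rcap w i * dstereo_norm r z v - e * dstereo r i z v).
  by rewrite -(funext (circle_stereo c)).
have [_ E'] := has_DM (has_D_cst (circle_factor c) z v) dc.
have := etrans (esym E') E; rewrite mul0r add0r.
have := side_sqr (circle_face c).2; rewrite -/e.
move: (dotv _ _) (circle_factor c) (rcap w i) (dstereo_norm _ _ _) (dstereo _ _ _ _).
move=> n F p dm ds e2 H.
transitivity (- e * (p * dm - e * ds)); last by rewrite -H; ring.
by rewrite -[ds in LHS]mul1r -e2; ring.
Qed.

End BoundaryCircles.

(** * Every angle is realized by a midplane value *)

Section Angles.
Context {R : realType}.

Lemma exists_gam (d : R) : 0 < d < pi -> exists2 w, -1 < w < 1 & gam w = d.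
Proof.
move=> /andP[d0 dpi].
have ct : continuous (@tv R).
  by apply: continuous_derive => x; rewrite /tv /ev; eexists; repeat derive_step.
have le11 : -1 <= 1 :> R by lra.
have [|x xin xE] := IVT (v := pi / 2 - d) le11 (continuous_subspaceT ct).
  rewrite tvN tv1 minEle maxEle; have P0 := pi_gt0 R.
  rewrite (_ : - (pi / 2) <= pi / 2) /=; first by apply/andP; move: (pi : R) d0 dpi => P *; lra.
  by move: (pi : R) P0 => P *; lra.
exists x; last by rewrite /gam xE subKr.
move: xin; rewrite in_itv /= !le_eqVlt => /andP[/orP[/eqP x1|->] /orP[/eqP x2|->]] //.
- by move: x1 x2 => <-; lra.
- by move: xE; rewrite -x1 tvN tv1; move: (pi : R) d0 dpi => P *; lra.
- by move: xE; rewrite x2 tv1; move: (pi : R) d0 dpi => P *; lra.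
Qed.

End Angles.

Theorem theorem6p7 (R : realType) (a : 'I_3 -> R) (ha : forall i, 0 < a i) :
  exists (D : holed_disc R 5) (X : 'rV[R]_2 -> 'rV[R]_3) (S : set 'rV[R]_3),
    free_boundary_minimal a D X S /\
    forall b : option 'I_5,
      exists f : 'I_3 * bool, X @` boundary_component D b `<=` face_interior a f.
Proof.
have [d [lam [d0 dpi lam0 aE]]] := period_problem ha.
have /choice[w wP] l : exists w, -1 < w < 1 /\ gam w = d l.
  by have [w ? ?] := exists_gam (d0 l); exists w.
have w1 l : -1 < w l < 1 by have [] := wP l.
have sum_tv : \sum_l tv (w l) = pi / 2.
  have : \sum_l gam (w l) = pi by rewrite -dpi; apply: eq_bigr => l _; have [] := wP l.
  by rewrite !sum_ord3 /gam; move: (pi : R) => P; lra.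
have /choice[bx bxP] l : exists bx : R * (R -> R), [/\ 0 < bx.1, 1 + w l < bx.1 ^+ 2,
    forall x, - bx.1 < x < bx.1 -> 0 < Ap (w l) x,
    forall x, - bx.1 < x < bx.1 -> is_derive x 1 bx.2 (dxi (w l) x) & bx.2 0 = 0].
  by have [b [xi ?]] := exists_xi (w1 l); exists (b, xi).
pose b l := (bx l).1; pose xi l := (bx l).2.
have b0 l : 0 < b l by have [] := bxP l.
have wb l : 1 + w l < b l ^+ 2 by have [] := bxP l.
have Apos l x : - b l < x < b l -> 0 < Ap (w l) x by have [_ _ + _ _] := bxP l; exact.
have dxiP l x : - b l < x < b l -> is_derive x 1 (xi l) (dxi (w l) x).
  by have [_ _ _ + _] := bxP l; exact.
have xi0 l : xi l 0 = 0 by have [] := bxP l.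
have axi l : a l / 2 = lam * xi l (Num.sqrt (1 + w l)).
  have [_ gE] := wP l; rewrite aE -gE; congr (_ * _); apply/esym.
  exact: (xi_halfperiod (w1 l) (b0 l) (wb l) (@Apos l) (@dxiP l) (xi0 l)).
clearbody b xi; clear bxP.
have r0 := rscale_gt0 w1 sum_tv.
pose D := domain w1 sum_tv; pose X := rowf (Xcoord w a xi (rscale w) lam).
have Din z : carrier D z -> inside w (rscale w) z by exact: carrier_inside.
have Dreg z : carrier D z -> regular w b (rscale w) z.
  by move=> /Din zin; have [] := inside_regular w1 sum_tv b0 wb zin.
have on_face c z : boundary_component D c z ->
    [/\ X z 0 (circle_face c).1 = face_level a (circle_face c),
        forall j, j != (circle_face c).1 -> 0 < X z 0 j < a j,
        prism a (X z) &
        outward_unit_conormal X z (domain_normal D c z) (face_normal R (circle_face c))].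
  move=> zc; have zin := Din z (boundary_carrier zc).
  have e2 := @side_sqr R (circle_face c).2; have zi := boundary_stereo zc.
  split.
  - rewrite mxE (boundary_Xcoord w1 sum_tv b0 wb Apos dxiP xi0 axi zin e2 zi).
    by rewrite /face_level /side; case: (circle_face c).2; field.
  - move=> j ji; rewrite mxE.
    exact: (boundary_Xcoord_other w1 sum_tv b0 wb Apos dxiP lam0 xi0 axi ha zin e2 zi ji).
  - exact: (inside_prism w1 sum_tv b0 wb Apos dxiP lam0 xi0 axi ha zin).
  - have -> : face_normal R (circle_face c) =
        @side R (circle_face c).2 *: delta_mx 0 (circle_face c).1.
      by rewrite /face_normal /side; case: (circle_face c).2; rewrite ?scale1r ?scaleN1r.
    apply: (boundary_conormal a w1 sum_tv b0 wb Apos dxiP r0 lam0 zin e2 zi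
      (K := 2 * circle_factor w c)).
      by rewrite mulr_gt0 // circle_factor_gt0.
    by move=> v; exact: boundary_dstereo.
exists D, X, (X @` carrier D); split; last first.
  by move=> c; exists (circle_face c) => _ [z zc <-]; have [] := on_face c z zc.
split => //.
- by move=> _ [z /Din zin <-]; exact: (inside_prism w1 sum_tv b0 wb Apos dxiP lam0 xi0 axi ha zin).
- exists (regular w b (rscale w)); split; [exact: open_regular|exact: Dreg|].
  by apply: smooth_on_rowf; [exact: open_regular|move=> l n; exact: smooth_Xcoord].
- move=> z /Dreg hz; split; first exact: (immersive_X a w1 Apos dxiP r0 lam0 hz).
  exact: (mean_curvature_X a w1 sum_tv Apos dxiP r0 lam0 hz).
- move=> c z /on_face[Xi Xj Xp co]; split; first by exists (circle_face c).
  (* The point lies in the interior of its face, so no other face contains it. *)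
  move=> f [_ fX]; suff -> : f = circle_face c by [].
  have f1 : f.1 = (circle_face c).1.
    apply/eqP; apply: contraT => /Xj; rewrite fX /face_level.
    by case: ifP => _; rewrite ltxx ?andbF.
  apply/eqP; rewrite -pair_eqE /pair_eq f1 eqxx /=.
  move: fX; rewrite f1 Xi /face_level f1; have := ha (circle_face c).1.
  by case: (circle_face c).2; case: f.2 => // + E; rewrite E ltxx.
Qed.
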